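(* Let $c<d$ be real numbers, $T>0$, $g:\mathbb R\times\mathbb R\to\mathbb R$ and $h:[c,d]\to\mathbb R$. Consider the PDE for $u:[0,T]\times[c,d]\to\mathbb R$: $$u_t=u_{xx}+g(u,u_x)\ \text{ on }[0,T]\times(c,d),\qquad u_x=0\ \text{ on }[0,T]\times\{c,d\},\qquad u(0,x)=h(x)\ \text{ for }x\in(c,d).\qquad( * )$$ Assume there is a constant $A\in\mathbb R_+$ with $|h(x)-h(x')|\le A|x-x'|$ for all $x,x'\in[c,d]$, and that, with $C:=\sup_{c<x<d}|h(x)|$, there are constants $B,D\in\mathbb R_+$ and a nondecreasing function $\rho:\mathbb R_+\to\mathbb R_+$ such that $|g(y,z)-g(y',z)|\le B|y-y'|$, $|g(y,z)-g(y,z')|\le\rho(|z|\vee|z'|)|z-z'|$ and $|g(y,z)|\le D(1+|y|)+\rho(|z|)|z|$ for all $y,y'\in\mathbb R$ with $|y|,|y'|\le(C+1)e^{DT}-1$ and all $z,z'\in\mathbb R$. Then $( * )$ has a viscosity solution $u$ satisfying $$|u(t,x)|\le\Big(\sup_{c<x<d}|h(x)|+1\Big)e^{Dt}-1,\qquad(t,x)\in[0,T]\times[c,d].$$ Moreover, suppose that $g$ is continuous in $y$, that for every $L\in\mathbb R_+$ there exists a constant $\gamma_L\in\mathbb R$ such that $g(y',z)-g(y,z)\ge\gamma_L(y-y')$ for all $-L\le y'\le y\le L$ and $z\in\mathbb R$, and that $F(t,x,y,v,S):=-S-g(y,v)$ satisfies the following: for all $L,L'\in\mathbb R_+$ there is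 a function $\delta_{L,L'}:\mathbb R_+\to\mathbb R_+$ with $\lim_{x\downarrow0}\delta_{L,L'}(x)=0$ such that $$F(t,x',y,v',S')-F(t,x,y,v,S)\le\delta_{L,L'}\Big(\eta+|x-x'|(1+|v|\vee|v'|)+\frac{|x-x'|^2}{\varepsilon^2}\Big)$$ for all $\eta,\varepsilon\in(0,1]$, $t\in[0,T]$, $x,x'\in[c,d]$, $|y|\le L$, $v,v'\in\mathbb R$ and $S,S'\in\mathbb R$ satisfying $$-\frac{L'}{\varepsilon^2}Id\le\begin{pmatrix}S&0\\0&-S'\end{pmatrix}\le\frac{L'}{\varepsilon^2}\begin{pmatrix}1&-1\\-1&1\end{pmatrix}+L'\eta\,Id,\quad|v-v'|\le L'\eta\varepsilon(1+|v|\wedge|v'|),\quad|x-x'|\le L'\eta\varepsilon.$$ Then $u$ is the unique viscosity solution of $( * )$. If in addition $h\equiv0$ and $g$ is $C^1$, then $u$ is $C^{1,2}$ and satisfies $|u_x(t,x)|\le3Ae^{Bt}$ for all $(t,x)\in[0,T]\times[c,d]$.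
   Context: $C^{1,2}$ means once continuously differentiable in $t$ and twice in $x$; $Id$ is the $2\times2$ identity and matrix inequalities are in the usual order of symmetric matrices. Viscosity solution (standard, Neumann problem): $u$ is continuous on $[0,T]\times[c,d]$, $u(0,\cdot)=h$, and for each $C^{1,2}$ test function $\varphi$, with $\frac{\partial\varphi}{\partial n}$ the inward derivative ($\varphi_x$ at $c$, $-\varphi_x$ at $d$): if $u-\varphi$ has a local maximum at $(t,x)\in(0,T)\times[c,d]$, then $P:=\varphi_t(t,x)-\varphi_{xx}(t,x)-g(u(t,x),\varphi_x(t,x))\le0$ if $x\in(c,d)$ and $\min\{P,-\frac{\partial\varphi}{\partial n}(t,x)\}\le0$ if $x\in\{c,d\}$; if $u-\varphi$ has a local minimum there, then $P\ge0$ if $x\in(c,d)$ and $\max\{P,-\frac{\partial\varphi}{\partial n}(t,x)\}\ge0$ if $x\in\{c,d\}$. *)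

(* Defs.v *)
From HB Require Import structures.
From mathcomp Require Import all_boot all_order all_algebra.
From mathcomp Require Import all_classical all_reals all_analysis.

Set Implicit Arguments.
Unset Strict Implicit.
Unset Printing Implicit Defensive.

Import Order.TTheory GRing.Theory Num.Theory.
Import numFieldNormedType.Exports.

Local Open Scope classical_set_scope.
Local Open Scope ring_scope.

(* Functions on a subset of the line or of the plane are total functions of
   real arguments; only their values on that subset are ever used. *)

Definition rect {R : realType} (T c d : R) : set (R * R) :=
  [set` `[0, T]] `*` [set` `[c, d]].

(* C = sup_{c < x < d} |h x| *)
Definition sup_abs {R : realType} (c d : R) (h : R -> R) : R :=
  sup [set `|h x| | x in `]c, d[].

(* l is the derivative of f at x relative to D; at an endpoint of an interval D
   this is the one-sided derivative. *)
Definition has_deriv_within {R : realType} (D : set R) (f : R -> R) (x l : R)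
  : Prop :=
  (f y - f x) / (y - x) @[y --> within D x^'] --> l.

Definition cont_on {R : realType} (D : set (R * R)) (f : R -> R -> R) : Prop :=
  {within D, continuous (fun p : R * R => f p.1 p.2)}.

(* f is C^{1,2} on [0, T] x [c, d], with derivatives ft, fx, fxx *)
Definition is_C12 {R : realType} (T c d : R) (f ft fx fxx : R -> R -> R)
  : Prop :=
  [/\ [/\ cont_on (rect T c d) f, cont_on (rect T c d) ft,
          cont_on (rect T c d) fx & cont_on (rect T c d) fxx],
      forall t x : R, t \in `[0, T] -> x \in `[c, d] ->
        has_deriv_within `[0, T] (fun s => f s x) t (ft t x),
      forall t x : R, t \in `[0, T] -> x \in `[c, d] ->
        has_deriv_within `[c, d] (f t) x (fx t x) &
      forall t x : R, t \in `[0, T] -> x \in `[c, d] ->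
        has_deriv_within `[c, d] (fx t) x (fxx t x)].

Definition local_max_on {R : realType} (D : set (R * R)) (f : R * R -> R)
    (p : R * R) : Prop :=
  \forall q \near within D (nbhs p), f q <= f p.

Definition local_min_on {R : realType} (D : set (R * R)) (f : R * R -> R)
    (p : R * R) : Prop :=
  \forall q \near within D (nbhs p), f p <= f q.

(* derivative in the inward direction at x \in {c, d}, for a function whose
   space derivative at x is px *)
Definition inward_deriv {R : realType} (c x px : R) : R :=
  if x == c then px else - px.

(* Viscosity solution of u_t = u_xx + g (u, u_x) on [0, T] x [c, d] with zero
   Neumann boundary condition and initial value h. Local extrema are relative
   to [0, T] x [c, d]. *)
Definition viscosity_solution {R : realType} (T c d : R) (g : R -> R -> R)
    (h : R -> R) (u : R -> R -> R) : Prop :=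
  [/\ cont_on (rect T c d) u,
      forall x : R, x \in `[c, d] -> u 0 x = h x &
      forall phi phit phix phixx : R -> R -> R,
        is_C12 T c d phi phit phix phixx ->
        forall t x : R, t \in `]0, T[ -> x \in `[c, d] ->
        let P := phit t x - phixx t x - g (u t x) (phix t x) in
        let n := inward_deriv c x (phix t x) in
        (local_max_on (rect T c d) (fun p => u p.1 p.2 - phi p.1 p.2) (t, x) ->
          (x \in `]c, d[ -> P <= 0) /\
          (x = c \/ x = d -> Num.min P (- n) <= 0)) /\
        (local_min_on (rect T c d) (fun p => u p.1 p.2 - phi p.1 p.2) (t, x) ->
          (x \in `]c, d[ -> 0 <= P) /\
          (x = c \/ x = d -> 0 <= Num.max P (- n)))].

(* Loewner order (used for symmetric matrices only) *)
Definition loewner_le {R : realType} {n : nat} (M N : 'M[R]_n) : Prop :=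
  forall w : 'rV[R]_n, 0 <= (w *m (N - M) *m w^T) ord0 ord0.

Definition mx22 {R : realType} (m00 m01 m10 m11 : R) : 'M[R]_2 :=
  \matrix_(i < 2, j < 2)
    (if i == 0 then (if j == 0 then m00 else m01)
     else (if j == 0 then m10 else m11)).

(* F (t, x, y, v, S) = - S - g (y, v); t and x are dummy arguments *)
Definition Fop {R : realType} (g : R -> R -> R) (t x y v S : R) : R :=
  - S - g y v.

Definition structure_condition {R : realType} (T c d : R)
    (F : R -> R -> R -> R -> R -> R) : Prop :=
  forall L L' : R, 0 <= L -> 0 <= L' ->
  exists delta : R -> R,
    [/\ forall r : R, 0 <= r -> 0 <= delta r,
        delta r @[r --> 0^'+] --> 0 &
        forall eta eps t x x' y v v' S S' : R,
          eta \in `]0, 1] -> eps \in `]0, 1] ->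
          t \in `[0, T] -> x \in `[c, d] -> x' \in `[c, d] ->
          `|y| <= L ->
          loewner_le (- (L' / eps ^+ 2) *: 1%:M) (mx22 S 0 0 (- S')) ->
          loewner_le (mx22 S 0 0 (- S'))
            ((L' / eps ^+ 2) *: mx22 1 (- 1) (- 1) 1 + (L' * eta) *: 1%:M) ->
          `|v - v'| <= L' * eta * eps * (1 + Num.min `|v| `|v'|) ->
          `|x - x'| <= L' * eta * eps ->
          F t x' y v' S' - F t x y v S <=
            delta (eta + `|x - x'| * (1 + Num.max `|v| `|v'|)
                   + `|x - x'| ^+ 2 / eps ^+ 2)].

(* g is C^1 on the plane: both partial derivatives exist and are jointly
   continuous *)
Definition is_C1 {R : realType} (g : R -> R -> R) : Prop :=
  exists gy gz : R -> R -> R,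
    [/\ forall y z : R, is_derive y (1 : R) (fun y0 : R => g y0 z) (gy y z),
        forall y z : R, is_derive z (1 : R) (g y) (gz y z),
        continuous (fun p : R * R => gy p.1 p.2) &
        continuous (fun p : R * R => gz p.1 p.2)].

(* Main.v *)
(* After truncating g in both variables the source G is bounded, globally
   Lipschitz, and B-Lipschitz in its first variable. A monotone explicit finite
   difference scheme for u_t = u_xx + G (u, u_x), with the Neumann condition
   encoded by reflection at c and d, preserves the Lipschitz bound A e^{Bt} and
   the bound (C + 1) e^{Dt} - 1, and is Lipschitz in time; averaging its solution
   over small windows gives, for every eps > 0, a function of class C^{1,2} with
   u_x = 0 at c and d which solves the equation up to eps. Any subsolution is
   compared with such a smooth function by penalization, without doubling of
   variables. Hence the approximations converge uniformly, the limit is a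
   solution, and any solution of the original equation is the same limit; the
   truncation is removed because a test function touching an L-Lipschitz function
   has slope at most L there. If h = 0 the construction runs with A = 0, so u does
   not depend on x and solves y' = g (y, 0). *)
Require Import Defs.
From HB Require Import structures.
From mathcomp Require Import all_boot all_order all_algebra.
From mathcomp Require Import all_classical all_reals all_analysis.
From mathcomp Require Import ring lra.

Set Implicit Arguments.
Unset Strict Implicit.
Unset Printing Implicit Defensive.

Import Order.TTheory GRing.Theory Num.Theory.
Import numFieldNormedType.Exports.

Local Open Scope classical_set_scope.
Local Open Scope ring_scope.

(** * One-sided derivatives and continuity on a rectangle *)

Section Basics.
Context {R : realType}.
Implicit Types (D : set R) (f : R -> R) (x l : R).

(** Comparison with a $C^{1,2}$ function uses only its derivatives, but it requires smooth
    approximate solutions, and these have to be produced without parabolic regularity theory. The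
    obstacle is that [G] is nonlinear in the slope, so averaging does not commute with it; it does
    so up to a small error only if the slope of the discrete solution oscillates little over the
    averaging window. The scheme itself provides this: Lipschitz continuity in time and boundedness
    of [G] bound the second differences, and a Lipschitz function with bounded second differences
    has a slope of small oscillation. The slope bound [A * expR (B * (T + 1))] does not involve the
    Lipschitz constant of [G] in the slope, so truncating at that level is not circular; [T + 1]
    leaves room for the steps that run past [T]. A competing solution is not known to be Lipschitz
    or to obey the growth bound. It is therefore compared under the original [g], but only slopes
    within 1 of those of the approximant occur. *)

Lemma has_deriv_withinP D f x l :
  has_deriv_within D f x l <->
  forall e : R, 0 < e -> exists2 r : R, 0 < r & forall y, D y -> `|y - x| < r ->
    `|f y - f x - l * (y - x)| <= e * `|y - x|.
Proof.
split=> [Dfl e e0|H].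
- move/cvgrPdist_le : Dfl => /(_ e e0) /nbhs_ballP[r /= r0 H].
  exists r => // y Dy yxr; have [->|yx] := eqVneq y x.
    by rewrite !subrr mulr0 subrr normr0 mulr0.
  have yx0 : y - x != 0 by rewrite subr_eq0.
  have -> : f y - f x - l * (y - x) = - (l - (f y - f x) / (y - x)) * (y - x).
    by field.
  rewrite normrM normrN ler_wpM2r//; apply: H => //.
  by rewrite /ball /= distrC.
- apply/cvgrPdist_le => e e0; have [r r0 H'] := H e e0.
  apply/nbhs_ballP; exists r => //= y.
  rewrite /ball /= distrC => yxr yx Dy.
  have yx0 : y - x != 0 by rewrite subr_eq0.
  have -> : l - (f y - f x) / (y - x) = - ((f y - f x - l * (y - x)) / (y - x)).
    by field.
  by rewrite normrN normrM normfV ler_pdivrMr ?normr_gt0// H'.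
Qed.

Lemma is_derive_has_deriv_within D f x l :
  is_derive x (1 : R) f l -> has_deriv_within D f x l.
Proof.
move=> [dfx dfl]; apply/has_deriv_withinP => e e0.
have : h^-1 *: ((f \o shift x) (h *: (1:R)) - f x) @[h --> 0^'] --> l.
  by rewrite -dfl; exact: dfx.
move=> /cvgrPdist_le /(_ e e0) /nbhs_ballP[r /= r0 H].
exists r => // y _ yxr; have [->|yx] := eqVneq y x.
  by rewrite !subrr mulr0 subrr normr0 mulr0.
have yx0 : y - x != 0 by rewrite subr_eq0.
have := H (y - x); rewrite /ball /= sub0r normrN => /(_ yxr yx0).
rewrite /GRing.scale /= mulr1 subrK => H1.
have -> : f y - f x - l * (y - x) = - (l - (y - x)^-1 * (f y - f x)) * (y - x).
  by field.
by rewrite normrM normrN ler_wpM2r.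
Qed.

Lemma has_deriv_within_is_derive f x l :
  has_deriv_within setT f x l -> is_derive x (1 : R) f l.
Proof.
move=> /has_deriv_withinP H.
have H1 : h^-1 *: ((f \o shift x) (h *: (1:R)) - f x) @[h --> 0^'] --> l.
  apply/cvgrPdist_le => e e0; have [r r0 H'] := H e e0.
  apply/nbhs_ballP; exists r => //= y.
  rewrite /ball /= sub0r normrN => yr y0.
  have := H' (y + x) I; rewrite addrK => /(_ yr).
  rewrite /GRing.scale /= mulr1 => H2.
  have -> : l - y^-1 * (f (y + x) - f x) = - (f (y + x) - f x - l * y) / y.
    by field.
  by rewrite normrM normrN normfV ler_pdivrMr ?normr_gt0.
apply: DeriveDef; first by apply/cvg_ex; exists l.
exact/cvg_lim.
Qed.

Lemma has_deriv_within_nbhs D f x l (r : R) :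
  0 < r -> (forall y, `|y - x| < r -> D y) ->
  has_deriv_within D f x l -> has_deriv_within setT f x l.
Proof.
move=> r0 rD /has_deriv_withinP H; apply/has_deriv_withinP => e e0.
have [s s0 Hs] := H e e0; exists (Num.min r s); first by rewrite lt_min r0.
by move=> y _; rewrite lt_min => /andP[yr ys]; apply: Hs => //; exact: rD.
Qed.

Lemma has_deriv_withinW (D D' : set R) f x l : D' `<=` D ->
  has_deriv_within D f x l -> has_deriv_within D' f x l.
Proof.
move=> sub /has_deriv_withinP H; apply/has_deriv_withinP => e e0.
by have [r r0 Hr] := H e e0; exists r => // y /sub; exact: Hr.
Qed.

Lemma cont_onP (D : set (R * R)) (f : R -> R -> R) :
  cont_on D f <->
  forall t x, D (t, x) -> forall e : R, 0 < e -> exists2 r : R, 0 < r &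
    forall s y, D (s, y) -> `|s - t| < r -> `|y - x| < r ->
      `|f s y - f t x| <= e.
Proof.
rewrite /cont_on; split => [/subspace_continuousP H t x Dtx e e0|H].
- have /cvgrPdist_le /(_ e e0) := H _ Dtx.
  move=> /nbhs_ballP[r /= r0 Hr]; exists r => // s y Dsy st yx.
  by rewrite distrC; apply: (Hr (s, y)) => //; split; rewrite /ball /= distrC.
- apply/subspace_continuousP => -[t x] Dtx.
  apply/cvgrPdist_le => e e0; have [r r0 Hr] := H _ _ Dtx _ e0.
  apply/nbhs_ballP; exists r => //= -[s y] /= [].
  rewrite /ball /= => st yx Dsy; rewrite distrC; apply: Hr => //.
    by rewrite distrC.
  by rewrite distrC.
Qed.

Lemma local_max_onP (D : set (R * R)) (f : R * R -> R) (t x : R) :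
  local_max_on D f (t, x) <->
  exists2 r : R, 0 < r & forall s y, D (s, y) -> `|s - t| < r -> `|y - x| < r ->
      f (s, y) <= f (t, x).
Proof.
split => [/nbhs_ballP[r /= r0 Hr]|[r r0 Hr]].
- exists r => // s y Dsy st yx.
  by apply: (Hr (s, y)) => //; split; rewrite /ball /= distrC.
- apply/nbhs_ballP; exists r => //= -[s y] [].
  by rewrite /ball /= => st yx Dsy; apply: Hr => //; rewrite distrC.
Qed.

Lemma has_deriv_within_continuous (a b : R) f (f' : R -> R) : a < b ->
  (forall x, x \in `[a, b] -> has_deriv_within `[a, b] f x (f' x)) ->
  {within `[a, b], continuous f}.
Proof.
move=> ab H; apply/subspace_continuousP => x /= xab.
apply/cvgrPdist_le => e e0.
have := H x xab; move=> /has_deriv_withinP /(_ 1 ltr01)[r r0 Hr].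
apply/nbhs_ballP.
pose M : R := `|f' x| + 2.
have M0 : 0 < M by rewrite ltr_wpDl.
exists (Num.min r (e / M)) => /=.
  by rewrite lt_min r0 divr_gt0.
move=> y; rewrite /ball /= distrC lt_min => /andP[yr ye] yab.
have := Hr y yab yr; rewrite mul1r => h1.
have h2 : `|f y - f x| <= `|f' x| * `|y - x| + `|y - x|.
  rewrite -(subrK (f' x * (y - x)) (f y - f x)) (le_trans (ler_normD _ _))//.
  by rewrite normrM addrC lerD2l.
rewrite distrC; apply: (le_trans h2).
move: ye; rewrite ltr_pdivlMr// => ye.
have : 0 <= `|y - x| by [].
rewrite /M in ye; nra.
Qed.

Lemma mean_value (a b : R) f (f' : R -> R) : a < b ->
  (forall x, x \in `[a, b] -> has_deriv_within `[a, b] f x (f' x)) ->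
  exists2 x, x \in `]a, b[ & f b - f a = f' x * (b - a).
Proof.
move=> ab H; apply: MVT => //; last exact: (has_deriv_within_continuous ab H).
move=> x xab; apply: has_deriv_within_is_derive.
move: xab; rewrite in_itv /= => /andP[ax xb].
apply: (@has_deriv_within_nbhs `[a, b] _ _ _ (Num.min (x - a) (b - x))).
- by rewrite lt_min !subr_gt0 ax.
- move=> y; rewrite lt_min => /andP[]; rewrite !ltr_norml => /andP[? ?] /andP[? ?].
  by rewrite /= in_itv /=; apply/andP; split; lra.
- by apply: H; rewrite in_itv /= !ltW.
Qed.

End Basics.

(** * Extremum tests, and closure properties of continuous and $C^{1,2}$ functions *)

Section Calculus.
Context {R : realType}.
Implicit Types (D : set R) (f g : R -> R) (x l : R).

Lemma has_deriv_within_lin D f g x l l' (k : R) :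
  has_deriv_within D f x l -> has_deriv_within D g x l' ->
  has_deriv_within D (fun y => f y + k * g y) x (l + k * l').
Proof.
move=> /has_deriv_withinP Hf /has_deriv_withinP Hg.
apply/has_deriv_withinP => e e0.
have e2 : 0 < e / 2 by rewrite divr_gt0.
have k0 : 0 < e / 2 / (`|k| + 1) by rewrite divr_gt0// ltr_wpDl.
have [r r0 Hr] := Hf _ e2; have [s s0 Hs] := Hg _ k0.
exists (Num.min r s); first by rewrite lt_min r0.
move=> y Dy; rewrite lt_min => /andP[/(Hr y Dy) h1 /(Hs y Dy) h2].
have -> : f y + k * g y - (f x + k * g x) - (l + k * l') * (y - x) =
  (f y - f x - l * (y - x)) + k * (g y - g x - l' * (y - x)) by ring.
rewrite (le_trans (ler_normD _ _))// normrM.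
have h3 : `|k| * `|g y - g x - l' * (y - x)| <= e / 2 * `|y - x|.
  apply: (@le_trans _ _ (`|k| * (e / 2 / (`|k| + 1) * `|y - x|))).
    by rewrite ler_wpM2l.
  rewrite mulrA ler_wpM2r// mulrCA ger_pMr// ler_pdivrMr ?mul1r ?lerDl//.
lra.
Qed.

Lemma deriv_le0_right D f x l (r : R) : 0 < r ->
  (forall y, x < y -> y < x + r -> D y /\ f y <= f x) ->
  has_deriv_within D f x l -> l <= 0.
Proof.
move=> r0 H /has_deriv_withinP Hf; rewrite leNgt; apply/negP => l0.
have l2 : 0 < l / 2 by rewrite divr_gt0.
have [s s0 Hs] := Hf _ l2.
pose h := Num.min (r / 2) (s / 2).
have h0 : 0 < h by rewrite lt_min !divr_gt0.
have hr : h <= r / 2 by rewrite ge_min lexx.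
have hs : h <= s / 2 by rewrite ge_min lexx orbT.
have [||Dy fy] := H (x + h); [lra|lra|].
have := Hs _ Dy; have -> : x + h - x = h by ring.
rewrite (gtr0_norm h0) => /(_ ltac:(lra)); rewrite ler_norml => /andP[].
nra.
Qed.

Lemma deriv_ge0_left D f x l (r : R) : 0 < r ->
  (forall y, x - r < y -> y < x -> D y /\ f y <= f x) ->
  has_deriv_within D f x l -> 0 <= l.
Proof.
move=> r0 H /has_deriv_withinP Hf; rewrite leNgt; apply/negP => l0.
have l2 : 0 < - l / 2 by rewrite divr_gt0// oppr_gt0.
have [s s0 Hs] := Hf _ l2.
pose h := Num.min (r / 2) (s / 2).
have h0 : 0 < h by rewrite lt_min !divr_gt0.
have hr : h <= r / 2 by rewrite ge_min lexx.
have hs : h <= s / 2 by rewrite ge_min lexx orbT.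
have [||Dy fy] := H (x - h); [lra|lra|].
have := Hs _ Dy; have -> : x - h - x = - h by ring.
rewrite normrN (gtr0_norm h0) => /(_ ltac:(lra)); rewrite ler_norml => /andP[].
nra.
Qed.

Lemma deriv_eq0_max D f x l (r : R) : 0 < r ->
  (forall y, `|y - x| < r -> D y /\ f y <= f x) ->
  has_deriv_within D f x l -> l = 0.
Proof.
move=> r0 H Hf; apply: le_anti; apply/andP; split.
  apply: (deriv_le0_right r0 _ Hf) => y xy yr; apply: H.
  by rewrite ltr_norml; apply/andP; split; lra.
apply: (deriv_ge0_left r0 _ Hf) => y xy yr; apply: H.
by rewrite ltr_norml; apply/andP; split; lra.
Qed.

(** If [l > 0], then [f' x = 0] forces [f' y >= (l / 2) (y - x) > 0] just to the right of [x], and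
    by the mean value theorem [f] increases there, against the maximum. *)
Lemma deriv2_le0_max (c d : R) f (f' : R -> R) x l (r : R) : 0 < r ->
  (forall y, `|y - x| < r -> y \in `[c, d] /\ f y <= f x) ->
  (forall y, y \in `[c, d] -> has_deriv_within `[c, d] f y (f' y)) ->
  has_deriv_within `[c, d] f' x l -> l <= 0.
Proof.
move=> r0 H Hf Hf'; have xcd : x \in `[c, d].
  by have [] := H x; rewrite ?subrr ?normr0.
have f'x : f' x = 0 by apply: (deriv_eq0_max r0 H); exact: Hf.
rewrite leNgt; apply/negP => l0.
have l2 : 0 < l / 2 by rewrite divr_gt0.
move/has_deriv_withinP : Hf' => /(_ _ l2)[s s0 Hs].
pose h := Num.min (r / 2) (s / 2).
have h0 : 0 < h by rewrite lt_min !divr_gt0.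
have hr : h <= r / 2 by rewrite ge_min lexx.
have hs : h <= s / 2 by rewrite ge_min lexx orbT.
have xh : x < x + h by rewrite ltrDl.
have near y : x <= y -> y <= x + h -> `|y - x| < r /\ `|y - x| < s.
  by move=> ? ?; rewrite !ltr_norml; split; apply/andP; split; lra.
have sub : `[x, x + h]%classic `<=` (`[c, d]%classic : set R).
  move=> y /=; rewrite in_itv /= => /andP[xy yx].
  by have [/H[]] := near y xy yx.
have [|y] := @mean_value R x (x + h) f f' xh.
  by move=> y yx; apply: (has_deriv_withinW sub); apply: Hf; exact: sub.
rewrite in_itv /= => /andP[xy yx].
have [nr ns] := near y (ltW xy) (ltW yx).
have := Hs y (H _ nr).1 ns; rewrite f'x subr0.
have y0 : 0 < y - x by lra.
rewrite (gtr0_norm y0) ler_norml => /andP[h1 _].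
have f'y : 0 < f' y by nra.
have [_ fxh] : x + h \in `[c, d] /\ f (x + h) <= f x.
  by apply: H; apply: (near _ _ _).1; lra.
have -> : x + h - x = h by ring.
move=> h2; have : 0 < f' y * h by rewrite mulr_gt0.
lra.
Qed.

Lemma cont_on_lin (D : set (R * R)) (f g : R -> R -> R) (k : R) :
  cont_on D f -> cont_on D g -> cont_on D (fun t x => f t x + k * g t x).
Proof.
move=> /cont_onP Hf /cont_onP Hg; apply/cont_onP => t x Dtx e e0.
have e2 : 0 < e / 2 by rewrite divr_gt0.
have k0 : 0 < e / 2 / (`|k| + 1) by rewrite divr_gt0// ltr_wpDl.
have [r r0 Hr] := Hf _ _ Dtx _ e2; have [s s0 Hs] := Hg _ _ Dtx _ k0.
exists (Num.min r s); first by rewrite lt_min r0.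
move=> t' y Dy; rewrite !lt_min => /andP[tr ts] /andP[yr ys].
have h1 := Hr _ _ Dy tr yr; have h2 := Hs _ _ Dy ts ys.
have -> : f t' y + k * g t' y - (f t x + k * g t x) =
  (f t' y - f t x) + k * (g t' y - g t x) by ring.
rewrite (le_trans (ler_normD _ _))// normrM.
have h3 : `|k| * `|g t' y - g t x| <= e / 2.
  apply: (@le_trans _ _ (`|k| * (e / 2 / (`|k| + 1)))).
    by rewrite ler_wpM2l.
  rewrite mulrCA ger_pMr// ler_pdivrMr ?mul1r ?lerDl//.
lra.
Qed.

Lemma cont_on_sum (D : set (R * R)) (p q : R -> R) :
  continuous p -> continuous q -> cont_on D (fun t x => p t + q x).
Proof.
move=> cp cq; apply/cont_onP => t x Dtx e e0.
have e2 : 0 < e / 2 by rewrite divr_gt0.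
have /cvgrPdist_le /(_ _ e2) /nbhs_ballP[r /= r0 Hr] := cp t.
have /cvgrPdist_le /(_ _ e2) /nbhs_ballP[s /= s0 Hs] := cq x.
exists (Num.min r s); first by rewrite lt_min r0.
move=> t' y Dy; rewrite !lt_min => /andP[tr ts] /andP[yr ys].
have := Hr t'; rewrite /ball /= distrC => /(_ tr) h1.
have := Hs y; rewrite /ball /= distrC => /(_ ys) h2.
have -> : p t' + q y - (p t + q x) = (p t' - p t) + (q y - q x) by ring.
rewrite (le_trans (ler_normD _ _))//.
by rewrite (distrC (p t')) (distrC (q y)); lra.
Qed.

Lemma is_C12_lin (T c d k : R) (f ft fx fxx g gt gx gxx : R -> R -> R) :
  is_C12 T c d f ft fx fxx -> is_C12 T c d g gt gx gxx ->
  is_C12 T c d (fun t x => f t x + k * g t x)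
    (fun t x => ft t x + k * gt t x) (fun t x => fx t x + k * gx t x)
    (fun t x => fxx t x + k * gxx t x).
Proof.
move=> [[f1 f2 f3 f4] f5 f6 f7] [[g1 g2 g3 g4] g5 g6 g7].
split; first by split; exact: cont_on_lin.
- by move=> t x tT xcd; apply: has_deriv_within_lin; [exact: f5|exact: g5].
- by move=> t x tT xcd; apply: has_deriv_within_lin; [exact: f6|exact: g6].
- by move=> t x tT xcd; apply: has_deriv_within_lin; [exact: f7|exact: g7].
Qed.

Lemma is_C12_sum (T c d : R) (p p' q q' q'' : R -> R) :
  (forall t : R, is_derive t (1 : R) p (p' t)) -> continuous p' ->
  (forall x : R, is_derive x (1 : R) q (q' x)) ->
  (forall x : R, is_derive x (1 : R) q' (q'' x)) -> continuous q'' ->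
  is_C12 T c d (fun t x => p t + q x) (fun t _ => p' t) (fun _ x => q' x)
    (fun _ x => q'' x).
Proof.
move=> dp cp' dq dq' cq''.
have dcont (f f' : R -> R) : (forall x : R, is_derive x (1 : R) f (f' x)) -> continuous f.
  move=> df x; apply: differentiable_continuous.
  by apply/derivable1_diffP; case: (df x).
have c0 : continuous (cst 0 : R -> R) by move=> x; exact: cvg_cst.
split; first split.
- by apply: cont_on_sum; [exact: dcont dp|exact: dcont dq].
- have := cont_on_sum (D := rect T c d) cp' c0; congr cont_on.
  by apply/funext => t; apply/funext => x; rewrite addr0.
- have := cont_on_sum (D := rect T c d) c0 (dcont _ _ dq'); congr cont_on.
  by apply/funext => t; apply/funext => x; rewrite add0r.
- have := cont_on_sum (D := rect T c d) c0 cq''; congr cont_on.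
  by apply/funext => t; apply/funext => x; rewrite add0r.
- move=> t x tT xcd; apply: is_derive_has_deriv_within.
  have -> : (fun s => p s + q x) = p \+ cst (q x) by [].
  by rewrite -[X in is_derive _ _ _ X]addr0; exact: is_deriveD.
- move=> t x tT xcd; apply: is_derive_has_deriv_within.
  have -> : (fun s => p t + q s) = cst (p t) \+ q by [].
  by rewrite -[X in is_derive _ _ _ X]add0r; exact: is_deriveD.
- by move=> t x tT xcd; exact: is_derive_has_deriv_within.
Qed.

Lemma rectangle_max (a b c d : R) (f : R -> R -> R) : a <= b -> c <= d ->
  cont_on (`[a, b]%classic `*` `[c, d]%classic) f ->
  exists t x, [/\ t \in `[a, b], x \in `[c, d] &
    forall s y, s \in `[a, b] -> y \in `[c, d] -> f s y <= f t x].
Proof.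
move=> ab cd cf.
have [||[t x]] := @compact_EVT_max _ R (fun p => f p.1 p.2)
    (`[a, b]%classic `*` `[c, d]%classic) _ _ cf.
- by exists (a, c) => /=; split; rewrite /= in_itv /= lexx.
- by apply: compact_setX; exact: segment_compact.
- rewrite inE => -[/= tab xcd] H; exists t, x; split => // s y sab ycd.
  by apply: (H (s, y)); rewrite inE.
Qed.

Lemma cont_on_sub (D D' : set (R * R)) (f : R -> R -> R) : D' `<=` D ->
  cont_on D f -> cont_on D' f.
Proof.
move=> sub /cont_onP H; apply/cont_onP => t x Dtx e e0.
have [r r0 Hr] := H _ _ (sub _ Dtx) _ e0.
by exists r => // s y /sub; exact: Hr.
Qed.

Lemma cont_on_bounded (T c d : R) (f : R -> R -> R) : 0 <= T -> c <= d ->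
  cont_on (rect T c d) f ->
  exists2 M : R, 0 <= M & forall t x, t \in `[0, T] -> x \in `[c, d] ->
    `|f t x| <= M.
Proof.
move=> T0 cd cf.
have [t [x [_ _ H]]] := rectangle_max T0 cd cf.
have cf' : cont_on (rect T c d) (fun t x => - f t x).
  (* Negation is obtained as [f + (-2) f], from closure under linear combinations; the device recurs
     below. *)
  have := cont_on_lin (k := -2) cf cf; congr cont_on.
  by apply/funext => s; apply/funext => y; ring.
have [t' [x' [_ _ H']]] := rectangle_max T0 cd cf'.
exists (`|f t x| + `|f t' x'|); first by rewrite addr_ge0.
move=> s y sT ycd; have h1 := H _ _ sT ycd; have h2 := H' _ _ sT ycd.
have := ler_norm (f t x); have := ler_norm (- f t' x').
rewrite normrN => h3 h4; have := normr_ge0 (f t x); have := normr_ge0 (f t' x').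
by move=> h5 h6; rewrite ler_norml; apply/andP; split; lra.
Qed.

End Calculus.

(** * Subsolutions and comparison *)

Section Viscosity.
Context {R : realType}.
Variables (T c d : R).
Hypotheses (T0 : 0 < T) (cd : c < d).
Implicit Types (g : R -> R -> R) (eps : R) (v : R -> R -> R).

(** The boundary condition min <= 0 is stated as a disjunction. The tolerance [eps] concerns the
    equation only, not the boundary alternative, so that approximate solutions are covered; initial
    values are kept apart. *)
Definition subsolution g eps v : Prop :=
  forall phi phit phix phixx : R -> R -> R, is_C12 T c d phi phit phix phixx ->
  forall t x : R, t \in `]0, T[ -> x \in `[c, d] ->
  local_max_on (rect T c d) (fun p => v p.1 p.2 - phi p.1 p.2) (t, x) ->
  phit t x - phixx t x - g (v t x) (phix t x) <= eps \/
  (x = c \/ x = d) /\ - inward_deriv c x (phix t x) <= 0.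

(* u is a supersolution for g if and only if - u is a subsolution for
   reflect_source g. *)
Definition reflect_source g (y z : R) : R := - g (- y) (- z).

Lemma is_C12N (f ft fx fxx : R -> R -> R) : is_C12 T c d f ft fx fxx ->
  is_C12 T c d (fun t x => - f t x) (fun t x => - ft t x)
    (fun t x => - fx t x) (fun t x => - fxx t x).
Proof.
move=> H; have := is_C12_lin (-2) H H; congr is_C12;
  by apply/funext => t; apply/funext => x; ring.
Qed.

Lemma inward_derivN (x p : R) : inward_deriv c x (- p) = - inward_deriv c x p.
Proof. by rewrite /inward_deriv; case: ifP. Qed.

Lemma viscosity_solutionP g (h : R -> R) (u : R -> R -> R) :
  viscosity_solution T c d g h u <->
  [/\ cont_on (rect T c d) u, forall x, x \in `[c, d] -> u 0 x = h x,
      subsolution g 0 u &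
      subsolution (reflect_source g) 0 (fun t x => - u t x)].
Proof.
have sub (x : R) : x \in `[c, d] -> (x \in `]c, d[) \/ (x = c \/ x = d).
  rewrite !in_itv /= => /andP[]; rewrite !le_eqVlt.
  by move=> /predU1P[->|->]; [right; left|move=> /predU1P[->|->]; [right; right|left]].
have nsub (x : R) : x \in `]c, d[ -> ~ (x = c \/ x = d).
  by rewrite in_itv /= => /andP[+ +] [|] xE; rewrite xE ltxx.
split => -[cu u0].
- move=> H; split => //.
  + move=> phi pt px pxx Cphi t x tT xcd lmax.
    have [/(_ lmax)[h1 h2] _] := H _ _ _ _ Cphi t x tT xcd.
    have [/h1|xb] := sub x xcd; first by left.
    by have := h2 xb; rewrite ge_min => /orP[]; [left|right].
  + move=> phi pt px pxx Cphi t x tT xcd lmax.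
    have lmin : local_min_on (rect T c d)
        (fun p => u p.1 p.2 - - phi p.1 p.2) (t, x).
      by apply: filterS lmax => -[s y] /=; lra.
    have [_ /(_ lmin)[]] := H _ _ _ _ (is_C12N Cphi) t x tT xcd.
    rewrite inward_derivN => h1 h2; rewrite /reflect_source (opprK (u t x)).
    have [/h1|xb] := sub x xcd; first by left; lra.
    have := h2 xb; rewrite le_max => /orP[h3|h3]; first by left; lra.
    by right; split => //; lra.
- move=> H1 H2; split => // phi pt px pxx Cphi t x tT xcd P n; split => lm.
  + have := H1 _ _ _ _ Cphi t x tT xcd lm; rewrite -/P -/n => -[hP|[xb hn]].
      by split => // _; rewrite ge_min hP.
    by split => [/nsub//|_]; rewrite ge_min hn orbT.
  + have lmax : local_max_on (rect T c d)
        (fun p => - u p.1 p.2 - - phi p.1 p.2) (t, x).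
      by apply: filterS lm => -[s y] /=; lra.
    have := H2 _ _ _ _ (is_C12N Cphi) t x tT xcd lmax.
    rewrite inward_derivN opprK -/n /reflect_source !opprK => -[hP|[xb hn]].
      have P0 : 0 <= P by rewrite /P; lra.
      by split => // _; rewrite le_max P0.
    by split => [/nsub//|_]; rewrite le_max; apply/orP; right; lra.
Qed.

Lemma itv_oo_near (a b x : R) : x \in `]a, b[ ->
  exists2 r : R, 0 < r & forall y, `|y - x| < r -> y \in `[a, b].
Proof.
rewrite in_itv /= => /andP[ax xb]; exists (Num.min (x - a) (b - x)).
  by rewrite lt_min !subr_gt0 ax.
move=> y; rewrite lt_min => /andP[]; rewrite !ltr_norml => /andP[? ?] /andP[? ?].
by rewrite in_itv /=; apply/andP; split; lra.
Qed.

Lemma classical_subsolution g eps (f ft fx fxx : R -> R -> R) :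
  is_C12 T c d f ft fx fxx ->
  (forall t, t \in `[0, T] -> fx t c = 0 /\ fx t d = 0) ->
  (forall t x, t \in `[0, T] -> x \in `[c, d] ->
     ft t x - fxx t x - g (f t x) (fx t x) <= eps) ->
  subsolution g eps f.
Proof.
move=> Cf fN Hf p pt px pxx Cp t x tT xcd.
move=> /local_max_onP[/= r r0 Hr].
have tT' : t \in `[0, T] by move: tT; rewrite !in_itv /= => /andP[/ltW -> /ltW ->].
have := is_C12_lin (-1) Cf Cp.
set k := fun t x => f t x + -1 * p t x => -[_ Dt Dx Dxx].
have Hr' s y : s \in `[0, T] -> y \in `[c, d] -> `|s - t| < r -> `|y - x| < r ->
    k s y <= k t x.
  by move=> sT ycd st yx; have := Hr s y (conj sT ycd) st yx; rewrite /k; lra.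
have [q q0 Hq] := itv_oo_near tT.
have kt : ft t x + -1 * pt t x = 0.
  apply: (@deriv_eq0_max _ `[0, T] (k ^~ x) t _ (Num.min r q)).
  - by rewrite lt_min r0.
  - move=> s; rewrite lt_min => /andP[sr /Hq sT]; split => //.
    by apply: Hr' => //; rewrite subrr normr0.
  - exact: Dt.
have [xc|xc] := eqVneq x c.
  right; split; first by left.
  rewrite /inward_deriv xc eqxx oppr_le0.
  have : fx t c + -1 * px t c <= 0.
    apply: (@deriv_le0_right _ `[c, d] (k t) c _ (Num.min r (d - c))).
    - by rewrite lt_min r0 subr_gt0.
    - move=> y cy yr; have [yr1 yr2] : y < c + r /\ y < d.
        have : Num.min r (d - c) <= r by rewrite ge_min lexx.
        have : Num.min r (d - c) <= d - c by rewrite ge_min lexx orbT.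
        by move=> ? ?; split; lra.
      have ycd : y \in `[c, d] by rewrite in_itv /=; apply/andP; split; lra.
      split => //; rewrite -xc; apply: Hr' => //; rewrite ?subrr ?normr0 ?xc//.
      by rewrite ltr_norml; apply/andP; split; lra.
    - by have := Dx t x tT' xcd; rewrite xc.
  by rewrite (fN t tT').1; lra.
have [xd|xd] := eqVneq x d.
  right; split; first by right.
  rewrite /inward_deriv xd (gt_eqF cd) opprK.
  have : 0 <= fx t d + -1 * px t d.
    apply: (@deriv_ge0_left _ `[c, d] (k t) d _ (Num.min r (d - c))).
    - by rewrite lt_min r0 subr_gt0.
    - move=> y cy yr; have [yr1 yr2] : d - r < y /\ c < y.
        have : Num.min r (d - c) <= r by rewrite ge_min lexx.
        have : Num.min r (d - c) <= d - c by rewrite ge_min lexx orbT.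
        by move=> ? ?; split; lra.
      have ycd : y \in `[c, d] by rewrite in_itv /=; apply/andP; split; lra.
      split => //; rewrite -xd; apply: Hr' => //; rewrite ?subrr ?normr0 ?xd//.
      by rewrite ltr_norml; apply/andP; split; lra.
    - by have := Dx t x tT' xcd; rewrite xd.
  by rewrite (fN t tT').2; lra.
left.
have xcd' : x \in `]c, d[.
  by move: xcd; rewrite !in_itv /= !le_eqVlt (eq_sym c) (negbTE xc) (negbTE xd).
have [q' q'0 Hq'] := itv_oo_near xcd'.
have Hmax y : `|y - x| < Num.min r q' -> y \in `[c, d] /\ k t y <= k t x.
  rewrite lt_min => /andP[yr /Hq' ycd]; split => //.
  by apply: Hr' => //; rewrite subrr normr0.
have r'0 : 0 < Num.min r q' by rewrite lt_min r0.
have kx : fx t x + -1 * px t x = 0.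
  by apply: (deriv_eq0_max r'0 Hmax); exact: Dx.
have kxx : fxx t x + -1 * pxx t x <= 0.
  apply: (deriv2_le0_max r'0 Hmax _ (Dxx t x tT' xcd)).
  by move=> y ycd; exact: Dx.
have := Hf t x tT' xcd.
have -> : px t x = fx t x by lra.
lra.
Qed.

(** Test functions touch only at times in the open interval, so estimates are proved for [t < T] and
    carried to [T] by continuity. *)
Lemma rect_continuous_ext (f : R -> R -> R) (M : R) : cont_on (rect T c d) f ->
  (forall t x, 0 <= t -> t < T -> x \in `[c, d] -> f t x <= M) ->
  forall t x, t \in `[0, T] -> x \in `[c, d] -> f t x <= M.
Proof.
move=> /cont_onP cf H t x; rewrite in_itv /= => /andP[t0 tT] xcd.
have [|tT'] := ltP t T; first by move=> ?; exact: H.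
have {tT'} tE : t = T by apply: le_anti; rewrite tT.
rewrite tE; apply/ler_addgt0Pr => e e0.
have TT : T \in `[0, T] by rewrite in_itv /= lexx ltW.
have [r r0 Hr] := cf T x (conj TT xcd) e e0.
pose s := Num.max 0 (T - r / 2).
have s0 : 0 <= s by rewrite le_max lexx.
have sT : s < T by rewrite gt_max T0 /=; lra.
have sr : T - r / 2 <= s by rewrite le_max lexx orbT.
have sT' : s \in `[0, T] by rewrite in_itv /= s0 ltW.
have := Hr s x (conj sT' xcd); rewrite subrr normr0 ltr_norml => /(_ _ r0) h.
have {h} := h ltac:(by apply/andP; split; lra); rewrite ler_norml => /andP[h1 h2].
by have := H s x s0 sT xcd; lra.
Qed.

Lemma lipschitz_continuous (f : R -> R) (K : R) :
  (forall x y, `|f x - f y| <= K * `|x - y|) -> continuous f.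
Proof.
move=> H x; apply/cvgrPdist_le => e e0; apply/nbhs_ballP.
have K0 : 0 < `|K| + 1 by rewrite ltr_wpDl.
exists (e / (`|K| + 1)); first by rewrite /= divr_gt0.
move=> y; rewrite /ball /= ltr_pdivlMr// => xy; apply: (le_trans (H _ _)).
have := ler_norm K; have := normr_ge0 (x - y); nra.
Qed.

(** A second-order remainder bound often replaces the differentiation rules below; it also applies
    to [(max 0 y)^2], which is not twice differentiable. *)
Lemma is_derive_quad (f : R -> R) (x l K r : R) : 0 < r ->
  (forall y, `|y - x| < r -> `|f y - f x - l * (y - x)| <= K * (y - x) ^+ 2) ->
  is_derive x (1 : R) f l.
Proof.
move=> r0 H; apply/has_deriv_within_is_derive/has_deriv_withinP => e e0.
have K0 : 0 < `|K| + 1 by rewrite ltr_wpDl.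
exists (Num.min r (e / (`|K| + 1))); first by rewrite lt_min r0 divr_gt0.
move=> y _; rewrite lt_min ltr_pdivlMr// => /andP[yr ye].
apply: (le_trans (H _ yr)); rewrite -real_normK ?num_real//.
have := ler_norm K; have := normr_ge0 (y - x); nra.
Qed.

Lemma is_derive_possq (x : R) :
  is_derive x (1 : R) (fun y => (Num.max 0 y) ^+ 2) (2 * Num.max 0 x).
Proof.
apply: (@is_derive_quad _ _ _ 1 1) => // y _; rewrite mul1r.
case: (leP 0 y) => hy; case: (leP 0 x) => hx; rewrite ler_norml;
  apply/andP; split; have := sqr_ge0 x; have := sqr_ge0 y;
  have := sqr_ge0 (y - x); nra.
Qed.

Lemma cont_on_mul (D : set (R * R)) (f g : R -> R -> R) :
  cont_on D f -> cont_on D g -> cont_on D (fun t x => f t x * g t x).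
Proof. by move=> cf cg p; apply: continuousM; [exact: cf|exact: cg]. Qed.

Lemma cont_on_fst (D : set (R * R)) (p : R -> R) :
  continuous p -> cont_on D (fun t _ => p t).
Proof.
move=> cp; have c0 : continuous (cst 0 : R -> R) by move=> x; exact: cvg_cst.
have := cont_on_sum (D := D) cp c0; congr cont_on.
by apply/funext => t; apply/funext => x; rewrite addr0.
Qed.

Lemma is_C12_quad (k m : R) (p p' : R -> R) :
  (forall t : R, is_derive t (1 : R) p (p' t)) -> continuous p' ->
  is_C12 T c d (fun t x => p t + k * (x - m) ^+ 2) (fun t _ => p' t)
    (fun _ x => k * (2 * (x - m))) (fun _ _ => k * 2).
Proof.
move=> dp cp'; apply: is_C12_sum => //.
- move=> x; apply: (@is_derive_quad _ _ _ `|k| 1) => // y _.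
  have -> : k * (y - m) ^+ 2 - k * (x - m) ^+ 2 - k * (2 * (x - m)) * (y - x) =
    k * (y - x) ^+ 2 by ring.
  by rewrite normrM (@ger0_norm _ (_ ^+ 2))// sqr_ge0.
- move=> x; apply: (@is_derive_quad _ _ _ 0 1) => // y _.
  have -> : k * (2 * (y - m)) - k * (2 * (x - m)) - k * 2 * (y - x) = 0 by ring.
  by rewrite normr0 mul0r.
- by move=> x; exact: cvg_cst.
Qed.

Lemma is_derive_expM (l t : R) :
  is_derive t (1 : R) (fun t : R => expR (l * t)) (l * expR (l * t)).
Proof.
rewrite mulrC; apply: (is_derive1_comp (f := expR) (g := fun t : R => l * t)).
apply: (@is_derive_quad _ _ _ 0 1) => // y _.
have -> : l * y - l * t - l * (y - t) = 0 by ring.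
by rewrite normr0 mul0r.
Qed.

Lemma derivable_continuous (f f' : R -> R) :
  (forall x : R, is_derive x (1 : R) f (f' x)) -> continuous f.
Proof.
move=> df x; apply: differentiable_continuous.
by apply/derivable1_diffP; case: (df x).
Qed.

Lemma max0_lipschitz (a b : R) :
  `|Num.max 0 a - Num.max 0 b| <= `|a - b|.
Proof.
have := ler_norm (a - b); have := ler_norm (- (a - b)); rewrite normrN.
case: (leP 0 a) => ha; case: (leP 0 b) => hb h1 h2; rewrite ler_norml;
  apply/andP; split; lra.
Qed.

Lemma mul_le_bound (a w z : R) : 0 <= a -> a <= 1 -> 0 <= z -> w <= z ->
  a * w <= z.
Proof. by move=> a0 a1 z0 wz; have [w0|w0] := leP w 0; nra. Qed.

(* The maximum of e^{-(Gam + 1) t} (v - phi - kap (x - m)^2) - K max(0, t - s)^2, with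
   m the midpoint of [c, d] and s the time of the claim, is used. The quadratic term in x makes the inward
   derivative of the test function strictly negative at c and d, which excludes
   the boundary alternative; the penalization K keeps the maximum away from T. *)
Lemma subsolution_comparison (gv q v phi phit phix phixx : R -> R -> R)
    (Gam N eps : R) : 0 <= Gam -> 0 <= N -> 0 <= eps ->
  cont_on (rect T c d) v -> is_C12 T c d phi phit phix phixx ->
  (forall t, t \in `[0, T] -> phix t c = 0 /\ phix t d = 0) ->
  subsolution gv eps v ->
  (forall x, x \in `[c, d] -> v 0 x - phi 0 x <= eps) ->
  (forall t x, t \in `[0, T] -> x \in `[c, d] ->
     - eps <= phit t x - phixx t x - q t x) ->
  (forall t x z, t \in `[0, T] -> x \in `[c, d] -> `|z - phix t x| <= 1 ->
     eps < v t x - phi t x ->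
     gv (v t x) z - q t x <=
       Gam * (v t x - phi t x) + N * `|z - phix t x| + eps) ->
  forall t x, t \in `[0, T] -> x \in `[c, d] ->
    v t x - phi t x <= 3 * expR ((Gam + 1) * T) * eps.
Proof.
move=> Gam0 N0 eps0 cv Cphi phiN subv init res Hg.
have cphi : cont_on (rect T c d) phi by case: Cphi => -[].
apply: rect_continuous_ext.
  by have := cont_on_lin (k := -1) cv cphi; congr cont_on;
    apply/funext => t; apply/funext => x; rewrite mulN1r.
move=> s y s0 sT ycd; apply/ler_addgt0Pr => e e0.
set lam := Gam + 1; set E := expR (lam * T).
have lam0 : 0 < lam by rewrite ltr_wpDl.
pose m := (c + d) / 2; pose W := d - c.
have W0 : 0 < W by rewrite subr_gt0.
pose Cc := 2 + lam * W ^+ 2 + N * W.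
have W20 : 0 <= W ^+ 2 by rewrite sqr_ge0.
have Cc0 : 0 <= Cc.
  by rewrite !addr_ge0// mulr_ge0// ltW.
have E0 : 0 < E by exact: expR_gt0.
(* The first entry keeps the tested slope within 1 of [phix], the range covered by [Hg]; the second
   makes all that the quadratic term adds to the final bound at most [e]. *)
pose kap := Num.min W^-1 (e / (E * Cc + W ^+ 2 + 1)).
have den0 : 0 < E * Cc + W ^+ 2 + 1.
  by rewrite ltr_wpDl// addr_ge0// mulr_ge0// ltW.
have kap0 : 0 < kap by rewrite lt_min invr_gt0 W0 divr_gt0.
have kapW : kap * W <= 1.
  by rewrite -ler_pdivlMr// div1r ge_min lexx.
have kape : kap * (E * Cc + W ^+ 2) <= e.
  have : kap * (E * Cc + W ^+ 2 + 1) <= e.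
    by rewrite -ler_pdivlMr// ge_min lexx orbT.
  nra.
have mW x : x \in `[c, d] -> `|2 * (x - m)| <= W.
  rewrite in_itv /= ler_norml => /andP[? ?].
  by apply/andP; split; rewrite /m /W; lra.
have mW2 x : x \in `[c, d] -> (x - m) ^+ 2 <= W ^+ 2.
  rewrite in_itv /= => /andP[? ?]; rewrite -subr_ge0.
  have -> : W ^+ 2 - (x - m) ^+ 2 = (W - (x - m)) * (W + (x - m)) by ring.
  by apply: mulr_ge0; rewrite /m /W; lra.
pose w t x := v t x - phi t x - kap * (x - m) ^+ 2.
have cw : cont_on (rect T c d) w.
  have c0 : continuous (cst 0 : R -> R) by move=> x; exact: cvg_cst.
  have cq : continuous (fun x : R => (x - m) ^+ 2).
    apply: (@derivable_continuous _ (fun x => 2 * (x - m))) => x.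
    apply: (@is_derive_quad _ _ _ 1 1) => // z _.
    rewrite (_ : _ - _ = 1 * (z - x) ^+ 2); last by ring.
    by rewrite normrM (@ger0_norm _ (_ ^+ 2)) ?sqr_ge0// normr1.
  have := cont_on_lin (k := - kap) (cont_on_lin (k := -1) cv cphi)
    (cont_on_sum (D := rect T c d) c0 cq).
  by congr cont_on; apply/funext => t; apply/funext => x; rewrite /w /=; ring.
have [Mv Mv0 HM] := cont_on_bounded (ltW T0) (ltW cd) cw.
(* At time [T] the penalty is [2 * Mv + 1], more than the weighted [w] can vary, so no maximum lies
   there; at time [s] it vanishes. *)
pose K := (2 * Mv + 1) / (T - s) ^+ 2.
have Ts0 : 0 < (T - s) ^+ 2 by rewrite exprn_gt0// subr_gt0.
have KE : K * (T - s) ^+ 2 = 2 * Mv + 1 by rewrite divfK// gt_eqF.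
have K0 : 0 < K by rewrite divr_gt0// ltr_wpDl// mulr_ge0.
pose P t := (Num.max 0 (t - s)) ^+ 2.
have P0 t : 0 <= P t by exact: sqr_ge0.
have dP (t : R) : is_derive t (1 : R) P (2 * Num.max 0 (t - s)).
  rewrite -[X in is_derive _ _ _ X]mulr1.
  apply: (is_derive1_comp (f := fun y : R => (Num.max 0 y) ^+ 2)).
    exact: is_derive_possq.
  apply: (@is_derive_quad _ _ _ 0 1) => // z _.
  have -> : z - s - (t - s) - 1 * (z - t) = 0 by ring.
  by rewrite normr0 mul0r.
have cexp l : continuous (fun t : R => expR (l * t)).
  exact: (derivable_continuous (is_derive_expM l)).
pose Q t x := expR (- lam * t) * w t x - K * P t.
have cQ : cont_on (rect T c d) Q.
  have := cont_on_lin (k := - K) (cont_on_mul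
    (cont_on_fst (D := rect T c d) (cexp (- lam))) cw)
    (cont_on_fst (D := rect T c d) (derivable_continuous dP)).
  by congr cont_on; apply/funext => t; apply/funext => x; rewrite /Q /=; ring.
have [t [x [tT xcd Hmax]]] := rectangle_max (ltW T0) (ltW cd) cQ.
have sT' : s \in `[0, T] by rewrite in_itv /= s0 ltW.
have Ps : P s = 0 by rewrite /P subrr maxxx expr0n.
set mm := Q t x in Hmax.
have Qs : expR (- lam * s) * w s y <= mm.
  by have := Hmax s y sT' ycd; rewrite {1}/Q Ps mulr0 subr0.
have expN z : expR (- lam * z) * expR (lam * z) = 1.
  by rewrite -expRD mulNr addNr expR0.
have expl z : 0 <= z -> expR (- lam * z) <= 1.
  by move=> z0; rewrite -[X in _ <= X]expR0 ler_expR mulNr oppr_le0 mulr_ge0// ltW.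
have t0 : 0 <= t by move: tT; rewrite in_itv /= => /andP[].
(* The three [eps] come from the subsolution inequality, from [res] and from [Hg]; [Cc] collects the
   second derivative, zeroth order and slope contributions of the quadratic term. *)
suff mmle : mm <= 3 * eps + kap * Cc.
  have h1 : w s y <= expR (lam * s) * mm.
    rewrite -[X in X <= _]mul1r -(expN s) [X in X * _ <= _]mulrC -mulrA.
    by rewrite ler_wpM2l// expR_ge0.
  have h2 : expR (lam * s) <= E by rewrite ler_expR ler_pM2l// ltW.
  have h3 : w s y <= E * (3 * eps + kap * Cc).
    apply: (le_trans h1); apply: (@le_trans _ _ (expR (lam * s) * (3 * eps + kap * Cc))).
      by rewrite ler_wpM2l// expR_ge0.
    by rewrite ler_wpM2r// addr_ge0// mulr_ge0// ltW.
  have h4 := mW2 y ycd.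
  have h5 : kap * (y - m) ^+ 2 <= kap * W ^+ 2 by rewrite ler_wpM2l// ltW.
  have -> : v s y - phi s y = w s y + kap * (y - m) ^+ 2 by rewrite /w; ring.
  have h6 : kap * (E * Cc + W ^+ 2) = E * (kap * Cc) + kap * W ^+ 2 by ring.
  have h7 : E * (3 * eps + kap * Cc) = 3 * E * eps + E * (kap * Cc) by ring.
  lra.
have wle : w t x <= v t x - phi t x.
  by rewrite /w gerBl mulr_ge0 ?sqr_ge0// ltW.
have mmw (z : R) : 0 <= z -> w t x <= z -> mm <= z.
  move=> z0 wz; have h1 : 0 <= K * P t by rewrite mulr_ge0// ltW.
  have h2 := expl t t0; have h3 := expR_ge0 (- lam * t).
  apply: (@le_trans _ _ (expR (- lam * t) * w t x)); first by rewrite gerBl.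
  exact: mul_le_bound.
have kCc : 0 <= kap * Cc by rewrite mulr_ge0// ltW.
have [small|big] := leP (v t x - phi t x) eps.
  by apply: mmw; clear - small wle kCc eps0; lra.
apply: mmw; first by clear - eps0 kCc; lra.
have tT2 : t \in `]0, T[.
  move: (tT); rewrite !in_itv /= => /andP[_ tleT].
  rewrite !lt_neqAle t0 tleT !andbT; apply/andP; split.
    by apply: contraTneq big => <-; rewrite -leNgt init.
  apply/negP => /eqP tE; have h1 := HM _ _ tT xcd; have h2 := HM _ _ sT' ycd.
  have PT : P t = (T - s) ^+ 2 by rewrite /P tE max_r// subr_ge0 ltW.
  have h3 : K * P t = 2 * Mv + 1 by rewrite PT.
  have h4 := expl t t0; have h5 := expl s s0.
  have h6 := expR_ge0 (- lam * t); have h7 := expR_ge0 (- lam * s).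
  move: h1 h2; rewrite !ler_norml => /andP[h11 h12] /andP[h21 h22].
  move: Qs; rewrite /mm /Q h3 => Qs.
  have h8 : expR (- lam * t) * w t x <= Mv by clear - h12 h4 h6 Mv0; nra.
  have h9 : - Mv <= expR (- lam * s) * w s y by clear - h21 h5 h7 Mv0; nra.
  clear - Qs h8 h9; lra.
(* Solving [Q = mm] for [v] gives the test function: [v] minus it equals [expR (lam * r)] times
   [Q - mm], hence is nonpositive and vanishes at the maximum. *)
pose p r := expR (lam * r) * (mm + K * P r).
pose p' r := lam * p r + expR (lam * r) * (K * (2 * Num.max 0 (r - s))).
have dp (r : R) : is_derive r (1 : R) p (p' r).
  have h1 : is_derive r (1 : R) (fun r : R => mm + K * P r)
      (K * (2 * Num.max 0 (r - s))).
    rewrite -[X in is_derive _ _ _ X]add0r.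
    by apply: is_deriveD; apply: is_deriveZ.
  have := is_deriveM (is_derive_expM lam r) h1.
  rewrite /GRing.scale /= => h; apply: is_derive_eq h _.
  by rewrite /p' /p; ring.
have cmax : continuous (fun r : R => Num.max 0 (r - s)).
  apply: (@lipschitz_continuous _ 1) => a b; rewrite mul1r.
  have -> : a - b = (a - s) - (b - s) by ring.
  exact: max0_lipschitz.
have cp' : continuous p'.
  have cp := derivable_continuous dp.
  have ck (k : R) (f : R -> R) : continuous f -> continuous (fun r => k * f r).
    by move=> cf r; apply: (@continuousM _ _ (cst k) f); [exact: cvg_cst|exact: cf].
  move=> r; apply: (@continuousD _ _ _ (fun r => lam * p r)
    (fun r => expR (lam * r) * (K * (2 * Num.max 0 (r - s))))).
    exact: (ck lam p cp).
  apply: (@continuousM _ _ (fun r => expR (lam * r))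
    (fun r => K * (2 * Num.max 0 (r - s)))); first exact: cexp.
  exact: (ck K _ (ck 2 _ cmax)).
have Cchi := is_C12_lin 1 Cphi (is_C12_quad kap m dp cp').
have vchi r z : v r z - (phi r z + 1 * (p r + kap * (z - m) ^+ 2)) =
    expR (lam * r) * (Q r z - mm).
  rewrite /p /Q; have := expN r.
  set a := expR (- lam * r); set b := expR (lam * r) => ab.
  have -> : b * (a * w r z - K * P r - mm) =
    (a * b) * w r z - b * (mm + K * P r) by ring.
  by rewrite ab mul1r /w; ring.
have lmax : local_max_on (rect T c d) (fun r => v r.1 r.2 -
    (phi r.1 r.2 + 1 * (p r.1 + kap * (r.2 - m) ^+ 2))) (t, x).
  apply/local_max_onP; exists 1 => // r z [/= rT zcd] _ _.
  rewrite !vchi -/mm subrr mulr0 mulr_ge0_le0 ?expR_ge0//.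
  by rewrite subr_le0; exact: Hmax.
have [|[xb]] := subv _ _ _ _ Cchi t x tT2 xcd lmax; last first.
  rewrite /inward_deriv; case: xb => ->.
    rewrite eqxx (phiN t tT).1 /m; have : kap * (d - c) > 0 by rewrite mulr_gt0.
    lra.
  rewrite gt_eqF// (phiN t tT).2 /m; have : kap * (d - c) > 0 by rewrite mulr_gt0.
  lra.
rewrite !mul1r; set z := phix t x + _ => hP.
have zE : `|z - phix t x| = kap * `|2 * (x - m)|.
  by rewrite /z addrC addKr normrM (gtr0_norm kap0).
have kzW : `|z - phix t x| <= kap * W.
  by rewrite zE ler_wpM2l// ?mW// ltW.
have := Hg t x z tT xcd (le_trans kzW kapW) big.
have := res t x tT xcd.
have h1 : N * `|z - phix t x| <= N * (kap * W) by rewrite ler_wpM2l.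
(* The exponential weight produces [(Gam + 1) * w]: the multiple [Gam] absorbs the growth allowed by
   [Hg], and one copy of [v - phi] is left to be bounded. The penalty contributes a nonnegative
   derivative. *)
have h2 : lam * w t x <= p' t.
  have -> : w t x = p t.
    by rewrite /p /mm /Q subrK mulrA [X in X * _]mulrC expN mul1r.
  rewrite lerDl mulr_ge0 ?expR_ge0// mulr_ge0 ?(ltW K0)// mulr_ge0//.
  by rewrite le_max lexx.
have h3 : lam * (kap * (x - m) ^+ 2) <= lam * (kap * W ^+ 2).
  by rewrite ler_pM2l// ler_pM2l// mW2.
have h4 : lam * w t x = Gam * (v t x - phi t x) + (v t x - phi t x)
    - lam * (kap * (x - m) ^+ 2) by rewrite /lam /w; ring.
have h5 : kap * Cc = kap * 2 + lam * (kap * W ^+ 2) + N * (kap * W).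
  by rewrite /Cc; ring.
lra.
Qed.

Lemma common_radius (s : seq R) : all (fun x => 0 < x) s ->
  exists2 r : R, 0 < r & all (fun x => r < x) s.
Proof.
elim: s => [|x s IH] /=; first by exists 1.
move=> /andP[x0 /IH[r r0 rs]]; exists (Num.min x r / 2).
  by rewrite divr_gt0// lt_min x0.
have hx : Num.min x r / 2 < x.
  rewrite ltr_pdivrMr// gt_min; apply/orP; left; lra.
have hr : Num.min x r / 2 < r.
  rewrite ltr_pdivrMr// gt_min; apply/orP; right; lra.
by rewrite hx; apply: sub_all rs => y; exact: lt_trans.
Qed.

(** The paraboloid makes the maximum at [(t0, x0)] strict: replacing [u] by [v] gains at most
    [2 * e], while moving a distance [r] away costs [nu * r ^+ 2 >= 4 * e]. A maximum over the
    closed box therefore avoids its faces at distance [r] and is a local one relative to the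
    rectangle. *)
Lemma perturbed_local_max (u v chi : R -> R -> R) (t0 x0 r r0 e nu : R) :
  0 < r -> r < r0 -> 0 < nu -> 4 * e <= nu * r ^+ 2 -> 0 < e ->
  (forall t, `|t - t0| < r0 -> t \in `[0, T]) -> x0 \in `[c, d] ->
  cont_on (rect T c d) v -> cont_on (rect T c d) chi ->
  (forall t x, t \in `[0, T] -> x \in `[c, d] -> `|t - t0| < r0 ->
    `|x - x0| < r0 -> u t x - chi t x <= u t0 x0 - chi t0 x0) ->
  (forall t x, t \in `[0, T] -> x \in `[c, d] -> `|v t x - u t x| <= e) ->
  let chin t x := chi t x + 1 * (nu * (t - t0) ^+ 2 + nu * (x - x0) ^+ 2) in
  exists t1 x1, [/\ `|t1 - t0| < r, `|x1 - x0| < r, x1 \in `[c, d] &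
    local_max_on (rect T c d) (fun p => v p.1 p.2 - chin p.1 p.2) (t1, x1)].
Proof.
move=> r_gt0 rr0 nu0 enur e0 Ht0 x0cd cv cchi Hu vu chin.
have tlo t : t0 - r <= t -> t <= t0 + r -> `|t - t0| <= r.
  by clear; move=> ? ?; rewrite ler_norml; apply/andP; split; lra.
have thi t : `|t - t0| <= r -> t0 - r <= t /\ t <= t0 + r.
  by clear; rewrite ler_norml => /andP[? ?]; split; lra.
have xlo x : x0 - r <= x -> x <= x0 + r -> `|x - x0| <= r.
  by clear; move=> ? ?; rewrite ler_norml; apply/andP; split; lra.
have xhi x : `|x - x0| <= r -> x0 - r <= x /\ x <= x0 + r.
  by clear; rewrite ler_norml => /andP[? ?]; split; lra.
have tT t : `|t - t0| <= r -> t \in `[0, T] by move=> h; apply: Ht0; exact: le_lt_trans rr0.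
have cbox : cont_on (`[t0 - r, t0 + r]%classic `*`
    `[Num.max c (x0 - r), Num.min d (x0 + r)]%classic) (fun t x => v t x - chin t x).
  apply: (@cont_on_sub _ (rect T c d)).
    move=> [t x] [/=]; rewrite !in_itv /= => /andP[t1 t2] /andP[x1 x2].
    split => /=; first exact/tT/tlo.
    move: x1 x2; rewrite ge_max le_min in_itv /= => /andP[-> _] /andP[-> _].
    by [].
  have c0 : continuous (fun t : R => nu * (t - t0) ^+ 2).
    apply: (@derivable_continuous _ (fun t => nu * (2 * (t - t0)))) => x.
    apply: (@is_derive_quad _ _ _ `|nu| 1) => // z _.
    have -> : nu * (z - t0) ^+ 2 - nu * (x - t0) ^+ 2 - nu * (2 * (x - t0)) * (z - x)
      = nu * (z - x) ^+ 2 by ring.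
    by rewrite normrM (@ger0_norm _ (_ ^+ 2))// sqr_ge0.
  have c1 : continuous (fun t : R => nu * (t - x0) ^+ 2).
    apply: (@derivable_continuous _ (fun t => nu * (2 * (t - x0)))) => x.
    apply: (@is_derive_quad _ _ _ `|nu| 1) => // z _.
    have -> : nu * (z - x0) ^+ 2 - nu * (x - x0) ^+ 2 - nu * (2 * (x - x0)) * (z - x)
      = nu * (z - x) ^+ 2 by ring.
    by rewrite normrM (@ger0_norm _ (_ ^+ 2))// sqr_ge0.
  have := cont_on_lin (k := -1) (cont_on_lin (k := -1) cv cchi)
    (cont_on_sum (D := rect T c d) c0 c1).
  congr cont_on; apply/funext => t; apply/funext => x; rewrite /chin; ring.
have [cx0 x0d] : c <= x0 /\ x0 <= d by move: (x0cd); rewrite in_itv /= => /andP.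
have [||t1 [x1 [t1b x1b Hmax]]] := rectangle_max _ _ cbox.
- by rewrite lerD2l ge0_cp// ltW.
- rewrite ge_max !le_min (ltW cd) /=; apply/andP; split; first by rewrite ler_wpDr// ltW.
  apply/andP; split; first by rewrite lerBlDr ler_wpDr// ltW.
  by rewrite lerD2l ge0_cp// ltW.
have inbox t x : t \in `[0, T] -> x \in `[c, d] -> `|t - t0| <= r -> `|x - x0| <= r ->
    v t x - chin t x <= v t1 x1 - chin t1 x1.
  move=> _ xcd /thi[t11 t12] /xhi[x11 x12]; apply: Hmax.
    by rewrite in_itv /= t11.
  move: xcd; rewrite in_itv /= => /andP[xc xd].
  by rewrite in_itv /= ge_max le_min xc xd x11.
have [t1r x1r x1cd] : [/\ `|t1 - t0| <= r, `|x1 - x0| <= r & x1 \in `[c, d]].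
  move: t1b x1b; rewrite !in_itv /= ge_max le_min.
  move=> /andP[? ?] /andP[/andP[-> ?] /andP[-> ?]].
  by split; [exact: tlo|exact: xlo|].
have t1T := tT _ t1r.
have t0T : t0 \in `[0, T] by apply: tT; rewrite subrr normr0 ltW.
have h1 : u t1 x1 - chi t1 x1 <= u t0 x0 - chi t0 x0.
  by apply: Hu => //; exact: le_lt_trans rr0.
have h2 : v t0 x0 - chin t0 x0 <= v t1 x1 - chin t1 x1.
  by apply: inbox; rewrite ?subrr ?normr0// ltW.
have h3 := vu t0 x0 t0T x0cd; have h4 := vu t1 x1 t1T x1cd.
have h5 : nu * ((t1 - t0) ^+ 2 + (x1 - x0) ^+ 2) <= 2 * e.
  move: h2 h3 h4; rewrite /chin !subrr expr0n /= mulr0 addr0 mulr0 !ler_norml.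
  clear - h1 => h2 /andP[? ?] /andP[? ?]; lra.
have h6 : (t1 - t0) ^+ 2 + (x1 - x0) ^+ 2 < r ^+ 2.
  rewrite -(ltr_pM2l nu0); apply: (le_lt_trans h5); clear - e0 enur; lra.
have t1r' : `|t1 - t0| < r.
  rewrite -(ltr_pXn2r (n := 2))// ?nnegrE ?(ltW r_gt0)// real_normK ?num_real//.
  by apply: le_lt_trans h6; rewrite lerDl sqr_ge0.
have x1r' : `|x1 - x0| < r.
  rewrite -(ltr_pXn2r (n := 2))// ?nnegrE ?(ltW r_gt0)// real_normK ?num_real//.
  by apply: le_lt_trans h6; rewrite lerDr sqr_ge0.
exists t1, x1; split => //; apply/local_max_onP.
exists (Num.min (r - `|t1 - t0|) (r - `|x1 - x0|)).
  by rewrite lt_min !subr_gt0 t1r'.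
move=> s y [/= sT ycd]; rewrite !lt_min !ltrBrDr => /andP[s1 _] /andP[_ y2].
apply: inbox => //; apply: ltW.
  exact: le_lt_trans (ler_distD t1 s t0) s1.
exact: le_lt_trans (ler_distD x1 y x0) y2.
Qed.

(** Strict failure of the boundary condition is an open condition, by continuity of [cx]; the radius
    also excludes every endpoint other than [x0]. *)
Lemma inward_deriv_near (cx : R -> R -> R) (t0 x0 : R) :
  cont_on (rect T c d) cx -> t0 \in `[0, T] -> x0 \in `[c, d] ->
  ~ ((x0 = c \/ x0 = d) /\ - inward_deriv c x0 (cx t0 x0) <= 0) ->
  exists2 r : R, 0 < r & forall t x, t \in `[0, T] ->
    x \in `[c, d] -> `|t - t0| < r -> `|x - x0| < r -> x = c \/ x = d ->
    x = x0 /\ 0 < - inward_deriv c x (cx t x).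
Proof.
move=> /cont_onP ccx t0T x0cd nb.
have [xc|xc] := eqVneq x0 c.
  have cx0 : 0 < - cx t0 c.
    rewrite ltNge; apply/negP => h; apply: nb; split; first by left.
    by rewrite /inward_deriv xc eqxx.
  have cx2 : 0 < - cx t0 c / 2 by lra.
  have [r rr Hr] := ccx t0 x0 (conj t0T x0cd) _ cx2.
  exists (Num.min r (d - c)); first by rewrite lt_min rr subr_gt0.
  move=> t x tT xcd; rewrite !lt_min => /andP[tr _] /andP[xr xdc] [xE|xE].
    have := Hr t x (conj tT xcd) tr xr.
    by rewrite /inward_deriv xE eqxx xc ler_norml => /andP[_ ?]; split => //; lra.
  by move: xdc; rewrite xE xc ger0_norm ?ltxx// subr_ge0 ltW.
have [xd|xd] := eqVneq x0 d.
  have cx0 : 0 < cx t0 d.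
    rewrite ltNge; apply/negP => h; apply: nb; split; first by right.
    by rewrite /inward_deriv xd gt_eqF// opprK.
  have cx2 : 0 < cx t0 d / 2 by lra.
  have [r rr Hr] := ccx t0 x0 (conj t0T x0cd) _ cx2.
  exists (Num.min r (d - c)); first by rewrite lt_min rr subr_gt0.
  move=> t x tT xcd; rewrite !lt_min => /andP[tr _] /andP[xr xdc] [xE|xE].
    by move: xdc; rewrite xE xd distrC ger0_norm ?ltxx// subr_ge0 ltW.
  have := Hr t x (conj tT xcd) tr xr.
  rewrite /inward_deriv xE (gt_eqF cd) xd ler_norml => /andP[? _].
  by split => //; lra.
move: (x0cd); rewrite in_itv /= => /andP[cx0 x0d].
have {}cx0 : c < x0 by rewrite lt_neqAle eq_sym xc.
have {}x0d : x0 < d by rewrite lt_neqAle xd.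
exists (Num.min (x0 - c) (d - x0)); first by rewrite lt_min !subr_gt0 cx0.
move=> t x tT xcd _; rewrite lt_min => /andP[h1 h2] [xE|xE].
  by move: h1; rewrite xE distrC ger0_norm ?ltxx// subr_ge0 ltW.
by move: h2; rewrite xE ger0_norm ?ltxx// subr_ge0 ltW.
Qed.

(** Stability under uniform limits: if both alternatives failed where [chi] touches [u], they would
    fail by a margin at a nearby point where a slightly bent [chi] touches a close subsolution
    [v]. *)
Lemma subsolution_limit (G u : R -> R -> R) (B M : R) : 0 <= B -> 0 <= M ->
  (forall y y' z z', `|G y z - G y' z'| <= B * `|y - y'| + M * `|z - z'|) ->
  cont_on (rect T c d) u ->
  (forall e : R, 0 < e -> exists v, [/\ cont_on (rect T c d) v,
    subsolution G e v & forall t x, t \in `[0, T] -> x \in `[c, d] ->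
      `|v t x - u t x| <= e]) ->
  subsolution G 0 u.
Proof.
move=> B0 M0 GL cu Hv chi ct cx cxx Cchi t0 x0 t0T x0cd.
move=> /local_max_onP[/= r0 r00 Hr0].
set P := ct t0 x0 - cxx t0 x0 - G (u t0 x0) (cx t0 x0).
have [P0|P0] := leP P 0; first by left.
have [nb|nb] := pselect ((x0 = c \/ x0 = d) /\ - inward_deriv c x0 (cx t0 x0) <= 0).
  by right.
exfalso.
have t0T' : t0 \in `[0, T] by move: t0T; rewrite !in_itv /= => /andP[/ltW -> /ltW ->].
have [r1 r10 Hr1] := itv_oo_near t0T.
have [[cchi cct ccx ccxx] _ _ _] := Cchi.
(* The derivatives of the bent test function and the tolerance cost at most [7 * nu], the variation
   of [G] at most [3 * nu * M + 2 * nu * B]: together less than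
   [P = 16 * (nu + nu * M + nu * B)]. *)
pose k := 16 * (1 + M + B).
have k0 : 0 < k by rewrite /k; lra.
pose nu := P / k.
have nu0 : 0 < nu by rewrite divr_gt0.
have nuk : nu + nu * M + nu * B = P / 16 by rewrite /nu /k; field; lra.
have [ra ra0 Hra] := (cont_onP _ _).1 cct t0 x0 (conj t0T' x0cd) _ nu0.
have [rb rb0 Hrb] := (cont_onP _ _).1 ccx t0 x0 (conj t0T' x0cd) _ nu0.
have [rc rc0 Hrc] := (cont_onP _ _).1 ccxx t0 x0 (conj t0T' x0cd) _ nu0.
have [rd rd0 Hrd] := (cont_onP _ _).1 cu t0 x0 (conj t0T' x0cd) _ nu0.
have [rf rf0 Hrf] := inward_deriv_near ccx t0T' x0cd nb.
have [|q q0] := @common_radius [:: r0; r1; ra; rb; rc; rd; rf; 1].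
  by rewrite /= r00 r10 ra0 rb0 rc0 rd0 rf0 ltr01.
rewrite /= andbT => /and5P[hr0 hr1 hra hrb /and4P[hrc hrd hrf hr]].
pose r := q / 2.
have r_gt0 : 0 < r by rewrite divr_gt0.
have rq : r < q by rewrite ltr_pdivrMr// mulr2n mulrDr mulr1 ltrDl.
pose e := Num.min nu (nu * r ^+ 2 / 4).
have r2 : 0 < r ^+ 2 by rewrite exprn_gt0.
have e0 : 0 < e by rewrite lt_min nu0 divr_gt0// mulr_gt0.
have enu : e <= nu by rewrite ge_min lexx.
have enur : 4 * e <= nu * r ^+ 2.
  have : e <= nu * r ^+ 2 / 4 by rewrite ge_min lexx orbT.
  by clear; lra.
have [v [cv subv vu]] := Hv e e0.
have Htq t : `|t - t0| < q -> t \in `[0, T].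
  by move=> h; apply: Hr1; exact: lt_trans hr1.
have Hmq t x : t \in `[0, T] -> x \in `[c, d] -> `|t - t0| < q ->
    `|x - x0| < q -> u t x - chi t x <= u t0 x0 - chi t0 x0.
  by move=> tT xcd h h'; apply: Hr0 => //; exact: lt_trans hr0.
have [t1 [x1 [t1r x1r x1cd]]] :=
  perturbed_local_max r_gt0 rq nu0 enur e0 Htq x0cd cv cchi Hmq vu.
have {}t1r := lt_trans t1r rq; have {}x1r := lt_trans x1r rq.
have t1T : t1 \in `[0, T] by apply: Hr1; exact: lt_trans hr1.
have t1T' : t1 \in `]0, T[.
  have := Hr1 (t0 - q); rewrite in_itv /= addrAC subrr add0r normrN gtr0_norm//.
  move=> /(_ hr1) /andP[h _].
  have := Hr1 (t0 + q); rewrite in_itv /= addrAC subrr add0r gtr0_norm//.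
  move=> /(_ hr1) /andP[_ h'].
  move: t1r; rewrite ltr_norml; clear - h h' => /andP[? ?].
  by rewrite in_itv /=; apply/andP; split; lra.
have Cnu : is_C12 T c d (fun t x => chi t x + 1 * (nu * (t - t0) ^+ 2 + nu * (x - x0) ^+ 2))
    (fun t x => ct t x + 1 * (nu * (2 * (t - t0))))
    (fun t x => cx t x + 1 * (nu * (2 * (x - x0))))
    (fun t x => cxx t x + 1 * (nu * 2)).
  apply: is_C12_lin Cchi _; apply: is_C12_quad => [t|].
    apply: (@is_derive_quad _ _ _ `|nu| 1) => // y _.
    have -> : nu * (y - t0) ^+ 2 - nu * (t - t0) ^+ 2 -
      nu * (2 * (t - t0)) * (y - t) = nu * (y - t) ^+ 2 by ring.
    by rewrite normrM (@ger0_norm _ (_ ^+ 2))// sqr_ge0.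
  apply: (@lipschitz_continuous _ (2 * nu)) => x y.
  have -> : nu * (2 * (x - t0)) - nu * (2 * (y - t0)) = 2 * nu * (x - y) by ring.
  by rewrite normrM ger0_norm// mulr_ge0// ltW.
move=> /(subv _ _ _ _ Cnu t1 x1 t1T' x1cd)[h7|[x1b]]; last first.
  have [] := Hrf t1 x1 t1T x1cd (lt_trans t1r hrf) (lt_trans x1r hrf) x1b.
  by move=> -> ? /=; rewrite subrr !mulr0 addr0 leNgt => /negP.
have := Hra t1 x1 (conj t1T x1cd) (lt_trans t1r hra) (lt_trans x1r hra).
have hb := Hrb t1 x1 (conj t1T x1cd) (lt_trans t1r hrb) (lt_trans x1r hrb).
have := Hrc t1 x1 (conj t1T x1cd) (lt_trans t1r hrc) (lt_trans x1r hrc).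
have hd := Hrd t1 x1 (conj t1T x1cd) (lt_trans t1r hrd) (lt_trans x1r hrd).
have hv := vu t1 x1 t1T x1cd.
move: h7; rewrite !mul1r.
set z := cx t1 x1 + _ => h7.
have hz : `|z - cx t0 x0| <= 3 * nu.
  have -> : z - cx t0 x0 = (cx t1 x1 - cx t0 x0) + (2 * nu) * (x1 - x0).
    by rewrite /z; ring.
  rewrite (le_trans (ler_normD _ _))// normrM (@ger0_norm _ (2 * nu)); last first.
    by rewrite mulr_ge0// ltW.
  have x11 := lt_trans x1r hr.
  have : 2 * nu * `|x1 - x0| <= 2 * nu * 1.
    by rewrite ler_wpM2l ?ltW// mulr_gt0.
  clear - hb; lra.
have hy : `|v t1 x1 - u t0 x0| <= 2 * nu.
  have := ler_distD (u t1 x1) (v t1 x1) (u t0 x0).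
  clear - hd hv enu; lra.
have := GL (v t1 x1) (u t0 x0) z (cx t0 x0).
have h8 : B * `|v t1 x1 - u t0 x0| <= B * (2 * nu) by rewrite ler_wpM2l.
have h9 : M * `|z - cx t0 x0| <= M * (3 * nu).
  by rewrite ler_wpM2l.
have h10 : nu * (t1 - t0) >= nu * -1.
  have := lt_trans t1r hr.
  rewrite ler_pM2l// ltr_norml => /andP[+ _]; exact: ltW.
rewrite !ler_norml => /andP[_ h11] /andP[_ h12] /andP[h13 _].
have nuM : 0 <= nu * M by rewrite mulr_ge0// ltW.
have nuB : 0 <= nu * B by rewrite mulr_ge0// ltW.
rewrite /P in nuk P0.
clear - h7 h8 h9 h10 h11 h12 h13 nuM nuB nuk P0 enu nu0; lra.
Qed.

End Viscosity.

(** * Averages *)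

Section Averages.
Context {R : realType}.
Implicit Types (f g F G : R -> R).

Lemma derive_bound F (F' : R -> R) (a b eta : R) : a <= b ->
  (forall x : R, is_derive x (1 : R) F (F' x)) ->
  (forall x, a <= x -> x <= b -> `|F' x| <= eta) ->
  `|F b - F a| <= eta * (b - a).
Proof.
rewrite le_eqVlt => /predU1P[->|ab] dF bF.
  by rewrite !subrr normr0 mulr0.
have [|x] := @mean_value R a b F F' ab.
  by move=> x _; exact: is_derive_has_deriv_within.
rewrite in_itv /= => /andP[ax xb] ->.
rewrite normrM (@ger0_norm _ (b - a)) ?subr_ge0 ?(ltW ab)//.
by rewrite ler_wpM2r ?subr_ge0 ?(ltW ab)// bF// ltW.
Qed.

Lemma antiderivative_right f (a : R) : continuous f ->
  exists F, forall x : R, a < x -> is_derive x (1 : R) F (f x).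
Proof.
move=> cf; exists (fun y => (\int[lebesgue_measure]_(t in `[a, y]) f t)%R) => x ax.
have xx1 : x < x + 1 by rewrite ltrDl.
have [|dF F'] := @continuous_FTC1_closed R f a x (x + 1) xx1 _ ax (cf x).
  apply: continuous_compact_integrable; first exact: segment_compact.
  exact: continuous_subspaceT.
by apply: DeriveDef; [exact: dF|rewrite -derive1E; exact: F'].
Qed.

(** An integral from -1 serves for [x > -1], a reflected one for [x < 1]. Normalised to vanish at 0,
    they agree on [(-1, 1)] by the mean value theorem, so gluing them at 0 keeps
    differentiability. *)
Lemma antiderivative_exists f : continuous f ->
  exists F, forall x : R, is_derive x (1 : R) F (f x).
Proof.
move=> cf.
have cfN : continuous (fun x => f (- x)).
  by move=> x; apply: (@continuous_comp _ _ _ (@GRing.opp R) f);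
    [exact: opp_continuous|exact: cf].
have [P dP] := antiderivative_right (-1) cf.
have [Q dQ] := antiderivative_right (-1) cfN.
have dQN (x : R) : x < 1 -> is_derive x (1 : R) (fun y => - Q (- y)) (f x).
  move=> x1; rewrite -[f x]opprK; apply: is_deriveN.
  rewrite -[X in is_derive _ _ _ X]mulrN1.
  apply: (is_derive1_comp (f := Q) (g := fun y : R => - y)).
  by rewrite -[X in f X]opprK; apply: dQ; lra.
have PQ x : -1 < x -> x < 1 -> P x - P 0 = - Q (- x) + Q 0.
  move=> x0 x1; pose H y := P y + Q (- y).
  have dH (y : R) : -1 < y -> y < 1 -> has_deriv_within setT H y 0.
    move=> y0 y1.
    have -> : H = fun y => P y + -1 * - Q (- y) by apply/funext => w; rewrite /H; ring.
    have -> : 0 = f y + -1 * f y by ring.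
    by apply: has_deriv_within_lin; apply: is_derive_has_deriv_within; [exact: dP|exact: dQN].
  suff : H x = H 0 by rewrite /H oppr0; lra.
  have [xlt|xgt|->//] := ltgtP x 0.
    have [|y _] := @mean_value R x 0 H (cst 0) xlt.
      move=> y; rewrite in_itv /= => /andP[? ?].
      by apply: (has_deriv_withinW (D := setT)) => //; apply: dH; lra.
    by rewrite mul0r; lra.
  have [|y _] := @mean_value R 0 x H (cst 0) xgt.
    move=> y; rewrite in_itv /= => /andP[? ?].
    by apply: (has_deriv_withinW (D := setT)) => //; apply: dH; lra.
  by rewrite mul0r; lra.
exists (fun x => if 0 <= x then P x - P 0 else - Q (- x) + Q 0) => x.
have loc (F G : R -> R) (r l : R) : 0 < r -> (forall y, `|y - x| < r -> F y = G y) ->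
    is_derive x (1 : R) G l -> is_derive x (1 : R) F l.
  move=> r0 FG dG; apply: has_deriv_within_is_derive.
  have /has_deriv_withinP H := is_derive_has_deriv_within setT dG.
  apply/has_deriv_withinP => e e0; have [s s0 Hs] := H e e0.
  exists (Num.min r s); first by rewrite lt_min r0.
  move=> y _; rewrite lt_min => /andP[yr ys].
  rewrite !FG ?subrr ?normr0//; exact: Hs.
have dPc (k : R) : -1 < x -> is_derive x (1 : R) (fun y => P y + k) (f x).
  by move=> x1; rewrite -[f x]addr0; apply: is_deriveD; exact: dP.
have dQc (k : R) : x < 1 -> is_derive x (1 : R) (fun y => - Q (- y) + k) (f x).
  by move=> x1; rewrite -[f x]addr0; apply: is_deriveD; exact: dQN.
have [x12|x12] := ltP x (1 / 2).
  apply: (loc _ (fun y => - Q (- y) + Q 0) (1 / 2)); [lra| |by apply: dQc; lra].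
  move=> y; rewrite ltr_norml => /andP[y1 y2].
  by case: ifP => // y0; apply: PQ; lra.
apply: (loc _ (fun y => P y - P 0) (1 / 2)); [lra| |by apply: dPc; lra].
move=> y; rewrite ltr_norml => /andP[y1 y2].
by rewrite ifT//; lra.
Qed.

(* Junk value 0 when f has no antiderivative; it is only applied to continuous f. *)
Definition antiderivative f : R -> R :=
  xget 0 [set F | forall x : R, is_derive x (1 : R) F (f x)].

Lemma antiderivativeP f : continuous f ->
  forall x : R, is_derive x (1 : R) (antiderivative f) (f x).
Proof.
move=> /antiderivative_exists[F HF]; rewrite /antiderivative.
by case: xgetP => [_ -> //|/(_ F)].
Qed.

(** The mean of [f] over [[a, b]]; with this form, estimates on means follow from the mean value
    theorem through [derive_bound]. *)
Definition avg f (a b : R) := (antiderivative f b - antiderivative f a) / (b - a).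

(** The difference of the means is an increment of one function, with derivative [f x - g (x + s)].
    A constant [g] gives closeness to a value, and [eta = 0] gives translation identities. *)
Lemma avg_dist f g (a b s eta : R) : a < b -> continuous f -> continuous g ->
  (forall x, a <= x -> x <= b -> `|f x - g (x + s)| <= eta) ->
  `|avg f a b - avg g (a + s) (b + s)| <= eta.
Proof.
move=> ab cf cg H.
have -> : avg f a b - avg g (a + s) (b + s) =
  ((antiderivative f b - antiderivative g (b + s)) -
   (antiderivative f a - antiderivative g (a + s))) / (b - a).
  by rewrite /avg; field; lra.
rewrite normrM normfV (@gtr0_norm _ (b - a)) ?subr_gt0// ler_pdivrMr ?subr_gt0//.
apply: (@derive_bound (fun x => antiderivative f x - antiderivative g (x + s))
  (fun x => f x - g (x + s))) => //; first exact: ltW.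
move=> x; apply: is_deriveB; first exact: antiderivativeP.
rewrite -[X in is_derive _ _ _ X]mulr1.
apply: (is_derive1_comp (f := antiderivative g) (g := fun x : R => x + s)).
  exact: antiderivativeP.
by rewrite -[X in is_derive _ _ _ X]addr0; exact: is_deriveD.
Qed.

Lemma avg_cst (k a b : R) : a < b -> avg (fun=> k) a b = k.
Proof.
move=> ab; have ck : continuous (fun _ : R => k) by move=> x; exact: cvg_cst.
suff : `|(antiderivative (fun=> k) b - k * b) - (antiderivative (fun=> k) a - k * a)|
    <= 0 * (b - a).
  rewrite mul0r normr_le0 /avg => /eqP h.
  have -> : antiderivative (fun=> k) b - antiderivative (fun=> k) a = k * (b - a) by lra.
  by rewrite mulfK// gt_eqF// subr_gt0.
apply: (@derive_bound (fun x => antiderivative (fun=> k) x - k * x) (fun=> 0)).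
- exact: ltW.
- move=> x; rewrite -[0](subrr k); apply: is_deriveB; first exact: antiderivativeP.
  by rewrite -[X in is_derive _ _ _ X]mulr1; apply: is_deriveZ.
- by move=> x _ _; rewrite normr0.
Qed.

Lemma avg_near f (a b k eta : R) : a < b -> continuous f ->
  (forall x, a <= x -> x <= b -> `|f x - k| <= eta) -> `|avg f a b - k| <= eta.
Proof.
move=> ab cf H; have ck : continuous (fun _ : R => k) by move=> x; exact: cvg_cst.
rewrite -{1}(@avg_cst k (a + 0) (b + 0)) ?ltrD2r//.
exact: avg_dist.
Qed.

Lemma avg_lin f g (k a b : R) : a < b -> continuous f -> continuous g ->
  avg (fun x => f x + k * g x) a b = avg f a b + k * avg g a b.
Proof.
move=> ab cf cg.
have ckg : continuous (fun x => k * g x).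
  by move=> x; apply: (@continuousM _ _ (cst k) g); [exact: cvg_cst|exact: cg].
have cfg : continuous (fun x => f x + k * g x).
  by move=> x; apply: (@continuousD _ _ _ f (fun x => k * g x)); [exact: cf|exact: ckg].
set h := fun x => f x + k * g x.
suff : `|(antiderivative h b - (antiderivative f b + k * antiderivative g b)) -
    (antiderivative h a - (antiderivative f a + k * antiderivative g a))|
    <= 0 * (b - a).
  rewrite mul0r normr_le0 /avg => /eqP H.
  rewrite mulrA -mulrDl; congr (_ / _); lra.
apply: (@derive_bound (fun x => antiderivative h x -
  (antiderivative f x + k * antiderivative g x)) (fun=> 0)).
- exact: ltW.
- move=> x; rewrite -[0](subrr (h x)); apply: is_deriveB; first exact: antiderivativeP.
  apply: is_deriveD; first exact: antiderivativeP.
  by apply: is_deriveZ; exact: antiderivativeP.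
- by move=> x _ _; rewrite normr0.
Qed.

Lemma avg_reflect g (p a b : R) : a < b -> continuous g ->
  avg (fun x => g (p - x)) a b = avg g (p - b) (p - a).
Proof.
move=> ab cg; set h := fun x => g (p - x).
have ch : continuous h.
  move=> x; apply: (@continuous_comp _ _ _ (fun x : R => p - x) g); last exact: cg.
  apply: (@lipschitz_continuous _ _ 1) => y z; rewrite mul1r.
  have -> : p - y - (p - z) = - (y - z) by ring.
  by rewrite normrN.
suff : `|(antiderivative h b + antiderivative g (p - b)) -
    (antiderivative h a + antiderivative g (p - a))| <= 0 * (b - a).
  rewrite mul0r normr_le0 /avg => /eqP H.
  have -> : p - a - (p - b) = b - a by ring.
  congr (_ / _); lra.
apply: (@derive_bound (fun x => antiderivative h x + antiderivative g (p - x)) (fun=> 0)).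
- exact: ltW.
- move=> x; rewrite -[0](subrr (h x)); apply: is_deriveD; first exact: antiderivativeP.
  rewrite -mulrN1.
  apply: (is_derive1_comp (f := antiderivative g) (g := fun x : R => p - x)).
    exact: antiderivativeP.
  by rewrite -[X in is_derive _ _ _ X]add0r; exact: is_deriveB.
- by move=> x _ _; rewrite normr0.
Qed.

Lemma is_derive_avg f (p q x : R) : continuous f ->
  is_derive x (1 : R) (fun x => avg f (x - p) (x + q)) ((f (x + q) - f (x - p)) / (q + p)).
Proof.
move=> cf.
have -> : (fun x => avg f (x - p) (x + q)) = (fun x => (q + p)^-1 *
   (antiderivative f (x + q) - antiderivative f (x - p))).
  apply/funext => y; rewrite /avg mulrC; congr (_^-1 * _); ring.
rewrite mulrC; apply: is_deriveZ; apply: is_deriveB.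
  rewrite -[X in is_derive _ _ _ X]mulr1.
  apply: (is_derive1_comp (f := antiderivative f) (g := fun x : R => x + q)).
    exact: antiderivativeP.
  by rewrite -[X in is_derive _ _ _ X]addr0; exact: is_deriveD.
rewrite -[X in is_derive _ _ _ X]mulr1.
apply: (is_derive1_comp (f := antiderivative f) (g := fun x : R => x - p)).
  exact: antiderivativeP.
by rewrite -[X in is_derive _ _ _ X]addr0; exact: is_deriveD.
Qed.

End Averages.

(** * Reflection *)

Section Fold.
Context {R : realType}.
Variables (c d : R).
Hypothesis cd : c < d.
Let l := d - c.

(** By rounding, the index of a nearest point of the lattice [c + 2 (d - c) Z]. *)
Definition lattice_index (x : R) : int :=
  Num.floor ((x - c + (d - c)) / (2 * (d - c))).

(* The triangle wave of period 2 (d - c) with values in [c, d]. *)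
Definition fold (x : R) : R :=
  c + `|x - c - 2 * (d - c) * (lattice_index x)%:~R|.

Let l0 : 0 < l. Proof. by rewrite subr_gt0. Qed.

Lemma fold_lattice (x : R) : `|x - c - 2 * l * (lattice_index x)%:~R| <= l.
Proof.
have l2 : 0 < 2 * l by rewrite mulr_gt0.
have := @floor_itv R ((x - c + l) / (2 * l)).
rewrite intrD -/(lattice_index x).
set m := (lattice_index x)%:~R : R => /andP[].
rewrite ler_pdivlMr// ltr_pdivrMr// => h1 h2.
by rewrite ler_norml; apply/andP; split; lra.
Qed.

(** The chosen lattice point is within [l] of [x] and all others are at least [2 * l] from it.
    Testing minimality with the lattice point chosen for another argument yields the Lipschitz bound
    and the symmetries of [fold]. *)
Lemma fold_min (x : R) (k : int) : fold x <= c + `|x - c - 2 * l * k%:~R|.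
Proof.
rewrite lerD2l; have h := fold_lattice x.
have [->//|km] := eqVneq k (lattice_index x).
have k1 : 1 <= `|(k - lattice_index x)%:~R : R|.
  by rewrite -intr_norm -[1]/(1%:~R) ler_int -gtz0_ge1 normr_gt0 subr_eq0.
apply: (le_trans h).
have : 2 * l * 1 <= `|2 * l * (k - lattice_index x)%:~R|.
  by rewrite normrM ger0_norm ?mulr_ge0 ?(ltW l0)// ler_wpM2l// mulr_ge0 ?(ltW l0).
have -> : 2 * l * (k - lattice_index x)%:~R = (x - c - 2 * l * (lattice_index x)%:~R)
   - (x - c - 2 * l * k%:~R) by rewrite rmorphB /=; ring.
move=> h1; have := ler_normB (x - c - 2 * l * (lattice_index x)%:~R) (x - c - 2 * l * k%:~R).
move: h h1; clear; lra.
Qed.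

Lemma fold_itv (x : R) : fold x \in `[c, d].
Proof.
have := fold_lattice x; rewrite /fold -/l.
set a := `| _ | => h; have a0 : 0 <= a by exact: normr_ge0.
by rewrite in_itv /=; apply/andP; split; rewrite /l in h; lra.
Qed.

Lemma fold_id (x : R) : x \in `[c, d] -> fold x = x.
Proof.
rewrite in_itv /= => /andP[cx xd]; apply: le_anti; apply/andP; split.
  by have := fold_min x 0; rewrite mulr0 subr0 ger0_norm; lra.
rewrite /fold -/l; set m := lattice_index x.
have [m0|m0] := leP m 0.
  have m0' : (m%:~R : R) <= 0 by rewrite -[0]/(0%:~R) ler_int.
  have : 2 * l * m%:~R <= 0 by rewrite mulr_ge0_le0// mulr_ge0// ltW.
  have := ler_norm (x - c - 2 * l * m%:~R); lra.
have m1 : 1 <= (m%:~R : R) by rewrite -[1]/(1%:~R) ler_int -gtz0_ge1.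
have : 2 * l * 1 <= 2 * l * m%:~R by rewrite ler_wpM2l// mulr_ge0// ltW.
have := ler_norm (- (x - c - 2 * l * m%:~R)); rewrite normrN /l; lra.
Qed.

Lemma fold_lipschitz (x y : R) : `|fold x - fold y| <= `|x - y|.
Proof.
have H a b : fold a - fold b <= `|a - b|.
  have := fold_min a (lattice_index b).
  have -> : fold b = c + `|b - c - 2 * l * (lattice_index b)%:~R| by [].
  have -> : a - c - 2 * l * (lattice_index b)%:~R =
    (a - b) + (b - c - 2 * l * (lattice_index b)%:~R) by ring.
  have := ler_normD (a - b) (b - c - 2 * l * (lattice_index b)%:~R).
  lra.
rewrite ler_norml H andbT.
by have := H y x; rewrite distrC; lra.
Qed.

Lemma fold_reflect (w : R) (k : int) : fold (2 * c - w + 2 * l * k%:~R) = fold w.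
Proof.
apply: le_anti; apply/andP; split.
  rewrite {2}/fold -/l; have := fold_min (2 * c - w + 2 * l * k%:~R) (k - lattice_index w).
  by rewrite -normrN; congr (_ <= c + `| _ |); rewrite rmorphB /=; ring.
rewrite {2}/fold -/l; set m := lattice_index _; have := fold_min w (k - m).
by rewrite -normrN; congr (_ <= c + `| _ |); rewrite rmorphB /=; ring.
Qed.

Lemma fold_shift (w : R) (k : int) : fold (w + 2 * l * k%:~R) = fold w.
Proof.
have := fold_reflect (2 * c - w) k; have := fold_reflect w 0.
rewrite mulr0 addr0 => <- <-; congr fold; ring.
Qed.

(** A symmetry of [fold], a translation or a reflection, sends [x] to [fold x]. It carries the
    neighbours of [x] along, which transfers identities for folded functions from [[c, d]] to the
    whole line. *)
Lemma fold_affine (x : R) : exists s p, [/\ s = 1 \/ s = -1,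
  fold x = s * x + p & forall w, fold (s * w + p) = fold w].
Proof.
rewrite {1}/fold -/l; set m := lattice_index x.
have [h|h] := leP 0 (x - c - 2 * l * m%:~R).
  exists 1, (- (2 * l * m%:~R)); split; first by left.
    by rewrite ger0_norm//; ring.
  by move=> w; rewrite -(fold_shift w (- m)) rmorphN /=; congr fold; ring.
exists (-1), (2 * c + 2 * l * m%:~R); split; first by right.
  by rewrite ltr0_norm//; ring.
by move=> w; rewrite -(fold_reflect w m); congr fold; ring.
Qed.

Lemma fold_reflect_left (w : R) : fold (2 * c - w) = fold w.
Proof. by have := fold_reflect w 0; rewrite mulr0 addr0. Qed.

Lemma fold_reflect_right (w : R) : fold (2 * d - w) = fold w.
Proof. by rewrite -(fold_reflect w 1); congr fold; rewrite /l; ring. Qed.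

End Fold.

(** * The finite difference scheme *)

Section Scheme.
Context {R : realType}.
Variables (c d T : R) (G : R -> R -> R) (B M G0 D : R).
Hypotheses (cd : c < d) (T0 : 0 < T).
Hypotheses (B0 : 0 <= B) (M0 : 0 <= M) (D0 : 0 <= D).
Hypothesis G_lip_y : forall y y' z, `|G y z - G y' z| <= B * `|y - y'|.
Hypothesis G_lip_z : forall y z z', `|G y z - G y z'| <= M * `|z - z'|.
Hypothesis G_bound : forall y z, `|G y z| <= G0.
Hypothesis G_zero : forall y, `|G y 0| <= D * (1 + `|y|).
Variables (h0 : R -> R) (A C H : R).
Hypotheses (A0 : 0 <= A) (C0 : 0 <= C) (H0 : 0 <= H).
Hypothesis h0_fold : forall x, h0 (fold c d x) = h0 x.
Hypothesis h0_lip : forall x y, `|h0 x - h0 y| <= A * `|x - y|.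
Hypothesis h0_bound : forall x, `|h0 x| <= C.
Hypothesis h0_diff2 : forall x s, `|h0 (x + s) - 2 * h0 x + h0 (x - s)| <= H * s ^+ 2.
Variable e : R.
Hypotheses (e0 : 0 < e) (eM : e * M <= 2) (e1 : e <= 1).

(* With this time step the scheme has no diagonal term, and it is monotone as soon
   as e * M <= 2. *)
Definition time_step : R := e ^+ 2 / 2.
Local Notation tau := time_step.

Lemma time_step_gt0 : 0 < tau.
Proof. by rewrite /time_step divr_gt0// exprn_gt0. Qed.

Lemma time_step_half : tau <= 1 / 2.
Proof. rewrite /time_step ler_pM2r ?invr_gt0//; move: e0 e1; nra. Qed.

Definition scheme_value (p q r : R) : R :=
  (q + r) / 2 + tau * G p ((q - r) / (2 * e)).

Definition scheme_step (w : R -> R) (x : R) : R :=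
  scheme_value (w (fold c d x)) (w (fold c d x + e)) (w (fold c d x - e)).

(** The extreme case [k = 1/2] is the identity |a + b| / 2 + |a - b| / 2 = max (|a|, |b|).
    Monotonicity of the scheme is used in this form. *)
Lemma half_sum_bound (a b k m : R) : `|a| <= m -> `|b| <= m -> 0 <= k ->
  k <= 1 / 2 -> `|(a + b) / 2| + k * `|a - b| <= m.
Proof.
move=> am bm k0 k2.
apply: (@le_trans _ _ (`|(a + b) / 2| + 1 / 2 * `|a - b|)).
  by rewrite lerD2l ler_wpM2r.
move: am bm; rewrite normrM (@ger0_norm _ 2^-1)// !ler_norml => /andP[? ?] /andP[? ?].
case: (ger0P (a + b)) => ?; case: (ger0P (a - b)) => ?; lra.
Qed.

(** The weight in the preceding inequality is [tau * M / (2 * e) = e * M / 4], at most 1/2 by [eM].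
    Averaging the neighbours thus pays for the variation of [G] in the slope, and [M] leaves no
    trace in the growth rates. *)
Lemma scheme_gradient (p q r q' r' m : R) : `|q - q'| <= m -> `|r - r'| <= m ->
  `|(q + r) / 2 - (q' + r') / 2| +
   tau * `|G p ((q - r) / (2 * e)) - G p ((q' - r') / (2 * e))| <= m.
Proof.
move=> qm rm.
have -> : (q + r) / 2 - (q' + r') / 2 = ((q - q') + (r - r')) / 2 by ring.
have k0 : 0 <= e * M / 4 by rewrite divr_ge0// mulr_ge0// ltW.
apply: le_trans (half_sum_bound qm rm k0 _); last by move: eM; lra.
rewrite lerD2l.
have := G_lip_z p ((q - r) / (2 * e)) ((q' - r') / (2 * e)).
have -> : (q - r) / (2 * e) - (q' - r') / (2 * e) = ((q - q') - (r - r')) / (2 * e).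
  by field; rewrite gt_eqF.
rewrite normrM (@ger0_norm _ (2 * e)^-1) ?invr_ge0 ?mulr_ge0// ?(ltW e0)// => h.
have tau0 := time_step_gt0.
apply: (@le_trans _ _ (tau * (M * (`|q - q' - (r - r')| / (2 * e))))).
  by rewrite ler_wpM2l// ltW.
rewrite /time_step le_eqVlt; apply/orP; left; apply/eqP; field.
by rewrite gt_eqF.
Qed.

Lemma scheme_value_contr (p q r p' q' r' m : R) : `|p - p'| <= m ->
  `|q - q'| <= m -> `|r - r'| <= m ->
  `|scheme_value p q r - scheme_value p' q' r'| <= (1 + B * tau) * m.
Proof.
move=> pm qm rm; have h1 := scheme_gradient p' qm rm.
have tau0 := time_step_gt0.
rewrite /scheme_value.
set z := (q - r) / _ in h1 *; set z' := (q' - r') / _ in h1 *.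
have -> : (q + r) / 2 + tau * G p z - ((q' + r') / 2 + tau * G p' z') =
  ((q + r) / 2 - (q' + r') / 2) + tau * (G p' z - G p' z') + tau * (G p z - G p' z).
  by ring.
apply: (le_trans (ler_normD _ _)).
apply: (@le_trans _ _ (m + tau * (B * m))); last by lra.
apply: lerD.
  apply: (le_trans (ler_normD _ _)); rewrite normrM (@gtr0_norm _ tau)//.
rewrite normrM (@gtr0_norm _ tau)// ler_pM2l//.
apply: (le_trans (G_lip_y _ _ _)); exact: ler_wpM2l.
Qed.

Lemma scheme_value_bound (p q r m : R) : `|p| <= m -> `|q| <= m -> `|r| <= m ->
  1 + `|scheme_value p q r| <= (1 + D * tau) * (1 + m).
Proof.
move=> pm qm rm; have tau0 := time_step_gt0.
have := @scheme_gradient p q r 0 0 m; rewrite !subr0 => /(_ qm rm).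
rewrite !addr0 !mul0r subr0 => h1; rewrite /scheme_value.
set z := (q - r) / _ in h1 *.
have -> : (q + r) / 2 + tau * G p z = (q + r) / 2 + tau * (G p z - G p 0) + tau * G p 0.
  by ring.
have h2 : tau * `|G p 0| <= tau * (D * (1 + m)).
  rewrite ler_pM2l//; apply: (le_trans (G_zero _)); apply: ler_wpM2l => //.
  by rewrite lerD2l.
have h3 := ler_normD ((q + r) / 2 + tau * (G p z - G p 0)) (tau * G p 0).
have h4 := ler_normD ((q + r) / 2) (tau * (G p z - G p 0)).
move: h3 h4; rewrite !(normrM tau) (@gtr0_norm _ tau)//.
move: h1 h2; lra.
Qed.

Lemma scheme_step_contr (w w' : R -> R) (m : R) : (forall x, `|w x - w' x| <= m) ->
  forall x, `|scheme_step w x - scheme_step w' x| <= (1 + B * tau) * m.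
Proof. by move=> ww' x; exact: scheme_value_contr. Qed.

(** [G] does not depend on the position, so the values at [x] and [y] are one formula applied to
    stencils whose entries differ by at most [L |x - y|]. Nothing is lost at the boundary since
    [fold] is 1-Lipschitz. *)
Lemma scheme_step_lip (w : R -> R) (L : R) : 0 <= L ->
  (forall x y, `|w x - w y| <= L * `|x - y|) ->
  forall x y, `|scheme_step w x - scheme_step w y| <= (1 + B * tau) * L * `|x - y|.
Proof.
move=> L0 wL x y; rewrite -mulrA.
have H' s : `|w (fold c d x + s) - w (fold c d y + s)| <= L * `|x - y|.
  apply: (le_trans (wL _ _)); apply: ler_wpM2l => //.
  by rewrite opprD addrACA subrr addr0; exact: fold_lipschitz.
apply: scheme_value_contr => //.
by have := H' 0; rewrite !addr0.
Qed.

Lemma scheme_step_bound (w : R -> R) (m : R) : (forall x, `|w x| <= m) ->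
  forall x, 1 + `|scheme_step w x| <= (1 + D * tau) * (1 + m).
Proof. by move=> wm x; exact: scheme_value_bound. Qed.

Lemma scheme_step_fold (w : R -> R) (x : R) :
  scheme_step w (fold c d x) = scheme_step w x.
Proof. by rewrite /scheme_step (fold_id cd (fold_itv cd x)). Qed.

(** Bounded second differences of [h0] make the first step of order [tau]; the stability of the step
    propagates this, which is the origin of the Lipschitz bound in time. *)
Lemma scheme_step_initial (x : R) : `|scheme_step h0 x - h0 x| <= tau * (H + G0).
Proof.
rewrite -(h0_fold x) /scheme_step; set y := fold c d x.
have tau0 := time_step_gt0.
have := h0_diff2 y e; have := G_bound (h0 y) ((h0 (y + e) - h0 (y - e)) / (2 * e)).
rewrite /scheme_value; set g := G _ _ => h1 h2.
have -> : (h0 (y + e) + h0 (y - e)) / 2 + tau * g - h0 y =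
  (h0 (y + e) - 2 * h0 y + h0 (y - e)) / 2 + tau * g by field.
apply: (le_trans (ler_normD _ _)); rewrite (normrM tau) (normrM _ 2^-1) (@gtr0_norm _ tau)//.
rewrite (@ger0_norm _ 2^-1)//.
have h3 : tau * `|g| <= tau * G0 by rewrite ler_pM2l.
have h4 : tau * H = H * e ^+ 2 / 2 by rewrite /time_step; field.
move: h2 h3 h4; lra.
Qed.

(* Interpolating between h0 and its image under one step and then iterating makes the
   scheme defined, and Lipschitz, at all real times. *)
Definition scheme_start (s : R) (x : R) : R :=
  h0 x + s / tau * (scheme_step h0 x - h0 x).

Definition scheme_iter (n : nat) (s : R) : R -> R :=
  iter n scheme_step (scheme_start s).

Let q := 1 + B * tau.
Let q1 : 1 <= q.
Proof. by rewrite /q lerDl mulr_ge0// ltW// time_step_gt0. Qed.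
Let qn0 n : 0 <= q ^+ n. Proof. by rewrite exprn_ge0// (le_trans _ q1). Qed.

Let theta_itv s : 0 <= s -> s <= tau -> 0 <= s / tau /\ s / tau <= 1.
Proof.
move=> s0 st; have tau0 := time_step_gt0.
by rewrite divr_ge0 ?(ltW tau0)// ler_pdivrMr// mul1r.
Qed.

Lemma scheme_iter_time (n : nat) (s s' x : R) :
  `|scheme_iter n s x - scheme_iter n s' x| <= q ^+ n * (H + G0) * `|s - s'|.
Proof.
have tau0 := time_step_gt0.
elim: n x => [|n IH] x; last first.
  by rewrite exprS -!mulrA; apply: scheme_step_contr => y; rewrite mulrA; exact: IH.
rewrite expr0 mul1r /scheme_iter /= /scheme_start.
have -> : h0 x + s / tau * (scheme_step h0 x - h0 x) -
   (h0 x + s' / tau * (scheme_step h0 x - h0 x)) =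
   (s - s') * ((scheme_step h0 x - h0 x) / tau).
  by field; rewrite gt_eqF.
rewrite normrM mulrC ler_wpM2r// normrM normfV (@gtr0_norm _ tau)//.
by rewrite ler_pdivrMr// mulrC scheme_step_initial.
Qed.

(** The end of one time cell is the start of the next, so gluing the cells creates no jump. *)
Lemma scheme_iter_next (n : nat) : scheme_iter n tau = scheme_iter n.+1 0.
Proof.
rewrite /scheme_iter iterSr; congr iter.
apply/funext => x; rewrite /scheme_start divff ?gt_eqF ?time_step_gt0//.
rewrite mul1r addrCA subrr addr0; congr scheme_step.
by apply/funext => y; rewrite mul0r mul0r addr0.
Qed.

Lemma scheme_iter_lip (n : nat) (s : R) : 0 <= s -> s <= tau ->
  forall x y, `|scheme_iter n s x - scheme_iter n s y| <= q ^+ n.+1 * A * `|x - y|.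
Proof.
move=> s0 st; have [th0 th1] := theta_itv s0 st.
elim: n => [|n IH] x y; last first.
  by rewrite exprS -(mulrA q); apply: scheme_step_lip => //; rewrite mulr_ge0.
rewrite /scheme_iter /= /scheme_start expr1; set th := s / tau in th0 th1 *.
have -> : h0 x + th * (scheme_step h0 x - h0 x) - (h0 y + th * (scheme_step h0 y - h0 y))
  = (1 - th) * (h0 x - h0 y) + th * (scheme_step h0 x - scheme_step h0 y) by ring.
apply: (le_trans (ler_normD _ _)); rewrite (normrM th) (normrM (1 - th)) (@ger0_norm _ th)//.
rewrite (@ger0_norm _ (1 - th)) ?subr_ge0//.
have h1 := h0_lip x y; have h2 := scheme_step_lip A0 h0_lip x y; rewrite -/q in h2.
have h3 : A * `|x - y| <= q * A * `|x - y|.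
  by rewrite -mulrA ler_peMl// mulr_ge0.
have h4 : (1 - th) * `|h0 x - h0 y| <= (1 - th) * (q * A * `|x - y|).
  by rewrite ler_wpM2l ?subr_ge0//; exact: le_trans h3.
have h5 : th * `|scheme_step h0 x - scheme_step h0 y| <= th * (q * A * `|x - y|).
  by rewrite ler_wpM2l.
move: h4 h5; lra.
Qed.

Lemma scheme_iter_bound (n : nat) (s : R) : 0 <= s -> s <= tau ->
  forall x, 1 + `|scheme_iter n s x| <= (1 + D * tau) ^+ n.+1 * (1 + C).
Proof.
move=> s0 st; have [th0 th1] := theta_itv s0 st.
elim: n => [|n IH] x; last first.
  rewrite exprS -mulrA.
  have -> : (1 + D * tau) ^+ n.+1 * (1 + C) = 1 + ((1 + D * tau) ^+ n.+1 * (1 + C) - 1).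
    by ring.
  by apply: scheme_step_bound => y; rewrite lerBrDl; exact: IH.
rewrite /scheme_iter /= /scheme_start expr1; set th := s / tau in th0 th1 *.
have -> : h0 x + th * (scheme_step h0 x - h0 x) = (1 - th) * h0 x + th * scheme_step h0 x.
  by ring.
have := ler_normD ((1 - th) * h0 x) (th * scheme_step h0 x); rewrite (normrM th) (normrM (1 - th)).
rewrite (@ger0_norm _ th)// (@ger0_norm _ (1 - th)) ?subr_ge0//.
have h1 := h0_bound x; have h2 := scheme_step_bound h0_bound x.
have h3 : 0 <= D * tau * (1 + C).
  by rewrite mulr_ge0 ?addr_ge0// mulr_ge0// ltW// time_step_gt0.
have h4 : (1 - th) * `|h0 x| <= (1 - th) * (C + D * tau * (1 + C)).
  by rewrite ler_wpM2l ?subr_ge0//; move: h1 h3; lra.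
have h5 : th * `|scheme_step h0 x| <= th * (C + D * tau * (1 + C)).
  by rewrite ler_wpM2l//; move: h2; lra.
move: h4 h5; lra.
Qed.

Lemma scheme_iter_fold (n : nat) (s x : R) :
  scheme_iter n s (fold c d x) = scheme_iter n s x.
Proof.
case: n => [|n]; last exact: scheme_step_fold.
by rewrite /scheme_iter /= /scheme_start h0_fold scheme_step_fold.
Qed.

Lemma scheme_iter_cells (V : R) (k n : nat) (s s' x : R) :
  q ^+ (n + k) * (H + G0) <= V -> 0 <= s -> s <= tau -> 0 <= s' -> s' <= tau ->
  n%:R * tau + s <= (n + k)%:R * tau + s' ->
  `|scheme_iter (n + k) s' x - scheme_iter n s x| <=
    V * ((n + k)%:R * tau + s' - (n%:R * tau + s)).
Proof.
have HG : 0 <= H + G0 by rewrite addr_ge0// (le_trans _ (G_bound 0 0)).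
elim: k n s => [|k IH] n s; first rewrite addn0.
  move=> qV s0 st s'0 s't; rewrite lerD2l => ss'.
  apply: (le_trans (scheme_iter_time _ _ _ _)).
  rewrite ger0_norm ?subr_ge0// (_ : _ + s' - _ = s' - s); last by ring.
  by rewrite ler_wpM2r// subr_ge0.
move=> qV s0 st s'0 s't _; have tau0 := time_step_gt0.
have qnV : q ^+ n * (H + G0) <= V.
  by apply: le_trans qV; rewrite ler_wpM2r// ler_weXn2l// leq_addr.
have h1 : `|scheme_iter n tau x - scheme_iter n s x| <= V * (tau - s).
  apply: (le_trans (scheme_iter_time _ _ _ _)).
  rewrite ger0_norm ?subr_ge0//; apply: ler_wpM2r; [by rewrite subr_ge0|exact: qnV].
have h2 : `|scheme_iter (n.+1 + k) s' x - scheme_iter n.+1 0 x| <=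
    V * ((n.+1 + k)%:R * tau + s' - (n.+1%:R * tau + 0)).
  apply: IH => //; rewrite ?addSnnS// ?(ltW tau0)//.
  by apply: lerD => //; rewrite ler_wpM2r ?(ltW tau0)// ler_nat -addSnnS leq_addr.
rewrite addSnnS in h2; rewrite scheme_iter_next in h1.
have := ler_distD (scheme_iter n.+1 0 x) (scheme_iter (n + k.+1) s' x) (scheme_iter n s x).
have hb : n.+1%:R * tau = n%:R * tau + tau by rewrite -(natr1 n); ring.
rewrite hb in h2; move: h1 h2; lra.
Qed.

(** Clamping the time makes the Lipschitz bounds global, as averaging requires; the upper end
    [T + tau] keeps the scheme relation available up to [T]. *)
Definition scheme_time (t : R) : R := Num.max 0 (Num.min t (T + tau)).

Definition scheme_solution (t : R) : R -> R :=
  let t' := scheme_time t in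
  scheme_iter (Num.truncn (t' / tau)) (t' - (Num.truncn (t' / tau))%:R * tau).

Local Notation u := scheme_solution.

Lemma scheme_time_id (t : R) : 0 <= t -> t <= T + tau -> scheme_time t = t.
Proof. by move=> t0 tT; rewrite /scheme_time (min_idPl tT) (max_idPr t0). Qed.

Lemma scheme_time_itv (t : R) : 0 <= scheme_time t /\ scheme_time t <= T + tau.
Proof.
rewrite /scheme_time le_max lexx ge_max ge_min lexx orbT andbT.
by split => //; rewrite addr_ge0 ?(ltW T0)// ltW// time_step_gt0.
Qed.

Lemma scheme_time_lip (t t' : R) : `|scheme_time t - scheme_time t'| <= `|t - t'|.
Proof.
apply: (le_trans (max0_lipschitz _ _)).
have := ler_norm (t - t'); have := ler_norm (- (t - t')); rewrite normrN.
case: (leP t (T + tau)) => h1; case: (leP t' (T + tau)) => h2 h3 h4;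
  rewrite ler_norml; apply/andP; split; lra.
Qed.

Lemma scheme_solution_cell (n : nat) (s t : R) : scheme_time t = n%:R * tau + s ->
  0 <= s -> s < tau -> u t = scheme_iter n s.
Proof.
move=> tE s0 st; rewrite /scheme_solution tE.
have tau0 := time_step_gt0.
have -> : Num.truncn ((n%:R * tau + s) / tau) = n.
  apply: truncn_def; rewrite ler_pdivlMr// ltr_pdivrMr// lerDl s0 -(natr1 n) mulrDl mul1r.
  by rewrite ltrD2l.
by rewrite addrAC subrr add0r.
Qed.

Lemma scheme_solution_cellP (t : R) : exists n s,
  [/\ scheme_time t = n%:R * tau + s, 0 <= s, s < tau & u t = scheme_iter n s].
Proof.
have tau0 := time_step_gt0; have [t0 tT] := scheme_time_itv t.
set n := Num.truncn (scheme_time t / tau).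
have : n%:R <= scheme_time t / tau < n.+1%:R by apply: truncn_itv; rewrite divr_ge0// ltW.
rewrite ler_pdivlMr// ltr_pdivrMr// -(natr1 n) mulrDl mul1r => /andP[h1 h2].
have tE : scheme_time t = n%:R * tau + (scheme_time t - n%:R * tau) by ring.
exists n, (scheme_time t - n%:R * tau); split=> //; first by rewrite subr_ge0.
  by rewrite ltrBlDl.
Qed.

Lemma expR_pow (k : R) (n : nat) : 0 <= k -> (1 + k * tau) ^+ n <= expR (k * (n%:R * tau)).
Proof.
move=> k0; have tau0 := time_step_gt0; rewrite (mulrCA k n%:R tau) expRM_natl.
have ktau0 : 0 <= k * tau by exact: mulr_ge0 k0 (ltW tau0).
apply: lerXn2r; rewrite ?nnegrE ?expR_ge0 ?addr_ge0//.
exact: expR_ge1Dx.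
Qed.

(** At most [n + 1] factors [1 + B * tau] occur, and [(n + 1) * tau <= T + 2 * tau <= T + 1] because
    [tau <= 1/2]. *)
Let E1 := expR (B * (T + 1)).

Let qnE (n : nat) (s t : R) : scheme_time t = n%:R * tau + s -> 0 <= s ->
  q ^+ n.+1 <= E1.
Proof.
move=> tE s0; apply: (le_trans (expR_pow _ B0)); rewrite ler_expR ler_wpM2l//.
have [_] := scheme_time_itv t; have := time_step_half.
by rewrite tE -(natr1 n) mulrDl mul1r; lra.
Qed.

Lemma scheme_solution_lip (t x y : R) : `|u t x - u t y| <= A * E1 * `|x - y|.
Proof.
have [n [s [tE s0 st ->]]] := scheme_solution_cellP t.
apply: (le_trans (scheme_iter_lip _ s0 (ltW st) _ _)).
by rewrite ler_wpM2r// mulrC ler_wpM2l//; exact: qnE tE s0.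
Qed.

Lemma scheme_solution_time (t t' x : R) :
  `|u t x - u t' x| <= (H + G0) * E1 * `|t - t'|.
Proof.
have HG : 0 <= H + G0 by rewrite addr_ge0// (le_trans _ (G_bound 0 0)).
have V0 : 0 <= (H + G0) * E1 by rewrite mulr_ge0// expR_ge0.
apply: (@le_trans _ _ ((H + G0) * E1 * `|scheme_time t - scheme_time t'|)); last first.
  by rewrite ler_wpM2l// scheme_time_lip.
have tau0 := time_step_gt0.
wlog tt' : t t' / scheme_time t' <= scheme_time t.
  move=> Hw; have [h|/ltW h] := leP (scheme_time t') (scheme_time t); first exact: Hw.
  by rewrite distrC (distrC (scheme_time t)); exact: Hw.
have [n [s [tE s0 st ->]]] := scheme_solution_cellP t.
have [n' [s' [tE' s0' st' ->]]] := scheme_solution_cellP t'.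
rewrite (@ger0_norm _ (scheme_time t - _)) ?subr_ge0//; move: tt'; rewrite tE tE' => tt'.
have nn : (n' <= n)%N.
  rewrite leqNgt; apply/negP => nn'.
  have : n.+1%:R * tau <= n'%:R * tau by rewrite ler_wpM2r ?(ltW tau0)// ler_nat.
  by rewrite -(natr1 n) mulrDl mul1r; lra.
rewrite -(subnKC nn) in tE tt' *.
apply: scheme_iter_cells => //; [|exact: ltW|exact: ltW].
rewrite mulrC ler_wpM2l//; apply: (le_trans _ (qnE tE s0)).
by rewrite ler_weXn2l.
Qed.

Lemma scheme_solution_fold (t x : R) : u t (fold c d x) = u t x.
Proof. exact: scheme_iter_fold. Qed.

Lemma scheme_solution_step (t : R) : 0 <= t -> t <= T ->
  u (t + tau) = scheme_step (u t).
Proof.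
move=> t0 tT; have tau0 := time_step_gt0.
have [n [s [tE s0 st ->]]] := scheme_solution_cellP t.
rewrite scheme_time_id// in tE; last by rewrite ler_wpDr// ltW.
apply: (@scheme_solution_cell n.+1 s) => //.
rewrite scheme_time_id ?lerD2r// ?addr_ge0// ?(ltW tau0)//.
by rewrite tE -(natr1 n) mulrDl mul1r addrAC.
Qed.

Lemma scheme_solution_bound (t x : R) : 0 <= t ->
  1 + `|u t x| <= (1 + C) * expR (D * (t + tau)).
Proof.
move=> t0; have [n [s [tE s0 st ->]]] := scheme_solution_cellP t.
apply: (le_trans (scheme_iter_bound _ s0 (ltW st) _)); rewrite mulrC.
rewrite ler_wpM2l ?addr_ge0//; apply: (le_trans (expR_pow _ D0)).
rewrite ler_expR ler_wpM2l// -(natr1 n) mulrDl mul1r lerD2r.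
apply: (@le_trans _ _ (scheme_time t)); first by rewrite tE lerDl.
by rewrite /scheme_time ge_max t0 ge_min lexx.
Qed.

Lemma scheme_solution0 (x : R) : u 0 x = h0 x.
Proof.
have tau0 := time_step_gt0.
rewrite (@scheme_solution_cell 0 0)// ?mul0r ?addr0 ?scheme_time_id//.
  by rewrite /scheme_iter /= /scheme_start mul0r mul0r addr0.
by rewrite addr_ge0 ?(ltW T0)// ltW.
Qed.

End Scheme.

(** * Smoothing by iterated window averages, and difference quotients at two scales *)

Section Smoothing.
Context {R : realType}.
Implicit Types (w f g : R -> R).

Lemma cont_on_lip (D : set (R * R)) (k : R -> R -> R) (K1 K2 : R) :
  (forall t s x y, `|k t x - k s y| <= K1 * `|t - s| + K2 * `|x - y|) ->
  cont_on D k.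
Proof.
move=> H; apply/cont_onP => t x _ e e0.
pose K := `|K1| + `|K2| + 1.
have K0 : 0 < K by rewrite /K ltr_wpDl// addr_ge0.
exists (e / K); first by rewrite divr_gt0.
move=> s y _; rewrite !ltr_pdivlMr// => st yx; apply: (le_trans (H _ _ _ _)).
have h1 : K1 * `|s - t| <= `|K1| * `|s - t| by rewrite ler_wpM2r// ler_norm.
have h2 : K2 * `|y - x| <= `|K2| * `|y - x| by rewrite ler_wpM2r// ler_norm.
have := normr_ge0 (s - t); have := normr_ge0 (y - x).
have := normr_ge0 K1; have := normr_ge0 K2.
have [h|h] := leP (`|s - t|) (`|y - x|); rewrite /K in st yx; nra.
Qed.

Lemma quadratic_remainder w (w' : R -> R) (K x y : R) :
  (forall x : R, is_derive x (1 : R) w (w' x)) ->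
  (forall x y, `|w' x - w' y| <= K * `|x - y|) ->
  `|w y - w x - w' x * (y - x)| <= K * (y - x) ^+ 2.
Proof.
move=> dw lw.
have dH (r : R) : is_derive r (1 : R) (fun r => w r - w' x * r) (w' r - w' x).
  apply: is_deriveB.
  by rewrite -[X in is_derive _ _ _ X]mulr1; apply: is_deriveZ.
have -> : w y - w x - w' x * (y - x) = (w y - w' x * y) - (w x - w' x * x) by ring.
have -> : K * (y - x) ^+ 2 = K * `|y - x| * `|y - x|.
  by rewrite -mulrA -expr2 real_normK ?num_real.
have K0 : 0 <= K.
  by have := lw 1 0; rewrite subr0 normr1 mulr1; exact: le_trans.
have [xy|yx] := leP x y.
  rewrite {2}(@ger0_norm _ (y - x)) ?subr_ge0//.
  apply: (derive_bound xy dH) => r xr ry; apply: (le_trans (lw _ _)).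
  by rewrite ler_wpM2l// !ger0_norm ?subr_ge0// lerB.
rewrite distrC {2}(distrC y x) (@ger0_norm _ (x - y)) ?subr_ge0 ?(ltW yx)//.
apply: (derive_bound (ltW yx) dH) => r yr rx; apply: (le_trans (lw _ _)).
by rewrite ler_wpM2l// distrC (distrC y) !ger0_norm ?subr_ge0 ?lerB// ltW.
Qed.

(** As a function of the step, the quantity has zero slope at 0 and a second derivative bounded by
    [2 * K * s] on [[0, s]]; [derive_bound] is applied twice. *)
Lemma second_difference_remainder w (w' w'' : R -> R) (K x s : R) : 0 <= s ->
  (forall x : R, is_derive x (1 : R) w (w' x)) ->
  (forall x : R, is_derive x (1 : R) w' (w'' x)) ->
  (forall x y, `|w'' x - w'' y| <= K * `|x - y|) ->
  `|w (x + s) - 2 * w x + w (x - s) - s ^+ 2 * w'' x| <= 2 * K * s ^+ 3.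
Proof.
move=> s0 dw dw' lw.
have K0 : 0 <= K.
  by have := lw 1 0; rewrite subr0 normr1 mulr1; exact: le_trans.
pose H r := w (x + r) + w (x - r) - r ^+ 2 * w'' x.
pose H' r := w' (x + r) - w' (x - r) - 2 * r * w'' x.
have dsq (r : R) : is_derive r (1 : R) (fun r => r ^+ 2 * w'' x) (2 * r * w'' x).
  apply: (@is_derive_quad _ _ _ _ `|w'' x| 1) => // y _.
  have -> : y ^+ 2 * w'' x - r ^+ 2 * w'' x - 2 * r * w'' x * (y - r) =
    w'' x * (y - r) ^+ 2 by ring.
  by rewrite normrM (@ger0_norm _ (_ ^+ 2))// sqr_ge0.
have dlin (r : R) : is_derive r (1 : R) (fun r => 2 * r * w'' x) (2 * w'' x).
  apply: (@is_derive_quad _ _ _ _ 0 1) => // y _.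
  have -> : 2 * y * w'' x - 2 * r * w'' x - 2 * w'' x * (y - r) = 0 by ring.
  by rewrite normr0 mul0r.
have dplus (f f' : R -> R) (r : R) : (forall x : R, is_derive x (1 : R) f (f' x)) ->
    is_derive r (1 : R) (fun r => f (x + r)) (f' (x + r)).
  move=> df; rewrite -[X in is_derive _ _ _ X]mulr1.
  apply: (is_derive1_comp (f := f) (g := fun r : R => x + r)).
  by rewrite -[X in is_derive _ _ _ X]add0r; exact: is_deriveD.
have dminus (f f' : R -> R) (r : R) : (forall x : R, is_derive x (1 : R) f (f' x)) ->
    is_derive r (1 : R) (fun r => f (x - r)) (- f' (x - r)).
  move=> df; rewrite -mulrN1.
  apply: (is_derive1_comp (f := f) (g := fun r : R => x - r)).
  by rewrite -[X in is_derive _ _ _ X]add0r; exact: is_deriveB.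
have dH (r : R) : is_derive r (1 : R) H (H' r).
  by have h1 := dplus _ _ r dw; have h2 := dminus _ _ r dw; apply: is_deriveB; apply: is_deriveD.
have dH' (r : R) : is_derive r (1 : R) H' (w'' (x + r) + w'' (x - r) - 2 * w'' x).
  have h1 := dplus _ _ r dw'; have h2 := dminus _ _ r dw'.
  by rewrite -[w'' (x - r)]opprK; apply: is_deriveB; apply: is_deriveB.
have bH' r : 0 <= r -> r <= s -> `|H' r| <= 2 * K * s * s.
  move=> r0 rs; have := @derive_bound R H' _ 0 r (2 * K * s) r0 dH'.
  rewrite {2}/H' addr0 !subr0 subrr mulr0 mul0r !subr0 => h.
  apply: (le_trans (h _)); last first.
    by rewrite ler_wpM2l// mulr_ge0// mulr_ge0.
  move=> y y0 yr.
  have -> : w'' (x + y) + w'' (x - y) - 2 * w'' x =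
    (w'' (x + y) - w'' x) + (w'' (x - y) - w'' x) by ring.
  apply: (le_trans (ler_normD _ _)).
  have := lw (x + y) x; have := lw (x - y) x.
  have -> : x + y - x = y by ring.
  have -> : x - y - x = - y by ring.
  rewrite normrN (ger0_norm y0).
  have : K * y <= K * s by rewrite ler_wpM2l// (le_trans yr).
  lra.
have := @derive_bound R H H' 0 s _ s0 dH (fun r r0 rs => bH' r r0 rs).
rewrite /H addr0 subr0 expr0n /= mul0r !subr0.
have -> : w (x + s) + w (x - s) - s ^+ 2 * w'' x - (w x + w x) =
  w (x + s) - 2 * w x + w (x - s) - s ^+ 2 * w'' x by ring.
by have -> : 2 * K * s * s * s = 2 * K * s ^+ 3 by ring.
Qed.

(** Differentiation under the mean: the quadratic remainder is bounded uniformly in [s], hence so is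
    its mean. *)
Lemma is_derive_avg_param (k kx : R -> R -> R) (K a b x : R) : a < b ->
  (forall x, continuous (k ^~ x)) -> (forall x, continuous (kx ^~ x)) ->
  (forall s x : R, is_derive x (1 : R) (k s) (kx s x)) ->
  (forall s x y, `|kx s x - kx s y| <= K * `|x - y|) ->
  is_derive x (1 : R) (fun x => avg (k ^~ x) a b) (avg (kx ^~ x) a b).
Proof.
move=> ab ck ckx dk lk; apply: (@is_derive_quad _ _ _ _ K 1) => // y _.
have -> : avg (k^~ y) a b - avg (k^~ x) a b - avg (kx^~ x) a b * (y - x) =
    avg (fun s => k s y + -1 * (k s x + (y - x) * kx s x)) a b.
  have cc : continuous (fun s => k s x + (y - x) * kx s x).
    move=> s; apply: (@continuousD _ _ _ (k ^~ x) (fun s => (y - x) * kx s x)); first exact: ck.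
    by apply: (@continuousM _ _ (cst (y - x)) (kx ^~ x)); [exact: cvg_cst|exact: ckx].
  by rewrite avg_lin// avg_lin//; ring.
rewrite -[X in `|X|]subr0; apply: avg_near => //.
  move=> s; apply: (@continuousD _ _ _ (k ^~ y) (fun s => -1 * (k s x + (y - x) * kx s x))).
    exact: ck.
  apply: (@continuousM _ _ (cst (-1)) (fun s => k s x + (y - x) * kx s x)); first exact: cvg_cst.
  apply: (@continuousD _ _ _ (k ^~ x) (fun s => (y - x) * kx s x)); first exact: ck.
  by apply: (@continuousM _ _ (cst (y - x)) (kx ^~ x)); [exact: cvg_cst|exact: ckx].
move=> s _ _; rewrite subr0.
have -> : k s y + -1 * (k s x + (y - x) * kx s x) = k s y - k s x - kx s x * (y - x).
  by ring.
by apply: quadratic_remainder => //; exact: lk.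
Qed.

Section Window.
Variable p : R.
Hypothesis p0 : 0 < p.

Definition window w x := avg w (x - p) (x + p).

Let win x : x - p < x + p.
Proof. by rewrite ltrD2l gtrN. Qed.

Lemma is_derive_window w (x : R) : continuous w ->
  is_derive x (1 : R) (window w) ((w (x + p) - w (x - p)) / (2 * p)).
Proof.
move=> cw; have -> : 2 * p = p + p by ring.
exact: is_derive_avg.
Qed.

Lemma continuous_window w : continuous w -> continuous (window w).
Proof. by move=> cw; apply: derivable_continuous => x; exact: is_derive_window. Qed.

Lemma window_dist f g (x s eta : R) : continuous f -> continuous g ->
  (forall y, `|y - x| <= p -> `|f y - g (y + s)| <= eta) ->
  `|window f x - window g (x + s)| <= eta.
Proof.
move=> cf cg H; rewrite /window.
have -> : x + s - p = x - p + s by ring.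
have -> : x + s + p = x + p + s by ring.
apply: avg_dist => // y xy yx; apply: H.
by rewrite ler_norml; apply/andP; split; lra.
Qed.

Lemma window_lip w (K : R) : (forall x y, `|w x - w y| <= K * `|x - y|) ->
  forall x y, `|window w x - window w y| <= K * `|x - y|.
Proof.
move=> lw x y; have cw := lipschitz_continuous lw.
have -> : y = x + (y - x) by ring.
apply: window_dist => // r _; apply: (le_trans (lw _ _)).
by rewrite (_ : r - (r + (y - x)) = x - (x + (y - x)))//; ring.
Qed.

Lemma window_reflect w (a x : R) : continuous w -> (forall y, w (a - y) = w y) ->
  window w (a - x) = window w x.
Proof.
move=> cw wE; rewrite /window.
have -> : a - x - p = a - (x + p) by ring.
have -> : a - x + p = a - (x - p) by ring.
rewrite -avg_reflect//; congr avg.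
by apply/funext => y; rewrite wE.
Qed.

(** Two window averages make a continuous function twice differentiable, with an explicit second
    derivative: a second difference at distance [2 * p]. *)
Definition smooth w x := window (window w) x.

Lemma smooth_dist f g (x s eta : R) : continuous f -> continuous g ->
  (forall y, `|y - x| <= 2 * p -> `|f y - g (y + s)| <= eta) ->
  `|smooth f x - smooth g (x + s)| <= eta.
Proof.
move=> cf cg H; apply: window_dist; [exact: continuous_window|exact: continuous_window|].
move=> y yx; apply: window_dist => // r ry; apply: H.
by have := ler_distD y r x; lra.
Qed.

Lemma smooth_cst (a x : R) : smooth (fun=> a) x = a.
Proof.
rewrite /smooth (_ : window (fun=> a) = fun=> a); first exact: avg_cst.
by apply/funext => y; exact: avg_cst.
Qed.

Lemma smooth_near f (x a eta : R) : continuous f ->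
  (forall y, `|y - x| <= 2 * p -> `|f y - a| <= eta) -> `|smooth f x - a| <= eta.
Proof.
move=> cf H; rewrite -[X in _ - X](smooth_cst a (x + 0)).
by apply: smooth_dist => // y; exact: cvg_cst.
Qed.

Lemma smooth_shift w (s x : R) : continuous w ->
  smooth (fun y => w (y + s)) x = smooth w (x + s).
Proof.
move=> cw; apply/eqP; rewrite -subr_eq0 -normr_le0; apply: smooth_dist => //.
  move=> y; apply: (@continuous_comp _ _ _ (fun x : R => x + s) w); last exact: cw.
  by apply: (@lipschitz_continuous _ _ 1) => r z; rewrite mul1r opprD addrACA subrr addr0.
by move=> y _; rewrite subrr normr0.
Qed.

Lemma window_lin f g (k x : R) : continuous f -> continuous g ->
  window (fun y => f y + k * g y) x = window f x + k * window g x.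
Proof. by move=> cf cg; exact: avg_lin. Qed.

Lemma smooth_lin f g (k x : R) : continuous f -> continuous g ->
  smooth (fun y => f y + k * g y) x = smooth f x + k * smooth g x.
Proof.
move=> cf cg; rewrite /smooth -window_lin; [|exact: continuous_window..].
by congr window; apply/funext => y; rewrite window_lin.
Qed.

End Window.

Section DifferenceQuotient.
Variables (w : R -> R) (L E e : R).
Hypotheses (e0 : 0 < e) (wL : forall x y, `|w x - w y| <= L * `|x - y|).
Hypothesis w2 : forall x, `|w (x + e) - 2 * w x + w (x - e)| <= E * e ^+ 2.

(** Let [D_k] be the centred difference over [k] steps. Its second difference in [k] is a difference
    of two second differences of [w], at most [2 * E * e ^+ 2]. Summing once gives the second bound,
    and summing that gives the first. *)
Lemma difference_quotient_scale (k : nat) (x : R) :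
  `|w (x + k%:R * e) - w (x - k%:R * e) - k%:R * (w (x + e) - w (x - e))| <=
    E * e ^+ 2 * k%:R ^+ 2 /\
  `|w (x + k.+1%:R * e) - w (x - k.+1%:R * e) - (w (x + k%:R * e) - w (x - k%:R * e))
     - (w (x + e) - w (x - e))| <= 2 * E * e ^+ 2 * k%:R.
Proof.
elim: k => [|k [IH1 IH2]].
  rewrite !mul0r !mul1r addr0 !subr0 (subrr (w x)) ?subr0 normr0 subrr normr0.
  by rewrite expr0n /= !mulr0.
have h1 := w2 (x + k.+1%:R * e); have h2 := w2 (x - k.+1%:R * e).
have E1 : x + k.+1%:R * e + e = x + k.+2%:R * e by rewrite -(natr1 k.+1); ring.
have E2 : x + k.+1%:R * e - e = x + k%:R * e by rewrite -(natr1 k); ring.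
have E3 : x - k.+1%:R * e + e = x - k%:R * e by rewrite -(natr1 k); ring.
have E4 : x - k.+1%:R * e - e = x - k.+2%:R * e by rewrite -(natr1 k.+1); ring.
rewrite E1 E2 in h1; rewrite E3 E4 in h2; rewrite -(natr1 k) in h1 h2 IH2 *.
move: h1 h2 IH1 IH2; set a := w (x + k.+2%:R * e); set b := w (x - k.+2%:R * e).
set a1 := w (x + (k%:R + 1) * e); set b1 := w (x - (k%:R + 1) * e).
set a0 := w (x + k%:R * e); set b0 := w (x - k%:R * e).
set dd := w (x + e) - w (x - e).
have k0 : 0 <= k%:R :> R by exact: ler0n.
have Ee : 0 <= E * e ^+ 2 by exact: le_trans (w2 0).
rewrite !ler_norml => /andP[? ?] /andP[? ?] /andP[? ?] /andP[? ?].
by split; rewrite ?expr2; apply/andP; split; lra.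
Qed.

Lemma difference_quotient_modulus (k : nat) (x y : R) : (0 < k)%N ->
  `|(w (x + e) - w (x - e)) / (2 * e) - (w (y + e) - w (y - e)) / (2 * e)| <=
    E * (k%:R * e) + L * (`|x - y| / (k%:R * e)).
Proof.
move=> k0; have kR : 0 < k%:R :> R by rewrite ltr0n.
have [hx _] := difference_quotient_scale k x.
have [hy _] := difference_quotient_scale k y.
have h1 := wL (x + k%:R * e) (y + k%:R * e).
have h2 := wL (x - k%:R * e) (y - k%:R * e).
rewrite opprD addrACA subrr addr0 in h1.
rewrite opprB addrA subrK in h2.
move: hx hy h1 h2; set qx := w (x + e) - w (x - e); set qy := w (y + e) - w (y - e).
set xp := w (x + _); set xm := w (x - _); set yp := w (y + _); set ym := w (y - _).
move=> hx hy h1 h2.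
have ke : 0 < 2 * (k%:R * e) by rewrite !mulr_gt0.
rewrite -(ler_pM2l ke).
have -> : 2 * (k%:R * e) * (E * (k%:R * e) + L * (`|x - y| / (k%:R * e))) =
  2 * (E * e ^+ 2 * k%:R ^+ 2) + 2 * (L * `|x - y|).
  by field; rewrite !gt_eqF.
rewrite -[X in X * `| _ |](gtr0_norm ke) -normrM.
have -> : 2 * (k%:R * e) * (qx / (2 * e) - qy / (2 * e)) = k%:R * qx - k%:R * qy.
  by field; rewrite gt_eqF.
move: hx hy h1 h2.
rewrite !ler_norml => /andP[? ?] /andP[? ?] /andP[? ?] /andP[? ?].
by apply/andP; split; lra.
Qed.

End DifferenceQuotient.

End Smoothing.

(** * Mollification of the scheme *)

Section Approximation.
Context {R : realType}.
Variables (c d T : R) (G : R -> R -> R) (B M G0 : R).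
Hypotheses (cd : c < d) (T0 : 0 < T) (B0 : 0 <= B) (M0 : 0 <= M).
Hypothesis G_lip_y : forall y y' z, `|G y z - G y' z| <= B * `|y - y'|.
Hypothesis G_lip_z : forall y z z', `|G y z - G y z'| <= M * `|z - z'|.
Hypothesis G_bound : forall y z, `|G y z| <= G0.
Variables (u : R -> R -> R) (e L V p : R) (k : nat).
Hypotheses (e0 : 0 < e) (L0 : 0 <= L) (V0 : 0 <= V) (p0 : 0 < p) (k0 : (0 < k)%N).
Hypothesis uL : forall t x y, `|u t x - u t y| <= L * `|x - y|.
Hypothesis uV : forall t s x, `|u t x - u s x| <= V * `|t - s|.
Hypothesis u_fold : forall t x, u t (fold c d x) = u t x.
Local Notation tau := (time_step e).
Hypothesis u_step : forall t, 0 <= t -> t <= T ->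
  u (t + tau) = scheme_step c d G e (u t).

Let tau0 : 0 < tau := time_step_gt0 e0.
Let E := V + G0.

Let quot t x := (u t (x + e) - u t (x - e)) / (2 * e).

Definition source t x := G (u t (fold c d x)) (quot t (fold c d x)).

(** The scheme, imposed at [fold x], is read here at every real [x]. A reflection exchanges the two
    neighbours, which their sum does not see; the sign of the slope does matter to [G], so [source]
    keeps the folded point. *)
Lemma scheme_solution_equation t x : 0 <= t -> t <= T ->
  u (t + tau) x = (u t (x + e) + u t (x - e)) / 2 + tau * source t x.
Proof.
move=> t0 tT; rewrite u_step// /scheme_step /scheme_value -/(quot _ _) -/(source _ _).
congr (_ / _ + _).
have [s [q [s1 fE fI]]] := fold_affine cd x.
have uI w : u t (s * w + q) = u t w by rewrite -u_fold fI u_fold.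
case: s1 => sE; rewrite fE sE in uI *.
  have -> : 1 * x + q + e = 1 * (x + e) + q by ring.
  have -> : 1 * x + q - e = 1 * (x - e) + q by ring.
  by rewrite !uI.
have -> : -1 * x + q + e = -1 * (x - e) + q by ring.
have -> : -1 * x + q - e = -1 * (x + e) + q by ring.
by rewrite !uI addrC.
Qed.

(** Solving the scheme for the second difference leaves twice the time increment, at most [V * tau],
    and twice [tau * G0]; and [2 * tau = e ^+ 2]. *)
Lemma scheme_solution_diff2 t x : 0 <= t -> t <= T ->
  `|u t (x + e) - 2 * u t x + u t (x - e)| <= E * e ^+ 2.
Proof.
move=> t0 tT; have := scheme_solution_equation x t0 tT.
have := uV (t + tau) t x; rewrite addrAC subrr add0r (gtr0_norm tau0).
have := G_bound (u t (fold c d x)) (quot t (fold c d x)).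
rewrite -/(source t x) => h1 h2 h3.
have h4 : tau * `|source t x| <= tau * G0 by rewrite ler_pM2l.
have -> : u t (x + e) - 2 * u t x + u t (x - e) =
  2 * (u (t + tau) x - u t x) - 2 * (tau * source t x) by rewrite h3; field.
have -> : E * e ^+ 2 = 2 * (V * tau) + 2 * (tau * G0).
  by rewrite /E /time_step; field.
apply: (le_trans (ler_normB _ _)).
rewrite (normrM 2) (normrM 2 (tau * _)) (normrM tau) (gtr0_norm tau0).
by rewrite (@ger0_norm _ 2)//; lra.
Qed.

Let ell := k%:R * e.

(* The centred difference quotient at the scale e of the grid need not be continuous
   uniformly in e, but the bound on second differences allows to replace it by the
   quotient at the larger scale ell = k e, which is L / ell-Lipschitz. *)
Lemma scheme_quotient_modulus t x y : 0 <= t -> t <= T ->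
  `|quot t x - quot t y| <= E * ell + L * (`|x - y| / ell).
Proof.
move=> t0 tT; apply: (difference_quotient_modulus e0 (uL t) _ _ _ k0) => r.
exact: scheme_solution_diff2.
Qed.

Let u_cont t : continuous (u t). Proof. exact: lipschitz_continuous (uL t). Qed.

Let quot_lip t x y : `|quot t x - quot t y| <= L / e * `|x - y|.
Proof.
rewrite /quot -mulrBl normrM (@gtr0_norm _ (2 * e)^-1) ?invr_gt0 ?mulr_gt0//.
rewrite ler_pdivrMr ?mulr_gt0//.
have -> : L / e * `|x - y| * (2 * e) = L * `|x - y| + L * `|x - y|.
  by field; rewrite gt_eqF.
have -> : u t (x + e) - u t (x - e) - (u t (y + e) - u t (y - e)) =
  (u t (x + e) - u t (y + e)) - (u t (x - e) - u t (y - e)) by ring.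
have := uL t (x + e) (y + e); have := uL t (x - e) (y - e).
have -> : x + e - (y + e) = x - y by ring.
have -> : x - e - (y - e) = x - y by ring.
have := ler_normB (u t (x + e) - u t (y + e)) (u t (x - e) - u t (y - e)).
lra.
Qed.

Let source_cont t : continuous (source t).
Proof.
apply: (@lipschitz_continuous _ _ (B * L + M * (L / e))) => x y; rewrite /source.
set x' := fold _ _ _; set y' := fold _ _ _.
have xy : `|x' - y'| <= `|x - y| by exact: fold_lipschitz.
have := G_lip_y (u t x') (u t y') (quot t x').
have := G_lip_z (u t y') (quot t x') (quot t y').
have h1 : B * `|u t x' - u t y'| <= B * (L * `|x - y|).
  by rewrite ler_wpM2l// (le_trans (uL _ _ _))// ler_wpM2l.
have h2 : M * `|quot t x' - quot t y'| <= M * (L / e * `|x - y|).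
  rewrite ler_wpM2l// (le_trans (quot_lip _ _ _))// ler_wpM2l//.
  by rewrite divr_ge0// ltW.
have := ler_distD (G (u t y') (quot t x')) (G (u t x') (quot t x')) (G (u t y') (quot t y')).
lra.
Qed.

Let Phi t x := smooth p (u t) x.
Let Phix t x := (window p (u t) (x + p) - window p (u t) (x - p)) / (2 * p).
Let Phixx t x := (u t (x + 2 * p) - 2 * u t x + u t (x - 2 * p)) / (4 * p ^+ 2).

Let p2 : 0 < 2 * p. Proof. by rewrite mulr_gt0. Qed.
Let p4 : 0 < 4 * p ^+ 2. Proof. by rewrite mulr_gt0// exprn_gt0. Qed.

Let dPhi (t x : R) : is_derive x (1 : R) (Phi t) (Phix t x).
Proof. by apply: is_derive_window => //; exact: continuous_window. Qed.

Let dPhix (t x : R) : is_derive x (1 : R) (Phix t) (Phixx t x).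
Proof.
have sh (f f' : R -> R) (s r : R) : (forall x : R, is_derive x (1 : R) f (f' x)) ->
    is_derive r (1 : R) (fun r => f (r + s)) (f' (r + s)).
  move=> df; rewrite -[X in is_derive _ _ _ X]mulr1.
  apply: (is_derive1_comp (f := f) (g := fun r : R => r + s)).
  by rewrite -[X in is_derive _ _ _ X]addr0; exact: is_deriveD.
have dw (r : R) : is_derive r (1 : R) (window p (u t))
    ((u t (r + p) - u t (r - p)) / (2 * p)) by exact: is_derive_window.
have h1 := sh _ _ p x dw; have h2 := sh _ _ (- p) x dw.
have -> : Phix t = (fun x => (2 * p)^-1 * (window p (u t) (x + p) - window p (u t) (x - p))).
  by apply/funext => y; rewrite /Phix mulrC.
have -> : Phixx t x = (2 * p)^-1 * ((u t (x + p + p) - u t (x + p - p)) / (2 * p) -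
    (u t (x - p + p) - u t (x - p - p)) / (2 * p)).
  rewrite /Phixx (_ : x + p + p = x + 2 * p); last by ring.
  rewrite (_ : x + p - p = x); last by ring.
  rewrite (_ : x - p + p = x); last by ring.
  rewrite (_ : x - p - p = x - 2 * p); last by ring.
  by field; rewrite gt_eqF.
by apply: is_deriveZ; apply: is_deriveB.
Qed.

Let Phixx_lip t x y : `|Phixx t x - Phixx t y| <= L / p ^+ 2 * `|x - y|.
Proof.
rewrite /Phixx -mulrBl normrM (@gtr0_norm _ (4 * p ^+ 2)^-1) ?invr_gt0//.
rewrite ler_pdivrMr//.
have -> : L / p ^+ 2 * `|x - y| * (4 * p ^+ 2) = 4 * (L * `|x - y|).
  by field; rewrite gt_eqF.
have h0 := uL t x y.
have := uL t (x + 2 * p) (y + 2 * p); have := uL t (x - 2 * p) (y - 2 * p).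
have -> : x + 2 * p - (y + 2 * p) = x - y by ring.
have -> : x - 2 * p - (y - 2 * p) = x - y by ring.
move: h0; rewrite !ler_norml => /andP[? ?] /andP[? ?] /andP[? ?].
by apply/andP; split; lra.
Qed.

Let Phixx_time t s x : `|Phixx t x - Phixx s x| <= V / p ^+ 2 * `|t - s|.
Proof.
rewrite /Phixx -mulrBl normrM (@gtr0_norm _ (4 * p ^+ 2)^-1) ?invr_gt0//.
rewrite ler_pdivrMr//.
have -> : V / p ^+ 2 * `|t - s| * (4 * p ^+ 2) = 4 * (V * `|t - s|).
  by field; rewrite gt_eqF.
have := uV t s (x + 2 * p); have := uV t s (x - 2 * p); have := uV t s x.
rewrite !ler_norml => /andP[? ?] /andP[? ?] /andP[? ?].
by apply/andP; split; lra.
Qed.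

Let win_lip t x y : `|window p (u t) x - window p (u t) y| <= L * `|x - y|.
Proof. by apply: window_lip => //; exact: uL. Qed.

Let Phi_lip t x y : `|Phi t x - Phi t y| <= L * `|x - y|.
Proof. by apply: window_lip => //; exact: win_lip. Qed.

Let win_time t s x : `|window p (u t) x - window p (u s) x| <= V * `|t - s|.
Proof.
rewrite -{2}[x]addr0; apply: window_dist => // y _.
by rewrite addr0; exact: uV.
Qed.

Let Phi_time t s x : `|Phi t x - Phi s x| <= V * `|t - s|.
Proof.
rewrite -{2}[x]addr0; apply: smooth_dist => // y _.
by rewrite addr0; exact: uV.
Qed.

Let Phix_bound t x : `|Phix t x| <= L.
Proof.
rewrite /Phix normrM (@gtr0_norm _ (2 * p)^-1) ?invr_gt0//.
rewrite ler_pdivrMr//; apply: (le_trans (win_lip _ _ _)).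
have -> : x + p - (x - p) = 2 * p by ring.
by rewrite (gtr0_norm p2).
Qed.

Let Phix_lip t x y : `|Phix t x - Phix t y| <= L / p * `|x - y|.
Proof.
rewrite /Phix -mulrBl normrM (@gtr0_norm _ (2 * p)^-1) ?invr_gt0//.
rewrite ler_pdivrMr//.
have -> : L / p * `|x - y| * (2 * p) = 2 * (L * `|x - y|).
  by field; rewrite gt_eqF.
have := win_lip t (x + p) (y + p); have := win_lip t (x - p) (y - p).
have -> : x + p - (y + p) = x - y by ring.
have -> : x - p - (y - p) = x - y by ring.
rewrite !ler_norml => /andP[? ?] /andP[? ?].
by apply/andP; split; lra.
Qed.

Let Phix_time t s x : `|Phix t x - Phix s x| <= V / p * `|t - s|.
Proof.
rewrite /Phix -mulrBl normrM (@gtr0_norm _ (2 * p)^-1) ?invr_gt0//.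
rewrite ler_pdivrMr//.
have -> : V / p * `|t - s| * (2 * p) = 2 * (V * `|t - s|).
  by field; rewrite gt_eqF.
have := win_time t s (x + p); have := win_time t s (x - p).
rewrite !ler_norml => /andP[? ?] /andP[? ?].
by apply/andP; split; lra.
Qed.

(** The time window is exactly one forward step, so the time derivative is the increment of [Phi]
    over one step divided by [tau], the quantity governed by the scheme. *)
Definition mollified t x := avg (Phi ^~ x) t (t + tau).
Definition mollified_t t x := (Phi (t + tau) x - Phi t x) / tau.
Definition mollified_x t x := avg (Phix ^~ x) t (t + tau).
Definition mollified_xx t x := avg (Phixx ^~ x) t (t + tau).

Let tt t : t < t + tau. Proof. by rewrite ltrDl. Qed.

Let time_cont (f : R -> R -> R) (K : R) :
  (forall t s x, `|f t x - f s x| <= K * `|t - s|) -> forall x, continuous (f ^~ x).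
Proof. by move=> H x; apply: (@lipschitz_continuous _ _ K) => t s; exact: H. Qed.

Let avg_cont_on (f : R -> R -> R) (K1 K2 : R) :
  (forall t s x, `|f t x - f s x| <= K1 * `|t - s|) ->
  (forall t x y, `|f t x - f t y| <= K2 * `|x - y|) ->
  cont_on (rect T c d) (fun t x => avg (f ^~ x) t (t + tau)).
Proof.
move=> h1 h2; apply: (@cont_on_lip _ _ _ K1 K2) => t s x y.
have -> : s + tau = t + tau + (s - t) by ring.
rewrite [X in avg _ X (_ + (s - t))](_ : s = t + (s - t)); last by ring.
apply: avg_dist => //; [exact: time_cont h1 _|exact: time_cont h1 _|].
move=> r _ _; have := h1 r (r + (s - t)) x; have := h2 (r + (s - t)) x y.
have -> : r - (r + (s - t)) = t - s by ring.
have := ler_distD (f (r + (s - t)) x) (f r x) (f (r + (s - t)) y).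
lra.
Qed.

Lemma mollified_C12 : is_C12 T c d mollified mollified_t mollified_x mollified_xx.
Proof.
have Phi_cont := time_cont Phi_time.
split; first split.
- exact: avg_cont_on Phi_time Phi_lip.
- apply: (@cont_on_lip _ _ _ (2 * V / tau) (2 * L / tau)) => t s x y.
  rewrite /mollified_t -mulrBl normrM (@gtr0_norm _ tau^-1) ?invr_gt0//.
  rewrite ler_pdivrMr//.
  have -> : (2 * V / tau * `|t - s| + 2 * L / tau * `|x - y|) * tau =
    2 * (V * `|t - s|) + 2 * (L * `|x - y|) by field; rewrite gt_eqF.
  have := Phi_time (t + tau) (s + tau) x; have := Phi_time t s x.
  have := Phi_lip (s + tau) x y; have := Phi_lip s x y.
  have -> : t + tau - (s + tau) = t - s by ring.
  rewrite !ler_norml => /andP[? ?] /andP[? ?] /andP[? ?] /andP[? ?].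
  by apply/andP; split; lra.
- exact: avg_cont_on Phix_time Phix_lip.
- exact: avg_cont_on Phixx_time Phixx_lip.
- move=> t x _ _; apply: is_derive_has_deriv_within.
  have := is_derive_avg 0 tau t (Phi_cont x).
  rewrite subr0 addr0; congr (is_derive _ _ _ _).
  by apply/funext => r; rewrite subr0.
- move=> t x _ _; apply: is_derive_has_deriv_within.
  by apply: (is_derive_avg_param x (tt t) (time_cont Phi_time) (time_cont Phix_time)
    (fun s => @dPhi s) (fun s => Phix_lip s)).
- move=> t x _ _; apply: is_derive_has_deriv_within.
  by apply: (is_derive_avg_param x (tt t) (time_cont Phix_time) (time_cont Phixx_time)
    (fun s => @dPhix s) (fun s => Phixx_lip s)).
Qed.

(** The window average of a function even about [a] is even about [a], so the difference defining
    [Phix] vanishes there. *)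
Lemma mollified_neumann t : mollified_x t c = 0 /\ mollified_x t d = 0.
Proof.
have H a : (forall s y, u s (2 * a - y) = u s y) -> mollified_x t a = 0.
  move=> ua; rewrite /mollified_x (_ : Phix ^~ a = fun=> 0); first exact: avg_cst.
  apply/funext => s; rewrite /Phix.
  have -> : a - p = 2 * a - (a + p) by ring.
  by rewrite window_reflect// subrr mul0r.
by split; apply: H => s y; rewrite -u_fold ?fold_reflect_left// ?fold_reflect_right// u_fold.
Qed.

Lemma mollified_x_bound t x : `|mollified_x t x| <= L.
Proof.
rewrite -[mollified_x t x]subr0; apply: avg_near => //.
  exact: time_cont Phix_time x.
by move=> s _ _; rewrite subr0.
Qed.

Let smooth_u_near t x : `|Phi t x - u t x| <= L * (2 * p).
Proof.
apply: smooth_near => // y yx; apply: (le_trans (uL _ _ _)).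
by rewrite ler_wpM2l.
Qed.

Lemma mollified_near t x : `|mollified t x - u t x| <= V * tau + L * (2 * p).
Proof.
apply: avg_near => //; first exact: time_cont Phi_time x.
move=> s st ts; have := Phi_time s t x; have := smooth_u_near t x.
have st' : `|s - t| <= tau by rewrite ger0_norm ?subr_ge0// lerBlDl.
have : V * `|s - t| <= V * tau by rewrite ler_wpM2l.
have := ler_distD (Phi t x) (Phi s x) (u t x); lra.
Qed.

Lemma mollified_bound t x (K : R) : (forall s y, t <= s -> s <= t + tau -> `|u s y| <= K) ->
  `|mollified t x| <= K.
Proof.
move=> uK; rewrite -[mollified t x]subr0; apply: avg_near => //.
  exact: time_cont Phi_time x.
move=> s st ts; apply: smooth_near => // y _; rewrite subr0; exact: uK.
Qed.

Let omega := E * ell + L * (2 * p / ell).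

Let ell0 : 0 < ell. Proof. by rewrite mulr_gt0// ltr0n. Qed.
Let E0 : 0 <= E. Proof. by rewrite addr_ge0// (le_trans _ (G_bound 0 0)). Qed.

Let smooth_quot t x : 0 <= t -> t <= T -> `|smooth p (quot t) x - quot t x| <= omega.
Proof.
move=> t0 tT; apply: smooth_near => //.
  exact: lipschitz_continuous (quot_lip t).
move=> y yx; apply: (le_trans (scheme_quotient_modulus _ _ t0 tT)).
by rewrite lerD2l ler_wpM2l// ler_wpM2r// invr_ge0 ltW.
Qed.

Let smooth_source t x : 0 <= t -> t <= T ->
  `|smooth p (source t) x - source t x| <= B * (L * (2 * p)) + M * omega.
Proof.
move=> t0 tT; apply: smooth_near => // y yx; rewrite /source.
set x' := fold _ _ x; set y' := fold _ _ y.
have xy : `|y' - x'| <= 2 * p by rewrite (le_trans (fold_lipschitz cd _ _)).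
have := G_lip_y (u t y') (u t x') (quot t y').
have := G_lip_z (u t x') (quot t y') (quot t x').
have h1 : B * `|u t y' - u t x'| <= B * (L * (2 * p)).
  by rewrite ler_wpM2l// (le_trans (uL _ _ _))// ler_wpM2l.
have h2 : M * `|quot t y' - quot t x'| <= M * omega.
  rewrite ler_wpM2l// (le_trans (scheme_quotient_modulus _ _ t0 tT))//.
  by rewrite lerD2l ler_wpM2l// ler_wpM2r// invr_ge0 ltW.
have := ler_distD (G (u t x') (quot t y')) (G (u t y') (quot t y')) (G (u t x') (quot t x')).
lra.
Qed.

Let shift_cont t (s : R) : continuous (fun y => u t (y + s)).
Proof.
apply: (@lipschitz_continuous _ _ L) => x y; apply: (le_trans (uL _ _ _)).
by have -> : x + s - (y + s) = x - y by ring.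
Qed.

(** Averaging commutes with translations and linear combinations, so the scheme holds exactly for
    [Phi]; the nonlinearity enters only through the averaged [source]. *)
Let smooth_equation t x : 0 <= t -> t <= T ->
  mollified_t t x = (Phi t (x + e) - 2 * Phi t x + Phi t (x - e)) / e ^+ 2 +
    smooth p (source t) x.
Proof.
move=> t0 tT.
have cm : continuous (fun y => u t (y + e) + -1 * u t (y - e)).
  move=> y; apply: (@continuousD _ _ _ (fun y => u t (y + e)) (fun y => -1 * u t (y - e))).
    exact: shift_cont.
  by apply: (@continuousM _ _ (cst (-1)) (fun y => u t (y - e)));
    [exact: cvg_cst|exact: shift_cont].
have cq : continuous (fun y => u t (y + e) + (-1 / 2) * (u t (y + e) + -1 * u t (y - e))).
  move=> y; apply: (@continuousD _ _ _ (fun y => u t (y + e))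
    (fun y => (-1 / 2) * (u t (y + e) + -1 * u t (y - e)))); first exact: shift_cont.
  by apply: (@continuousM _ _ (cst (-1 / 2)) (fun y => u t (y + e) + -1 * u t (y - e)));
    [exact: cvg_cst|exact: cm].
have -> : mollified_t t x = (smooth p (fun y => (u t (y + e) + (-1 / 2) *
    (u t (y + e) + -1 * u t (y - e))) + tau * source t y) x - Phi t x) / tau.
  rewrite /mollified_t /Phi; congr ((smooth _ _ _ - _) / _).
  by apply/funext => y; rewrite scheme_solution_equation//; field.
do 3!(rewrite smooth_lin//).
rewrite (smooth_shift p0 e x)// (smooth_shift p0 (- e) x)//.
rewrite -/(Phi t (x + e)) -/(Phi t (x - e)) /time_step.
by field; rewrite gt_eqF.
Qed.

(** The errors, in order: replacing the second difference of [Phi] by [Phixx], averaging [Phixx] in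
    time, moving the average past [source], and passing from grid data to mollified data inside [G].
    [omega] bounds the oscillation of the quotient over the radius [2 * p], through the intermediate
    scale [ell]. *)
Lemma mollified_residual t x : 0 <= t -> t <= T -> x \in `[c, d] ->
  `|mollified_t t x - mollified_xx t x - G (mollified t x) (mollified_x t x)| <=
    2 * (L / p ^+ 2) * e + V / p ^+ 2 * tau + (B * (L * (2 * p)) + M * omega) +
    (B * (V * tau + L * (2 * p)) + M * (omega + L / p * e + V / p * tau)).
Proof.
move=> t0 tT xcd; rewrite smooth_equation//.
have h1 : `|(Phi t (x + e) - 2 * Phi t x + Phi t (x - e)) / e ^+ 2 - Phixx t x| <=
    2 * (L / p ^+ 2) * e.
  have := second_difference_remainder x (ltW e0) (@dPhi t) (@dPhix t) (Phixx_lip t).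
  have e2 : 0 < e ^+ 2 by rewrite exprn_gt0.
  set w := _ + Phi t (x - e) => h.
  have -> : w / e ^+ 2 - Phixx t x = (w - e ^+ 2 * Phixx t x) / e ^+ 2.
    by field; rewrite gt_eqF.
  rewrite normrM normfV (gtr0_norm e2) ler_pdivrMr//; apply: (le_trans h).
  by rewrite le_eqVlt; apply/orP; left; apply/eqP; field; rewrite gt_eqF.
have h2 : `|mollified_xx t x - Phixx t x| <= V / p ^+ 2 * tau.
  apply: avg_near => //; first exact: time_cont Phixx_time x.
  move=> s st ts; apply: (le_trans (Phixx_time _ _ _)); apply: ler_wpM2l.
    by rewrite divr_ge0// exprn_ge0// ltW.
  by rewrite ger0_norm ?subr_ge0// lerBlDl.
have h3 := smooth_source x t0 tT.
have h4 : `|mollified_x t x - Phix t x| <= V / p * tau.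
  apply: avg_near => //; first exact: time_cont Phix_time x.
  move=> s st ts; apply: (le_trans (Phix_time _ _ _)); apply: ler_wpM2l.
    by rewrite divr_ge0// ltW.
  by rewrite ger0_norm ?subr_ge0// lerBlDl.
have h5 : `|smooth p (quot t) x - Phix t x| <= L / p * e.
  have -> : smooth p (quot t) x = (Phi t (x + e) - Phi t (x - e)) / (2 * e).
    have -> : quot t = fun y => (0 : R) + (2 * e)^-1 * (u t (y + e) + -1 * u t (y - e)).
      by apply/funext => y; rewrite /quot mulN1r add0r mulrC.
    have cm : continuous (fun y => u t (y + e) + -1 * u t (y - e)).
      move=> y; apply: (@continuousD _ _ _ (fun y => u t (y + e)) (fun y => -1 * u t (y - e))).
        exact: shift_cont.
      by apply: (@continuousM _ _ (cst (-1)) (fun y => u t (y - e)));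
        [exact: cvg_cst|exact: shift_cont].
    rewrite (smooth_lin p0 (f := fun=> 0))//; last by move=> y; exact: cvg_cst.
    rewrite smooth_cst// smooth_lin//.
    rewrite (smooth_shift p0 e x)// (smooth_shift p0 (- e) x)//.
    by rewrite -/(Phi t (x + e)) -/(Phi t (x - e)) mulN1r add0r mulrC.
  have ha := quadratic_remainder x (x + e) (@dPhi t) (Phix_lip t).
  have hb := quadratic_remainder x (x - e) (@dPhi t) (Phix_lip t).
  move: ha hb; have -> : x + e - x = e by ring.
  have -> : x - e - x = - e by ring.
  rewrite sqrrN => ha hb.
  have -> : (Phi t (x + e) - Phi t (x - e)) / (2 * e) - Phix t x =
    ((Phi t (x + e) - Phi t x - Phix t x * e) -
     (Phi t (x - e) - Phi t x - Phix t x * - e)) / (2 * e).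
    by field; rewrite gt_eqF.
  rewrite normrM (@gtr0_norm _ (2 * e)^-1) ?invr_gt0 ?mulr_gt0//.
  rewrite ler_pdivrMr ?mulr_gt0//; apply: (le_trans (ler_normB _ _)).
  have -> : L / p * e * (2 * e) = L / p * e ^+ 2 + L / p * e ^+ 2 by ring.
  exact: lerD.
have h6 := smooth_quot x t0 tT.
have h7 := mollified_near t x.
have sE : source t x = G (u t x) (quot t x) by rewrite /source fold_id.
have h8 := G_lip_y (u t x) (mollified t x) (quot t x).
have h9 := G_lip_z (mollified t x) (quot t x) (mollified_x t x).
have h10 : B * `|u t x - mollified t x| <= B * (V * tau + L * (2 * p)).
  by rewrite ler_wpM2l// distrC.
have h11 : M * `|quot t x - mollified_x t x| <= M * (omega + L / p * e + V / p * tau).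
  rewrite ler_wpM2l//.
  have := ler_distD (smooth p (quot t) x) (quot t x) (mollified_x t x).
  have := ler_distD (Phix t x) (smooth p (quot t) x) (mollified_x t x).
  rewrite (distrC (quot t x) (smooth p (quot t) x)) (distrC (Phix t x) (mollified_x t x)).
  move: h4 h5 h6; lra.
rewrite sE in h3.
set a := (_ / e ^+ 2) in h1 *; set b := smooth p (source t) x in h3 *.
set g1 := G (u t x) (quot t x) in h3 h8; set g2 := G (mollified t x) (quot t x) in h8 h9.
set g3 := G (mollified t x) (mollified_x t x) in h9 *.
have -> : a + b - mollified_xx t x - g3 = (a - Phixx t x) - (mollified_xx t x - Phixx t x)
   + (b - g1) + ((g1 - g2) + (g2 - g3)) by ring.
apply: (le_trans (ler_normD _ _)); apply: lerD.
  apply: (le_trans (ler_normD _ _)); apply: lerD => //.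
  by apply: (le_trans (ler_normB _ _)); apply: lerD.
apply: (le_trans (ler_normD _ _)); apply: lerD; first exact: le_trans h10.
exact: le_trans h11.
Qed.

End Approximation.

Lemma expR_le_linear (R : realType) (y : R) : 0 <= y -> y <= 1 / 2 -> expR y <= 1 + 2 * y.
Proof.
move=> y0 y2; have h := expR_ge1Dx (- y).
have h1 : expR y * expR (- y) = 1 by rewrite -expRD subrr expR0.
have h2 := expR_gt0 y.
have : expR y * (1 - y) <= 1 by rewrite -[X in _ <= X]h1 ler_wpM2l// ltW.
nra.
Qed.

(** * Choice of the scales: smooth approximate solutions *)

Section Approximants.
Context {R : realType}.
Variables (c d T : R) (G : R -> R -> R) (B M G0 D : R).
Hypotheses (cd : c < d) (T0 : 0 < T).
Hypotheses (B0 : 0 <= B) (M0 : 0 <= M) (D0 : 0 <= D).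
Hypothesis G_lip_y : forall y y' z, `|G y z - G y' z| <= B * `|y - y'|.
Hypothesis G_lip_z : forall y z z', `|G y z - G y z'| <= M * `|z - z'|.
Hypothesis G_bound : forall y z, `|G y z| <= G0.
Hypothesis G_zero : forall y, `|G y 0| <= D * (1 + `|y|).
Variables (h : R -> R) (A C : R).
Hypotheses (A0 : 0 <= A) (C0 : 0 <= C).
Hypothesis h_lip : forall x x', x \in `[c, d] -> x' \in `[c, d] ->
  `|h x - h x'| <= A * `|x - x'|.
Hypothesis h_bound : forall x, x \in `[c, d] -> `|h x| <= C.

(** Averaging the reflected extension of [h] preserves [A] and [C] and gives quadratic second
    differences. [H] may blow up as [e] tends to 0, which is harmless: it enters only the
    time-Lipschitz constant, fixed before the grid is chosen. *)
Lemma mollified_initial (e : R) : 0 < e -> exists (h0 : R -> R) (H : R), [/\ 0 <= H,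
  forall x, h0 (fold c d x) = h0 x, forall x y, `|h0 x - h0 y| <= A * `|x - y|,
  forall x, `|h0 x| <= C &
  (forall x s, `|h0 (x + s) - 2 * h0 x + h0 (x - s)| <= H * s ^+ 2) /\
  (forall x, x \in `[c, d] -> `|h0 x - h x| <= e)].
Proof.
move=> e0; pose w x := h (fold c d x).
have wL x y : `|w x - w y| <= A * `|x - y|.
  apply: (le_trans (h_lip (fold_itv cd x) (fold_itv cd y))).
  by rewrite ler_wpM2l// fold_lipschitz.
have cw := lipschitz_continuous wL.
pose p := e / (A + 1).
have A1 : 0 < A + 1 by rewrite ltr_wpDl.
have p0 : 0 < p by rewrite divr_gt0.
have pA : A * p <= e.
  have : (A + 1) * p = e by rewrite /p mulrC divfK// gt_eqF.
  by move: p0; rewrite mulrDl mul1r; lra.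
have dw (x : R) : is_derive x (1 : R) (window p w) ((w (x + p) - w (x - p)) / (2 * p)).
  exact: is_derive_window.
have dwL x y : `|(w (x + p) - w (x - p)) / (2 * p) - (w (y + p) - w (y - p)) / (2 * p)|
    <= A / p * `|x - y|.
  have p2 : 0 < 2 * p by rewrite mulr_gt0.
  rewrite -mulrBl normrM (@gtr0_norm _ (2 * p)^-1) ?invr_gt0// ler_pdivrMr//.
  have -> : A / p * `|x - y| * (2 * p) = 2 * (A * `|x - y|).
    by field; rewrite gt_eqF.
  have := wL (x + p) (y + p); have := wL (x - p) (y - p).
  have -> : x + p - (y + p) = x - y by ring.
  have -> : x - p - (y - p) = x - y by ring.
  rewrite !ler_norml => /andP[? ?] /andP[? ?].
  by apply/andP; split; lra.
exists (window p w), (2 * (A / p)); split.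
- by rewrite mulr_ge0// divr_ge0// ltW.
- move=> x; have [s [q [s1 -> fI]]] := fold_affine cd x.
  have wI y : w (s * y + q) = w y by rewrite /w fI.
  case: s1 => sE; rewrite sE in wI *.
    rewrite mul1r; apply/eqP; rewrite eq_sym -subr_eq0 -normr_le0.
    by apply: window_dist => // y _; rewrite -(wI y) mul1r subrr normr0.
  rewrite mulN1r addrC; apply: window_reflect => // y.
  by rewrite -(wI y) mulN1r addrC.
- exact: window_lip.
- move=> x; rewrite -[window p w x]subr0; apply: avg_near => //.
    by rewrite ltrD2l gtrN.
  by move=> y _ _; rewrite subr0; exact: h_bound (fold_itv cd y).
- split.
    move=> x s.
    have := quadratic_remainder x (x + s) dw dwL.
    have := quadratic_remainder x (x - s) dw dwL.
    have -> : x + s - x = s by ring.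
    have -> : x - s - x = - s by ring.
    rewrite sqrrN !ler_norml => /andP[? ?] /andP[? ?].
    by apply/andP; split; lra.
  move=> x xcd; apply: avg_near => //; first by rewrite ltrD2l gtrN.
  move=> y yx xy; have -> : h x = w x by rewrite /w fold_id.
  apply: (le_trans (wL _ _)); apply: le_trans pA; rewrite ler_wpM2l//.
  by rewrite ler_norml; apply/andP; split; lra.
Qed.

(** The slope bound is exact, so truncating slopes at that level changes nothing; the bound on
    values carries an error, so values are clamped again when the original source is evaluated. *)
Definition approximant (eps : R) (phi phit phix phixx : R -> R -> R) : Prop :=
  [/\ is_C12 T c d phi phit phix phixx,
      forall t, phix t c = 0 /\ phix t d = 0,
      forall t x, t \in `[0, T] -> x \in `[c, d] ->
        `|phit t x - phixx t x - G (phi t x) (phix t x)| <= eps,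
      forall t x, `|phix t x| <= A * expR (B * (T + 1)) &
      (forall t x, t \in `[0, T] -> `|phi t x| <= (1 + C) * expR (D * t) - 1 + eps) /\
      (forall x, x \in `[c, d] -> `|phi 0 x - h x| <= eps)].

Lemma approximant_exists (eps : R) : 0 < eps ->
  exists phi phit phix phixx, approximant eps phi phit phix phixx.
Proof.
move=> eps0; have eps2 : 0 < eps / 2 by rewrite divr_gt0.
have [h0 [H [H0 h0f h0L h0C [h02 h0h]]]] := mollified_initial eps2.
have G00 : 0 <= G0 by exact: le_trans (G_bound 0 0).
pose E1 := expR (B * (T + 1)).
have E10 : 0 <= E1 by exact: expR_ge0.
pose L := A * E1; pose V := (H + G0) * E1; pose E := V + G0.
have L0 : 0 <= L by exact: mulr_ge0.
have V0 : 0 <= V by rewrite mulr_ge0// addr_ge0.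
have E0 : 0 <= E by rewrite addr_ge0.
(* Multiplied by [l] below, [K1] bounds the residual, [K2] twice the error of averaging at time 0
   (the other half of [eps] pays for [h0]), and [K3] the excess in the growth bound. *)
pose K1 := 2 * L + V + (B * (2 * L) + M * (E + 2 * L)) +
  (B * (V + 2 * L) + M * (E + 2 * L + L + V)).
have BL : 0 <= B * L by exact: mulr_ge0.
have BV : 0 <= B * V by exact: mulr_ge0.
have ML : 0 <= M * L by exact: mulr_ge0.
have MV : 0 <= M * V by exact: mulr_ge0.
have ME : 0 <= M * E by exact: mulr_ge0.
have K10 : 0 <= K1 by rewrite /K1; lra.
pose K2 := 2 * (V + 2 * L).
have K20 : 0 <= K2 by rewrite mulr_ge0// addr_ge0// mulr_ge0.
pose K3 := (1 + C) * expR (D * T) * (2 * D).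
have K30 : 0 <= K3 by rewrite !mulr_ge0// ?addr_ge0// expR_ge0.
have K1230 : 0 <= K1 + K2 + K3 by rewrite addr_ge0// addr_ge0.
have [z z0 zE] : exists2 z : R, 0 <= z & z * eps = K1 + K2 + K3.
  exists ((K1 + K2 + K3) / eps); first by rewrite divr_ge0// ltW.
  by rewrite divfK// gt_eqF.
(* The single inequality [l * K <= 1] provides [l <= 1], [l * M <= 1], [l * D <= 1 / 2] and, through
   [z], errors of at most [eps]. *)
pose K := 1 + M + 2 * D + z.
have K0 : 0 < K by rewrite /K -!addrA ltr_pwDl ?addr_ge0 ?mulr_ge0.
pose N := (Num.truncn K).+1.
have KN : K < N%:R by exact: truncnS_gt.
have N0 : 0 < N%:R :> R by rewrite ltr0n.
pose l : R := N%:R^-1.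
have l0 : 0 < l by rewrite invr_gt0.
have lN : l * N%:R = 1 by rewrite mulVf// gt_eqF.
have lK : l * K <= 1 by rewrite -lN ler_wpM2l// ltW.
have lKE : l * K = l + l * M + 2 * (l * D) + l * z by rewrite /K; ring.
have lz0 : 0 <= l * z by rewrite mulr_ge0// ltW.
have lM0 : 0 <= l * M by rewrite mulr_ge0// ltW.
have lD0 : 0 <= l * D by rewrite mulr_ge0// ltW.
have l1 : l <= 1 by lra.
have lM : l * M <= 1 by lra.
have lD : l * D <= 1 / 2 by lra.
have lK123 : l * (K1 + K2 + K3) <= eps.
  by rewrite -zE mulrA ger_pMl//; lra.
(* With these exponents the intermediate scale is [k * e = l], while [e / p ^+ 2 = l ^+ 2] and
   [p / (k * e) = l], so every error is O(l). *)
pose e := l ^+ 6; pose p := l ^+ 2; pose k := (N ^ 5)%N.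
have e0 : 0 < e by rewrite exprn_gt0.
have p0 : 0 < p by rewrite exprn_gt0.
have k0 : (0 < k)%N by rewrite expn_gt0.
have lXle n : l ^+ n.+1 <= l.
  by rewrite exprS ger_pMr// exprn_ile1// ltW.
have lXle2 n : l ^+ n.+1 / 2 <= l.
  by rewrite ler_pdivrMr// (le_trans (lXle n))// ler_peMr ?ler1n// ltW.
have el : e <= l by exact: lXle.
have ke : k%:R * e = l.
  have -> : k%:R * e = (l * N%:R) ^+ 5 * l by rewrite /k /e natrX; ring.
  by rewrite lN expr1n mul1r.
have eM : e * M <= 2.
  by apply: (@le_trans _ _ (l * M)); [rewrite ler_wpM2r|lra].
have e1 : e <= 1 by exact: le_trans l1.
pose u := scheme_solution c d T G h0 e.
have uL t x y : `|u t x - u t y| <= L * `|x - y|.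
  exact: (scheme_solution_lip cd T0 B0 M0 G_lip_y G_lip_z A0 h0L).
have uV t s x : `|u t x - u s x| <= V * `|t - s|.
  exact: (scheme_solution_time T0 B0 M0 G_lip_y G_lip_z G_bound H0 h0f h02).
have uf t x : u t (fold c d x) = u t x by exact: scheme_solution_fold.
have us t : 0 <= t -> t <= T -> u (t + time_step e) = scheme_step c d G e (u t).
  exact: scheme_solution_step.
have tau0 := time_step_gt0 e0.
have taul : time_step e <= l / 2.
  rewrite /time_step ler_pM2r ?invr_gt0// -exprM; exact: lXle.
have Vtau : V * time_step e <= V * (l / 2) by rewrite ler_wpM2l.
have pl : p <= l by exact: lXle.
have Lp : L * (2 * p) <= L * (2 * l) by rewrite ler_wpM2l// ler_wpM2l.
have lK1 : 0 <= l * K1 by rewrite mulr_ge0// ltW.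
have lK2 : 0 <= l * K2 by rewrite mulr_ge0// ltW.
have lK3 : 0 <= l * K3 by rewrite mulr_ge0// ltW.
rewrite (mulrDr l (K1 + K2) K3) (mulrDr l K1 K2) in lK123.
exists (mollified u e p), (mollified_t u e p), (mollified_x u e p), (mollified_xx u e p); split.
- exact: (mollified_C12 c d T e0 p0 uL uV).
- exact: (mollified_neumann cd e0 p0 uL uf).
- move=> t x; rewrite in_itv /= => /andP[t0 tT] xcd.
  apply: (le_trans (mollified_residual cd B0 M0 G_lip_y G_lip_z G_bound e0 L0 V0
    p0 k0 uL uV uf us t0 tT xcd)).
  rewrite ke.
  apply: (@le_trans _ _ (l * K1)); last lra.
  have h1 : 2 * (L / p ^+ 2) * e <= 2 * L * l.
    have -> : 2 * (L / p ^+ 2) * e = 2 * L * l ^+ 2.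
      by rewrite /p /e; field; rewrite gt_eqF.
    by rewrite ler_wpM2l// ?mulr_ge0.
  have h2 : V / p ^+ 2 * time_step e <= V * l.
    have -> : V / p ^+ 2 * time_step e = V * (l ^+ 8 / 2).
      by rewrite /p /time_step /e; field; rewrite gt_eqF.
    by rewrite ler_wpM2l//; exact: (lXle2 7).
  have h3 : 2 * p / l = 2 * l by rewrite /p; field; rewrite gt_eqF.
  have h4 : L / p * e <= L * l.
    have -> : L / p * e = L * l ^+ 4.
      by rewrite /p /e; field; rewrite gt_eqF.
    by rewrite ler_wpM2l.
  have h5 : V / p * time_step e <= V * l.
    have -> : V / p * time_step e = V * (l ^+ 10 / 2).
      by rewrite /p /time_step /e; field; rewrite gt_eqF.
    by rewrite ler_wpM2l//; exact: (lXle2 9).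
  have h6 : B * (L * (2 * p)) <= B * (L * (2 * l)) by rewrite ler_wpM2l.
  have h7 : V * time_step e <= V * l.
    by rewrite ler_wpM2l// (le_trans taul)// ler_pdivrMr// ler_peMr ?ler1n ?(ltW l0).
  have h8 : B * (V * time_step e + L * (2 * p)) <= B * (V * l + L * (2 * l)).
    by rewrite ler_wpM2l// lerD.
  have h9 : M * (E * l + L * (2 * p / l) + L / p * e + V / p * time_step e) <=
      M * (E * l + L * (2 * l) + L * l + V * l).
    by rewrite ler_wpM2l// h3 !lerD.
  rewrite -/E h3 /K1 in h9 *.
  apply: (@le_trans _ _ (2 * L * l + V * l + (B * (L * (2 * l)) + M * (E * l + L * (2 * l))) +
    (B * (V * l + L * (2 * l)) + M * (E * l + L * (2 * l) + L * l + V * l)))).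
    by apply: lerD; [apply: lerD; [exact: lerD|exact: lerD]|exact: lerD].
  by rewrite le_eqVlt; apply/orP; left; apply/eqP; ring.
- exact: (mollified_x_bound e0 p0 uL uV).
- split.
    move=> t x; rewrite in_itv /= => /andP[t0 tT].
    apply: (mollified_bound e0 p0 uL uV) => s y ts st.
    have s0 : 0 <= s by exact: le_trans ts.
    have := scheme_solution_bound c d T0 M0 D0 G_lip_z G_zero C0 h0C e0 eM y s0.
    rewrite -/u => hu.
    (* The time window reaches one step past [t] and the discrete bound adds another; two steps are
       at most [l]. *)
    have hE : expR (D * (s + time_step e)) <= expR (D * t) * (1 + 2 * (l * D)).
      apply: (@le_trans _ _ (expR (D * t) * expR (l * D))); last first.
        by rewrite ler_wpM2l ?expR_ge0// expR_le_linear.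
      rewrite -expRD ler_expR (mulrC l) -mulrDr ler_wpM2l//; lra.
    have hE2 : expR (D * t) <= expR (D * T) by rewrite ler_expR ler_wpM2l.
    have h1 : (1 + C) * expR (D * (s + time_step e)) <=
        (1 + C) * (expR (D * t) * (1 + 2 * (l * D))).
      by rewrite ler_wpM2l// addr_ge0.
    have h2 : (1 + C) * expR (D * t) * (2 * (l * D)) <= l * K3.
      have -> : l * K3 = (1 + C) * expR (D * T) * (2 * (l * D)) by rewrite /K3; ring.
      apply: ler_wpM2r; first by rewrite mulr_ge0.
      by apply: ler_wpM2l => //; rewrite addr_ge0.
    lra.
  move=> x xcd.
  have := mollified_near e0 L0 V0 p0 uL uV 0 x.
  have -> : u 0 x = h0 x by exact: scheme_solution0.
  have := h0h x xcd; have := ler_distD (h0 x) (mollified u e p 0 x) (h x).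
  have lV : 0 <= V * l by rewrite mulr_ge0// ltW.
  rewrite /K2 in lK2 lK123; lra.
Qed.

End Approximants.

(** * The limit solution *)

Section Limit.
Context {R : realType}.
Variables (c d T : R) (G : R -> R -> R) (B M G0 D : R).
Hypotheses (cd : c < d) (T0 : 0 < T).
Hypotheses (B0 : 0 <= B) (M0 : 0 <= M) (D0 : 0 <= D).
Hypothesis G_lip_y : forall y y' z, `|G y z - G y' z| <= B * `|y - y'|.
Hypothesis G_lip_z : forall y z z', `|G y z - G y z'| <= M * `|z - z'|.
Hypothesis G_bound : forall y z, `|G y z| <= G0.
Hypothesis G_zero : forall y, `|G y 0| <= D * (1 + `|y|).
Variables (h : R -> R) (A C : R).
Hypotheses (A0 : 0 <= A) (C0 : 0 <= C).
Hypothesis h_lip : forall x x', x \in `[c, d] -> x' \in `[c, d] ->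
  `|h x - h x'| <= A * `|x - x'|.
Hypothesis h_bound : forall x, x \in `[c, d] -> `|h x| <= C.

Local Notation approximant := (approximant c d T G B D h A C).
Let L := A * expR (B * (T + 1)).
Let c0 := 3 * expR ((B + 1) * T).
Let c00 : 0 <= c0. Proof. by rewrite mulr_ge0// expR_ge0. Qed.

Lemma subsolutionW (g v : R -> R -> R) (e e' : R) : e <= e' ->
  subsolution T c d g e v -> subsolution T c d g e' v.
Proof.
move=> ee' H phi pt px pxx Cp t x tT xcd lm.
by have [h1|] := H _ _ _ _ Cp t x tT xcd lm; [left; exact: le_trans ee'|right].
Qed.

Lemma approximant_subsolution e phi pt px pxx : approximant e phi pt px pxx ->
  subsolution T c d G e phi /\
  subsolution T c d (reflect_source G) e (fun t x => - phi t x).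
Proof.
move=> [Cp N res _ _]; split; apply: (classical_subsolution cd).
- exact: Cp.
- by move=> t _; exact: N.
- by move=> t x tT xcd; exact: le_trans (ler_norm _) (res t x tT xcd).
- exact: is_C12N Cp.
- by move=> t _; have [-> ->] := N t; rewrite oppr0.
- move=> t x tT xcd; have := res t x tT xcd; rewrite -normrN.
  apply: le_trans; rewrite /reflect_source !opprK.
  have -> : - pt t x + pxx t x + G (phi t x) (px t x) =
    - (pt t x - pxx t x - G (phi t x) (px t x)) by ring.
  exact: ler_norm.
Qed.

Lemma approximantW e e' phi pt px pxx : e <= e' ->
  approximant e phi pt px pxx -> approximant e' phi pt px pxx.
Proof.
move=> ee' [H1 H2 H3 H4 [H5 H6]]; split => //.
  by move=> t x tT xcd; exact: le_trans (H3 t x tT xcd) ee'.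
split; last by move=> x xcd; exact: le_trans (H6 x xcd) ee'.
by move=> t x tT; apply: (le_trans (H5 t x tT)); rewrite lerD2l.
Qed.

(** One approximant is the smooth barrier, the other is used only as a subsolution; exchanging the
    roles gives the reverse inequality. *)
Lemma approximant_compare e e' phi pt px pxx psi st sx sxx : 0 <= e -> 0 <= e' ->
  approximant e phi pt px pxx -> approximant e' psi st sx sxx ->
  forall t x, t \in `[0, T] -> x \in `[c, d] ->
    psi t x - phi t x <= c0 * (e + e').
Proof.
move=> e0 e'0 Hphi Hpsi.
have [Cp N res _ [_ init]] := Hphi; have [Cs _ _ _ [_ init']] := Hpsi.
have [subpsi _] := approximant_subsolution Hpsi.
apply: (@subsolution_comparison _ T c d T0 cd G (fun t x => G (phi t x) (px t x))
  psi phi pt px pxx B M (e + e')) => //.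
- exact: addr_ge0.
- by case: Cs => -[].
- by apply: subsolutionW subpsi; rewrite lerDr.
- move=> x xcd; have := init x xcd; have := init' x xcd.
  by rewrite !ler_norml => /andP[? ?] /andP[? ?]; lra.
- move=> t x tT xcd; have := res t x tT xcd.
  by rewrite ler_norml => /andP[? _]; lra.
- move=> t x z tT xcd _; set y := psi t x; set y' := phi t x => yy'.
  have := G_lip_y y y' z; have := G_lip_z y' z (px t x).
  rewrite (@ger0_norm _ (y - y')); last by lra.
  by rewrite !ler_norml => /andP[? ?] /andP[? ?]; lra.
Qed.

Lemma approximant_lip e phi pt px pxx : approximant e phi pt px pxx ->
  forall t x y, t \in `[0, T] -> x \in `[c, d] -> y \in `[c, d] ->
    `|phi t x - phi t y| <= L * `|x - y|.
Proof.
move=> [[_ _ dx _] _ _ pL _] t x y tT.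
wlog xy : x y / x < y.
  move=> H xcd ycd; have [xy|yx|->] := ltgtP x y; first exact: H.
    by rewrite distrC (distrC x); exact: H.
  by rewrite !subrr normr0 mulr0.
move=> xcd ycd.
have sub : `[x, y]%classic `<=` (`[c, d]%classic : set R).
  move: xcd ycd; rewrite !in_itv /= => /andP[cx _] /andP[_ yd] z /=.
  by rewrite !in_itv /= => /andP[xz zy]; rewrite (le_trans cx)// (le_trans zy).
have [|z _] := @mean_value R x y (phi t) (px t) xy.
  move=> z zxy; apply: (has_deriv_withinW sub); apply: dx => //; exact: sub.
rewrite distrC (distrC x) => ->; rewrite normrM ler_wpM2r//; exact: pL.
Qed.

(** The approximants stay in the conclusion because uniqueness and regularity are deduced by working
    with them. *)
Lemma limit_solution_exists : exists u : R -> R -> R,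
  [/\ [/\ cont_on (rect T c d) u, forall x, x \in `[c, d] -> u 0 x = h x,
          subsolution T c d G 0 u &
          subsolution T c d (reflect_source G) 0 (fun t x => - u t x)],
      forall t x, t \in `[0, T] -> x \in `[c, d] ->
        `|u t x| <= (1 + C) * expR (D * t) - 1,
      forall t x y, t \in `[0, T] -> x \in `[c, d] -> y \in `[c, d] ->
        `|u t x - u t y| <= L * `|x - y| &
      forall e : R, 0 < e -> exists phi pt px pxx, approximant e phi pt px pxx /\
        forall t x, t \in `[0, T] -> x \in `[c, d] -> `|phi t x - u t x| <= e].
Proof.
have eps0 n : 0 < n.+1%:R^-1 :> R by rewrite invr_gt0 ltr0n.
have /choice[F HF] : forall n : nat, exists q : (R -> R -> R) * (R -> R -> R) *
    (R -> R -> R) * (R -> R -> R), approximant n.+1%:R^-1 q.1.1.1 q.1.1.2 q.1.2 q.2.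
  move=> n; have [phi [pt [px [pxx H]]]] := approximant_exists cd T0 B0 M0 D0
    G_lip_y G_lip_z G_bound G_zero A0 C0 h_lip h_bound (eps0 n).
  by exists (phi, pt, px, pxx).
pose phi n := (F n).1.1.1.
(* By comparison every lower end [phi n - c0 / (n + 1)] lies below every upper end
   [phi m + c0 / (m + 1)], so the supremum of the lower ends is within [c0 / (n + 1)] of each
   [phi n]. This replaces a Cauchy argument. *)
pose S t x := range (fun n => phi n t x - c0 * n.+1%:R^-1).
pose u t x := sup (S t x).
have bnd n t x : t \in `[0, T] -> x \in `[c, d] -> ubound (S t x) (phi n t x + c0 * n.+1%:R^-1).
  move=> tT xcd _ [m _ <-].
  rewrite lerBlDr -addrA -mulrDr -lerBlDl.
  exact: (approximant_compare (ltW (eps0 n)) (ltW (eps0 m)) (HF n) (HF m) tT xcd).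
have phiu n t x : t \in `[0, T] -> x \in `[c, d] -> `|phi n t x - u t x| <= c0 * n.+1%:R^-1.
  move=> tT xcd; rewrite ler_norml; apply/andP; split.
    rewrite lerBrDr addrC lerBlDr.
    by apply: ge_sup; [exists (phi n t x - c0 * n.+1%:R^-1), n|exact: bnd].
  rewrite lerBlDr addrC -lerBlDr.
  by apply: ub_le_sup; [exists (phi n t x + c0 * n.+1%:R^-1); exact: bnd|exists n].
have appr (e : R) : 0 < e -> exists phi pt px pxx, approximant e phi pt px pxx /\
    forall t x, t \in `[0, T] -> x \in `[c, d] -> `|phi t x - u t x| <= e.
  move=> e0; pose K := (1 + c0) / e; pose n := Num.truncn K.
  have Kn : K < n.+1%:R by exact: truncnS_gt.
  have n0 : 0 < n.+1%:R :> R by rewrite ltr0n.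
  have h1 : n.+1%:R^-1 * (1 + c0) <= e.
    move: Kn; rewrite /K ltr_pdivrMr// => /ltW h1.
    by rewrite mulrC ler_pdivrMr// mulrC.
  exists (phi n), (F n).1.1.2, (F n).1.2, (F n).2; split.
    by apply: approximantW (HF n); apply: le_trans h1; rewrite ler_peMr// ?lerDl// ltW.
  move=> t x tT xcd; apply: (le_trans (phiu n t x tT xcd)); apply: le_trans h1.
  by rewrite mulrC ler_wpM2l// ?lerDr// ltW.
have cu : cont_on (rect T c d) u.
  apply/cont_onP => t x [/= tT xcd] e e0.
  have e3 : 0 < e / 3 by rewrite divr_gt0.
  have [f [ft [fx [fxx [[Cf _ _ _ _] fu]]]]] := appr _ e3.
  have [[/cont_onP cf _ _ _] _ _ _] := Cf.
  have [r r0 Hr] := cf t x (conj tT xcd) _ e3.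
  exists r => // s y [/= sT ycd] st yx.
  have := Hr s y (conj sT ycd) st yx.
  have := fu t x tT xcd; have := fu s y sT ycd.
  rewrite !ler_norml => /andP[? ?] /andP[? ?] /andP[? ?].
  by apply/andP; split; lra.
have T00 : 0 \in `[0, T] by rewrite in_itv /= lexx ltW.
have lim_le (a b : R) : (forall e : R, 0 < e -> a <= b + 2 * e) -> a <= b.
  move=> H; apply/ler_addgt0Pr => e e0; have := H (e / 2).
  by rewrite (mulrC 2) divfK//; apply; rewrite divr_gt0.
exists u; split => //; first split => //.
- move=> x xcd; apply/eqP; rewrite -subr_eq0 -normr_le0; apply: lim_le => e e0.
  have [f [ft [fx [fxx [[_ _ _ _ [_ f0]] fu]]]]] := appr _ e0.
  have := f0 x xcd; have := fu 0 x T00 xcd; have := ler_distD (f 0 x) (u 0 x) (h x).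
  by rewrite (distrC (u 0 x) (f 0 x)); lra.
- apply: (@subsolution_limit _ T c d cd G u B M) => //.
    move=> y y' z z'; have := ler_distD (G y' z) (G y z) (G y' z').
    by have := G_lip_y y y' z; have := G_lip_z y' z z'; lra.
  move=> e e0; have [f [ft [fx [fxx [Hf fu]]]]] := appr _ e0.
  exists f; split => //; first by case: Hf => -[[]].
  by have [] := approximant_subsolution Hf.
- apply: (@subsolution_limit _ T c d cd (reflect_source G) _ B M) => //.
  + move=> y y' z z'; rewrite /reflect_source -opprD normrN.
    have := ler_distD (G (- y') (- z)) (G (- y) (- z)) (G (- y') (- z')).
    have := G_lip_y (- y) (- y') (- z); have := G_lip_z (- y') (- z) (- z').
    by rewrite -!opprD !normrN; lra.
  + have := cont_on_lin (k := -2) cu cu; congr cont_on.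
    by apply/funext => t; apply/funext => x; ring.
  + move=> e e0; have [f [ft [fx [fxx [Hf fu]]]]] := appr _ e0.
    exists (fun t x => - f t x); split.
    * by have [Cf _ _ _ _] := Hf; have [[]] := is_C12N Cf.
    * by have [] := approximant_subsolution Hf.
    * by move=> t x tT xcd; rewrite -opprD normrN; exact: fu.
- move=> t x tT xcd; apply: lim_le => e e0.
  have [f [ft [fx [fxx [[_ _ _ _ [fb _]] fu]]]]] := appr _ e0.
  have := fb t x tT; have := fu t x tT xcd; have := ler_distD (f t x) (u t x) 0.
  by rewrite !subr0 (distrC (u t x)); lra.
- move=> t x y tT xcd ycd; apply: lim_le => e e0.
  have [f [ft [fx [fxx [Hf fu]]]]] := appr _ e0.
  have := approximant_lip Hf tT xcd ycd.
  have := fu t x tT xcd; have := fu t y tT ycd.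
  rewrite !ler_norml => /andP[? ?] /andP[? ?] /andP[? ?].
  by apply/andP; split; lra.
Qed.

End Limit.

(** * Removal of the truncation *)

Section Slope.
Context {R : realType}.
Variables (T c d : R).
Hypotheses (cd : c < d).

(* At an endpoint only one of the two inequalities |cx| <= L survives; the other
   alternative is the boundary condition. *)
Lemma touching_slope (u chi ct cx cxx : R -> R -> R) (L t x : R) :
  is_C12 T c d chi ct cx cxx -> t \in `]0, T[ -> x \in `[c, d] ->
  (forall t x y, t \in `[0, T] -> x \in `[c, d] -> y \in `[c, d] ->
    `|u t x - u t y| <= L * `|x - y|) ->
  local_max_on (rect T c d) (fun p => u p.1 p.2 - chi p.1 p.2) (t, x) ->
  `|cx t x| <= L \/ (x = c \/ x = d) /\ - inward_deriv c x (cx t x) <= 0.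
Proof.
move=> [_ _ dx _] tT xcd uL /local_max_onP[/= r r0 Hr].
have tT' : t \in `[0, T] by move: tT; rewrite !in_itv /= => /andP[/ltW -> /ltW ->].
have dlin (k : R) : has_deriv_within `[c, d] (fun y => k * y + -1 * chi t y) x (k + -1 * cx t x).
  apply: has_deriv_within_lin; last exact: dx.
  apply/has_deriv_withinP => e e0; exists 1 => // y _ _.
  have -> : k * y - k * x - k * (y - x) = 0 by ring.
  by rewrite normr0 mulr_ge0// ltW.
have key y : y \in `[c, d] -> `|y - x| < r -> u t y - chi t y <= u t x - chi t x.
  by move=> ycd yx; apply: Hr; rewrite ?subrr ?normr0.
have [cx' xd] : c <= x /\ x <= d by move: xcd; rewrite in_itv /= => /andP.
have right : x < d -> - L <= cx t x.
  move=> xltd; have : - L + -1 * cx t x <= 0.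
    apply: (@deriv_le0_right _ `[c, d] (fun y => - L * y + -1 * chi t y) x _
      (Num.min r (d - x))) (dlin (- L)).
      by rewrite lt_min r0 subr_gt0.
    move=> y xy; rewrite -ltrBlDl lt_min => /andP[yr yd].
    have ycd : y \in `[c, d] by rewrite in_itv /=; apply/andP; split; lra.
    split => //; have := uL t y x tT' ycd xcd; have := key y ycd.
    rewrite gtr0_norm ?subr_gt0// => /(_ yr).
    by rewrite ler_norml => ? /andP[? ?]; lra.
  lra.
have left : c < x -> cx t x <= L.
  move=> cltx; have : 0 <= L + -1 * cx t x.
    apply: (@deriv_ge0_left _ `[c, d] (fun y => L * y + -1 * chi t y) x _
      (Num.min r (x - c))) (dlin L).
      by rewrite lt_min r0 subr_gt0.
    move=> y xy yx; have [yr cy] : x - y < r /\ c < y.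
      by move: xy; rewrite ltrBlDr -ltrBlDl lt_min => /andP[? ?]; split; lra.
    have ycd : y \in `[c, d] by rewrite in_itv /=; apply/andP; split; lra.
    split => //; have := uL t y x tT' ycd xcd; have := key y ycd.
    rewrite distrC gtr0_norm ?subr_gt0// => /(_ yr).
    by rewrite ler_norml => ? /andP[? ?]; lra.
  lra.
have [xc|xc] := eqVneq x c.
  have [h|h] := leP 0 (cx t x).
    by right; split; [left|rewrite /inward_deriv xc eqxx oppr_le0 -xc].
  have xltd : x < d by rewrite xc.
  by left; rewrite ltr0_norm//; have := right xltd; lra.
have cltx : c < x by rewrite lt_neqAle eq_sym xc.
have [xE|xE] := eqVneq x d.
  have [h|h] := leP (cx t x) 0.
    by right; split; [right|rewrite /inward_deriv (negbTE xc) opprK].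
  by left; rewrite gtr0_norm//; exact: left.
have xltd : x < d by rewrite lt_neqAle xE.
by left; rewrite ler_norml right//= left.
Qed.

(** At a touching point either the boundary alternative holds, which does not involve the source, or
    value and slope lie where [G] and [g] agree. *)
Lemma subsolution_truncation (G g u : R -> R -> R) (K L : R) :
  (forall t x, t \in `[0, T] -> x \in `[c, d] -> `|u t x| <= K) ->
  (forall t x y, t \in `[0, T] -> x \in `[c, d] -> y \in `[c, d] ->
    `|u t x - u t y| <= L * `|x - y|) ->
  (forall y z, `|y| <= K -> `|z| <= L -> G y z = g y z) ->
  subsolution T c d G 0 u -> subsolution T c d g 0 u.
Proof.
move=> uK uL Gg subu chi ct cx cxx Cchi t x tT xcd lm.
have [h|] := subu _ _ _ _ Cchi t x tT xcd lm; last by right.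
have [hx|] := touching_slope Cchi tT xcd uL lm; last by right.
have tT' : t \in `[0, T] by move: tT; rewrite !in_itv /= => /andP[/ltW -> /ltW ->].
by left; rewrite -Gg//; exact: uK.
Qed.

End Slope.

Section Clamp.
Context {R : realType}.
Implicit Types K x y e : R.

Definition clamp K y : R := Num.max (- K) (Num.min y K).

Lemma clamp_cases K y : 0 <= K ->
  [\/ y <= - K /\ clamp K y = - K, K <= y /\ clamp K y = K |
      - K <= y <= K /\ clamp K y = y].
Proof.
move=> K0; rewrite /clamp; have [yK|Ky] := leP y K.
  have [yK'|Ky'] := leP (- K) y; first by apply: Or33.
  by apply: Or31; rewrite ltW.
apply: Or32; rewrite ltW//; split => //; apply/max_idPr; lra.
Qed.

Lemma clamp_id K y : `|y| <= K -> clamp K y = y.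
Proof.
by rewrite ler_norml => /andP[h1 h2]; rewrite /clamp (min_idPl h2) (max_idPr h1).
Qed.

Lemma clamp_le K y : 0 <= K -> `|clamp K y| <= K.
Proof.
move=> K0; rewrite ler_norml.
by have [[h ->]|[h ->]|[/andP[h1 h2] ->]] := clamp_cases y K0; apply/andP; split; lra.
Qed.

Lemma clamp_le_norm K y : 0 <= K -> `|clamp K y| <= `|y|.
Proof.
move=> K0; have [[h ->]|[h ->]|[_ ->]] := clamp_cases y K0 => //.
  by rewrite normrN ger0_norm// ler0_norm; lra.
by rewrite !ger0_norm; lra.
Qed.

Lemma clamp_lip K x y : 0 <= K -> `|clamp K x - clamp K y| <= `|x - y|.
Proof.
move=> K0; wlog xy : x y / x <= y.
  by move=> H; have [/H//|/ltW/H] := leP x y; rewrite distrC (distrC y).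
rewrite (distrC x) (@ger0_norm _ (y - x)) ?subr_ge0// ler_norml.
have [[h ->]|[h ->]|[/andP[h1 h2] ->]] := clamp_cases x K0;
have [[h' ->]|[h' ->]|[/andP[h1' h2'] ->]] := clamp_cases y K0; apply/andP; split; lra.
Qed.

Lemma clamp_near K e y : 0 <= K -> 0 <= e -> `|y| <= K + e -> `|clamp K y - y| <= e.
Proof.
move=> K0 e0; rewrite !ler_norml => /andP[? ?].
by have [[h ->]|[h ->]|[/andP[h1 h2] ->]] := clamp_cases y K0; apply/andP; split; lra.
Qed.

End Clamp.

Section Supremum.
Context {R : realType}.
Variables (c d : R) (h : R -> R) (A : R).
Hypotheses (cd : c < d) (A0 : 0 <= A).
Hypothesis h_lip : forall x x', x \in `[c, d] -> x' \in `[c, d] ->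
  `|h x - h x'| <= A * `|x - x'|.

Let mid_in : (c + d) / 2 \in `]c, d[.
Proof. by rewrite in_itv /= !midf_lt. Qed.

(** The supremum ranges over the open interval; an endpoint is moved a fraction [th] of the way to
    the midpoint, at a cost controlled by [A]. The Lipschitz bound also shows that the set is
    bounded. *)
Lemma le_sup_abs x : x \in `[c, d] -> `|h x| <= sup_abs c d h.
Proof.
have sub y : y \in `]c, d[ -> y \in `[c, d].
  by rewrite !in_itv /= => /andP[/ltW -> /ltW ->].
have inner y : y \in `]c, d[ -> `|h y| <= sup_abs c d h.
  move=> ycd; apply: ub_le_sup; last by exists y.
  exists (`|h ((c + d) / 2)| + A * (d - c)) => _ [z /= zcd <-].
  have := ler_normD (h z - h ((c + d) / 2)) (h ((c + d) / 2)); rewrite subrK => h1.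
  have h2 := h_lip (sub _ zcd) (sub _ mid_in).
  suff : A * `|z - (c + d) / 2| <= A * (d - c) by lra.
  apply: ler_wpM2l => //; move: zcd; rewrite in_itv /= => /andP[? ?].
  by rewrite ler_norml; apply/andP; split; lra.
move=> xcd; apply/ler_addgt0Pr => e e0.
pose th := Num.min 1 (e / (A * (d - c) + 1)).
have Ap : 0 < A * (d - c) + 1 by rewrite ltr_wpDl// mulr_ge0// subr_ge0 ltW.
have th0 : 0 < th by rewrite lt_min ltr01 divr_gt0.
have th1 : th <= 1 by rewrite ge_min lexx.
have thA : th * (A * (d - c) + 1) <= e by rewrite -ler_pdivlMr// ge_min lexx orbT.
pose y := x + th * ((c + d) / 2 - x).
have [cx xd] : c <= x /\ x <= d by move: xcd; rewrite in_itv /= => /andP.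
have ycd : y \in `]c, d[.
  have h1 : 0 < th * ((d - c) / 2) by rewrite mulr_gt0// divr_gt0// subr_gt0.
  have h2 : 0 <= (1 - th) * (x - c) by rewrite mulr_ge0// subr_ge0.
  have h3 : 0 <= (1 - th) * (d - x) by rewrite mulr_ge0// subr_ge0.
  rewrite /y in_itv /=; clear -h1 h2 h3; apply/andP; split; lra.
have := h_lip xcd (sub _ ycd); have := inner y ycd.
have := ler_normD (h x - h y) (h y); rewrite subrK.
suff : A * `|x - y| <= e by lra.
apply: le_trans thA; rewrite /y opprD addrA subrr sub0r normrN normrM gtr0_norm//.
rewrite mulrCA ler_pM2l//.
suff : A * `|(c + d) / 2 - x| <= A * (d - c) by lra.
by apply: ler_wpM2l => //; rewrite ler_norml; apply/andP; split; lra.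
Qed.

Lemma sup_abs_ge0 : 0 <= sup_abs c d h.
Proof.
apply: (le_trans (normr_ge0 (h c))); apply: le_sup_abs.
by rewrite in_itv /= lexx ltW.
Qed.

End Supremum.

(** * Uniqueness and regularity *)

Section Uniqueness.
Context {R : realType}.
Variables (T c d : R).
Hypotheses (T0 : 0 < T) (cd : c < d).

(** [phi] may slightly leave [[-K, K]], where [g] is controlled in the slope; [p] stands for its
    clamped copy, at which [g] is evaluated. Replacing [phi] by [p] costs [Gam * e], whence the
    factor [1 + Gam]. *)
Lemma subsolution_le_approximation (g v p phi pt px pxx : R -> R -> R)
    (K L L0 Gam N e : R) :
  0 <= Gam -> 0 <= N -> 0 <= e -> K <= L0 ->
  (forall y y' z, - L0 <= y' -> y' <= y -> y <= L0 ->
     g y z - g y' z <= Gam * (y - y')) ->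
  (forall y z z', `|y| <= K -> `|z| <= L + 1 -> `|z'| <= L + 1 ->
     `|g y z - g y z'| <= N * `|z - z'|) ->
  cont_on (rect T c d) v -> subsolution T c d g 0 v ->
  (forall t x, t \in `[0, T] -> x \in `[c, d] -> `|v t x| <= L0) ->
  is_C12 T c d phi pt px pxx ->
  (forall t, px t c = 0 /\ px t d = 0) ->
  (forall t x, `|px t x| <= L) ->
  (forall t x, t \in `[0, T] -> x \in `[c, d] ->
     `|p t x| <= K /\ `|p t x - phi t x| <= e) ->
  (forall t x, t \in `[0, T] -> x \in `[c, d] ->
     `|pt t x - pxx t x - g (p t x) (px t x)| <= e) ->
  (forall x, x \in `[c, d] -> v 0 x - phi 0 x <= e) ->
  forall t x, t \in `[0, T] -> x \in `[c, d] ->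
    v t x - phi t x <= 3 * expR ((Gam + 1) * T) * ((1 + Gam) * e).
Proof.
move=> Gam0 N0 e0 KL gGam glip cv subv vL Cphi neu pxL pK res init.
have ee : e <= (1 + Gam) * e by have := mulr_ge0 Gam0 e0; lra.
apply: (@subsolution_comparison _ T c d T0 cd g (fun t x => g (p t x) (px t x))
  v phi pt px pxx Gam N) => //.
- exact: le_trans ee.
- by apply: subsolutionW subv; exact: le_trans ee.
- by move=> x xcd; apply: le_trans ee; exact: init.
- move=> t x tT xcd; have := res t x tT xcd; rewrite ler_norml => /andP[? _]; lra.
- move=> t x z tT xcd zpx vphi.
  have [pKtx pe] := pK t x tT xcd; have vLtx := vL t x tT xcd.
  (* Here [v - phi] exceeds [e], hence [p] lies below [v], the order that [gGam] requires. *)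
  have h1 : g (v t x) z - g (p t x) z <= Gam * (v t x - p t x).
    move: pKtx pe vLtx; rewrite !ler_norml => /andP[? ?] /andP[? ?] /andP[? ?].
    by apply: gGam; lra.
  have h2 : g (p t x) z - g (p t x) (px t x) <= N * `|z - px t x|.
    apply: (le_trans (ler_norm _)); apply: glip => //.
      by have := ler_distD (px t x) z 0; rewrite !subr0; have := pxL t x; lra.
    by have := pxL t x; lra.
  have h3 : Gam * (phi t x - p t x) <= Gam * e.
    by apply: ler_wpM2l => //; move: pe; rewrite ler_norml => /andP[? ?]; lra.
  lra.
Qed.

End Uniqueness.

(** * Limits that do not depend on the space variable *)

Section Flat.
Context {R : realType}.
Variables (T c d : R).
Hypotheses (T0 : 0 < T) (cd : c < d).

Lemma has_deriv_within_cst_eq0 (f : R -> R) (x l : R) : x \in `[c, d] ->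
  (forall y, y \in `[c, d] -> f y = f x) -> has_deriv_within `[c, d] f x l ->
  l = 0.
Proof.
move=> xcd fx /has_deriv_withinP H; apply/eqP; rewrite -normr_le0.
apply/ler_addgt0Pr => e e0; rewrite add0r; have [r r0 Hr] := H e e0.
have [y [ycd yx yr]] : exists y, [/\ y \in `[c, d], y != x & `|y - x| < r].
  move: xcd; rewrite in_itv /= => /andP[cx xd].
  have r2 : 0 < r / 2 by rewrite divr_gt0.
  have [xltd|dlex] := ltP x d.
    have s0 : 0 < Num.min (r / 2) (d - x) by rewrite lt_min r2 subr_gt0.
    have sr : Num.min (r / 2) (d - x) <= r / 2 by rewrite ge_min lexx.
    have sd : Num.min (r / 2) (d - x) <= d - x by rewrite ge_min lexx orbT.
    exists (x + Num.min (r / 2) (d - x)); split.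
    - by rewrite in_itv /=; apply/andP; split; lra.
    - by rewrite gt_eqF// ltrDl.
    - by rewrite addrC addKr gtr0_norm//; lra.
  have s0 : 0 < Num.min (r / 2) (x - c) by rewrite lt_min r2 subr_gt0 (lt_le_trans cd).
  have sr : Num.min (r / 2) (x - c) <= r / 2 by rewrite ge_min lexx.
  have sd : Num.min (r / 2) (x - c) <= x - c by rewrite ge_min lexx orbT.
  exists (x - Num.min (r / 2) (x - c)); split.
  - by rewrite in_itv /=; apply/andP; split; lra.
  - by rewrite lt_eqF// gtrBl.
  - by rewrite addrC addKr normrN gtr0_norm//; lra.
have := Hr y ycd yr; rewrite fx// subrr sub0r normrN normrM ler_pM2r//.
by rewrite normr_gt0 subr_eq0.
Qed.

(** As [px] vanishes, so does [pxx], and each approximant solves the ordinary differential equation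
    up to [e]. The mean value theorem turns this into a bound on time increments, which passes to
    the limit. *)
Lemma flat_limit_C12 (G : R -> R) (u : R -> R -> R) (B : R) : 0 <= B ->
  (forall y y', `|G y - G y'| <= B * `|y - y'|) ->
  cont_on (rect T c d) u ->
  (forall t x y, t \in `[0, T] -> x \in `[c, d] -> y \in `[c, d] ->
     u t x = u t y) ->
  (forall e : R, 0 < e -> exists phi pt px pxx : R -> R -> R,
     [/\ is_C12 T c d phi pt px pxx, forall t x, px t x = 0,
         forall t x, t \in `[0, T] -> x \in `[c, d] ->
           `|pt t x - pxx t x - G (phi t x)| <= e &
         forall t x, t \in `[0, T] -> x \in `[c, d] -> `|phi t x - u t x| <= e]) ->
  is_C12 T c d u (fun t x => G (u t x)) (fun _ _ => 0) (fun _ _ => 0).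
Proof.
move=> B0 GB cu flat appr.
have B1 : 0 < B + 1 by rewrite ltr_wpDl.
have c0 : cont_on (rect T c d) (fun _ _ => 0).
  by apply/cont_onP => t x _ e e0; exists 1 => // *; rewrite subrr normr0 ltW.
have d0 (f : R -> R) (x : R) : x \in `[c, d] -> (forall y, y \in `[c, d] -> f y = f x) ->
    has_deriv_within `[c, d] f x 0.
  move=> xcd fx; apply/has_deriv_withinP => e e0; exists 1 => // y ycd _.
  by rewrite fx// subrr mul0r subrr normr0 mulr_ge0// ltW.
split; [split => //|..].
- apply/cont_onP => t x tx e e0; move/cont_onP: cu => /(_ t x tx (e / (B + 1))).
  case=> [|r r0 Hr]; first by rewrite divr_gt0.
  exists r => // s y sy st yx; apply: (le_trans (GB _ _)).
  apply: (@le_trans _ _ ((B + 1) * (e / (B + 1)))); last by rewrite mulrC divfK// gt_eqF.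
  by rewrite ler_pM//; [rewrite lerDl|exact: Hr].
- move=> t x tT xcd; apply/has_deriv_withinP => e e0.
  move/cont_onP: cu => /(_ t x (conj tT xcd) (e / (B + 1))).
  case=> [|r r0 Hr]; first by rewrite divr_gt0.
  exists r => // s /= sT st.
  (* The extra [n] is spent on an approximant of accuracy [n / k]: two units replace it by [u] at
     the times [s] and [t], the rest is the slope error [1 + B] over the length [|s - t|]. *)
  apply/ler_addgt0Pr => n n0; pose k := 2 + (1 + B) * `|s - t|.
  have k0 : 0 < k by rewrite /k ltr_wpDr// mulr_ge0// addr_ge0.
  have nk : 0 < n / k by rewrite divr_gt0.
  have [f [ft [fx [fxx [Cf fx0 res fu]]]]] := appr _ nk.
  have fxx0 z : z \in `[0, T] -> fxx z x = 0.
    move=> zT; case: Cf => _ _ _ /(_ z x zT xcd); apply: has_deriv_within_cst_eq0 => //.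
    by move=> y ycd; rewrite !fx0.
  have slope z : z \in `[0, T] -> `|z - t| < r ->
      `|ft z x - G (u t x)| <= e + n / k * (1 + B).
    move=> zT zt; have h1 := res z x zT xcd; rewrite fxx0// subr0 in h1.
    have h2 := GB (f z x) (u z x); have h3 := GB (u z x) (u t x).
    have h4 : B * `|f z x - u z x| <= B * (n / k) by rewrite ler_wpM2l// fu.
    have h5 : B * `|u z x - u t x| <= e.
      apply: (@le_trans _ _ ((B + 1) * (e / (B + 1)))); last by rewrite mulrC divfK// gt_eqF.
      rewrite ler_pM// ?lerDl//; apply: Hr => //; by rewrite ?subrr ?normr0.
    have h6 := ler_distD (G (f z x)) (ft z x) (G (u t x)).
    have h7 := ler_distD (G (u z x)) (G (f z x)) (G (u t x)).
    by clear -h1 h2 h3 h4 h5 h6 h7; lra.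
  have main : `|f s x - f t x - G (u t x) * (s - t)| <=
      (e + n / k * (1 + B)) * `|s - t|.
    have [_ dt _ _] := Cf.
    have mv a b : a \in `[0, T] -> b \in `[0, T] -> a < b ->
        exists2 z, a < z < b & f b x - f a x = ft z x * (b - a).
      rewrite !in_itv /= => /andP[a0 _] /andP[_ bT] ab.
      have sub : `[a, b]%classic `<=` (`[0, T]%classic : set R).
        move=> z /=; rewrite !in_itv /= => /andP[az zb].
        by rewrite (le_trans a0)// (le_trans zb).
      have [z zab zE] := mean_value ab (fun z zab =>
        has_deriv_withinW sub (dt z x (sub z zab) xcd)).
      by exists z; move: zab; rewrite in_itv.
    have [ts|ts|->] := ltgtP t s.
    + have [z /andP[tz zs] ->] := mv t s tT sT ts.
      rewrite -mulrBl normrM ler_wpM2r//; apply: slope.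
        by move: tT sT; rewrite !in_itv /= => /andP[? ?] /andP[? ?]; apply/andP; split; lra.
      by move: st; rewrite !gtr0_norm ?subr_gt0//; lra.
    + have [z /andP[sz zt] zE] := mv s t sT tT ts.
      have -> : f s x - f t x = ft z x * (s - t) by lra.
      rewrite -mulrBl normrM ler_wpM2r//; apply: slope.
        by move: tT sT; rewrite !in_itv /= => /andP[? ?] /andP[? ?]; apply/andP; split; lra.
      by move: st; rewrite !ltr0_norm ?subr_lt0//; lra.
    + by rewrite !subrr mulr0 subrr normr0 mulr0.
  have h1 := fu s x sT xcd; have h2 := fu t x tT xcd.
  have h3 : n / k * (2 + (1 + B) * `|s - t|) = n by rewrite divfK// gt_eqF.
  move: main h1 h2; rewrite !ler_norml => /andP[? ?] /andP[? ?] /andP[? ?].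
  by apply/andP; split; lra.
- by move=> t x tT xcd; apply: d0 => // y ycd; exact: flat.
- by move=> t x tT xcd; exact: d0.
Qed.

End Flat.

Theorem corollary6p6 (R : realType) (c d T : R) (g : R -> R -> R) (h : R -> R)
    (A B D : R) (rho : R -> R)
    (hcd : c < d) (hT : 0 < T)
    (hA : 0 <= A) (hB : 0 <= B) (hD : 0 <= D)
    (h_lip : forall x x' : R, x \in `[c, d] -> x' \in `[c, d] ->
       `|h x - h x'| <= A * `|x - x'|)
    (rho_ge0 : forall r : R, 0 <= r -> 0 <= rho r)
    (rho_mono : forall r s : R, 0 <= r -> r <= s -> rho r <= rho s)
    (g_lip_y : forall y y' z : R,
       `|y| <= (sup_abs c d h + 1) * expR (D * T) - 1 ->
       `|y'| <= (sup_abs c d h + 1) * expR (D * T) - 1 ->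
       `|g y z - g y' z| <= B * `|y - y'|)
    (g_lip_z : forall y z z' : R,
       `|y| <= (sup_abs c d h + 1) * expR (D * T) - 1 ->
       `|g y z - g y z'| <= rho (Num.max `|z| `|z'|) * `|z - z'|)
    (g_growth : forall y z : R,
       `|y| <= (sup_abs c d h + 1) * expR (D * T) - 1 ->
       `|g y z| <= D * (1 + `|y|) + rho `|z| * `|z|) :
  exists u : R -> R -> R,
    [/\ viscosity_solution T c d g h u,
        forall t x : R, t \in `[0, T] -> x \in `[c, d] ->
          `|u t x| <= (sup_abs c d h + 1) * expR (D * t) - 1 &
        (forall z : R, continuous (fun y : R => g y z)) ->
        (forall L : R, 0 <= L -> exists gamma : R, forall y y' z : R,
           - L <= y' -> y' <= y -> y <= L ->
           gamma * (y - y') <= g y' z - g y z) ->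
        structure_condition T c d (Fop g) ->
        (forall v, viscosity_solution T c d g h v ->
           forall t x : R, t \in `[0, T] -> x \in `[c, d] -> v t x = u t x) /\
        ((forall x : R, x \in `[c, d] -> h x = 0) -> is_C1 g ->
         exists ut ux uxx : R -> R -> R,
           is_C12 T c d u ut ux uxx /\
           forall t x : R, t \in `[0, T] -> x \in `[c, d] ->
             `|ux t x| <= 3 * A * expR (B * t))].
Proof.
have C0 := sup_abs_ge0 hcd hA h_lip.
have hC := le_sup_abs hcd hA h_lip.
move: C0 hC g_lip_y g_lip_z g_growth; set C := sup_abs c d h.
set K := (C + 1) * expR (D * T) - 1.
move=> C0 hC glipy glipz ggrow.
have expK t : t <= T -> (C + 1) * expR (D * t) - 1 <= K.
  by move=> tT; rewrite lerD2r ler_wpM2l ?addr_ge0// ler_expR ler_wpM2l.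
have K0 : 0 <= K.
  by apply: le_trans (expK 0 (ltW hT)); rewrite mulr0 expR0; lra.
(* One [u] must serve all claims, including the one for [h = 0], so the Lipschitz constant is set to
   0 beforehand when [h] vanishes; then [L = 0] and the approximants have zero slope. *)
have [A' [A'0 lipA' A'h]] : exists A' : R, [/\ 0 <= A',
    forall x x' : R, x \in `[c, d] -> x' \in `[c, d] ->
      `|h x - h x'| <= A' * `|x - x'| &
    (forall x : R, x \in `[c, d] -> h x = 0) -> A' = 0].
  have [h0|h0] := pselect (forall x : R, x \in `[c, d] -> h x = 0).
    exists 0; split => // x x' xcd xcd'.
    by rewrite !h0// subrr normr0 mul0r.
  by exists A; split => // /h0.
pose L := A' * expR (B * (T + 1)).
have L0 : 0 <= L by rewrite mulr_ge0// expR_ge0.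
(* The bounds on [g] hold for [|y| <= K], and [rho] gives Lipschitz constants on bounded slopes;
   clamping makes them global, with constants [B] and [rho L]. *)
pose G y z := g (clamp K y) (clamp L z).
have cK y := clamp_le y K0.
have cL z := clamp_le z L0.
have GB y y' z : `|G y z - G y' z| <= B * `|y - y'|.
  apply: (le_trans (glipy _ _ _ (cK y) (cK y'))).
  by rewrite ler_wpM2l// clamp_lip.
have rhoM z z' r : `|z| <= r -> `|z'| <= r -> rho (Num.max `|z| `|z'|) <= rho r.
  by move=> zr z'r; apply: rho_mono; rewrite ?le_max ?normr_ge0// ge_max zr.
have GM y z z' : `|G y z - G y z'| <= rho L * `|z - z'|.
  apply: (le_trans (glipz _ _ _ (cK y))); apply: ler_pM => //.
  - by rewrite rho_ge0// le_max normr_ge0.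
  - exact: rhoM.
  - exact: clamp_lip.
have rL : rho L * L >= 0 by rewrite mulr_ge0// rho_ge0.
have Gbd y z : `|G y z| <= D * (1 + K) + rho L * L.
  apply: (le_trans (ggrow _ _ (cK y))); apply: lerD.
    by rewrite ler_wpM2l// lerD2l.
  by rewrite ler_pM// ?rho_ge0// rho_mono.
have clamp0 : clamp L 0 = 0 by rewrite clamp_id// normr0.
have Gzero y : `|G y 0| <= D * (1 + `|y|).
  rewrite /G clamp0; apply: (le_trans (ggrow _ _ (cK y))).
  by rewrite normr0 mulr0 addr0 ler_wpM2l// lerD2l clamp_le_norm.
have [u [[cu u0 sub1 sub2] ub ulip appr]] := limit_solution_exists hcd hT hB
  (rho_ge0 _ L0) hD GB GM Gbd Gzero A'0 C0 lipA' hC.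
have uK t x : t \in `[0, T] -> x \in `[c, d] -> `|u t x| <= K.
  move=> tT xcd; apply: (le_trans (ub t x tT xcd)); rewrite (addrC 1).
  by apply: expK; move: tT; rewrite in_itv /= => /andP[].
have uuK t x : t \in `[0, T] -> x \in `[c, d] -> `|- u t x| <= K.
  by move=> tT xcd; rewrite normrN uK.
exists u; split.
- apply/viscosity_solutionP; split => //.
    apply: (subsolution_truncation hcd uK ulip) sub1.
    by move=> y z yK zL; rewrite /G !clamp_id.
  apply: (subsolution_truncation hcd uuK) sub2.
    by move=> t x y tT xcd ycd; rewrite -opprD normrN; exact: ulip.
  by move=> y z yK zL; rewrite /reflect_source /G !clamp_id ?normrN.
- by move=> t x tT xcd; rewrite (addrC C); exact: ub.
move=> _ ggamma _; split; last first.
  move=> h0 _; have L00 : L = 0 by rewrite /L A'h// mul0r.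
  exists (fun t x => G (u t x) 0), (fun _ _ => 0), (fun _ _ => 0); split; last first.
    by move=> t x _ _; rewrite normr0 mulr_ge0 ?expR_ge0// mulr_ge0.
  apply: (@flat_limit_C12 _ T c d hcd (G^~ 0) u B hB) => //.
    move=> t x y tT xcd ycd; apply/eqP; rewrite -subr_eq0 -normr_le0.
    by have := ulip t x y tT xcd ycd; rewrite -/L L00 mul0r.
  move=> e e0; have [f [ft [fx [fxx [[Cf _ res fxL _] fu]]]]] := appr e e0.
  have fx0 t x : fx t x = 0.
    by apply/eqP; rewrite -normr_le0 -L00; exact: fxL.
  exists f, ft, fx, fxx; split => // t x tT xcd.
  by have := res t x tT xcd; rewrite fx0.
move=> v /viscosity_solutionP[cv v0 subv subNv] t x tT xcd.
(* Compactness is the only bound on a competing solution and may exceed [K]. The one-sided condition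
   is taken at the level [max V K]; the slope estimate on [g] is used only at clamped values of the
   approximant. *)
have [V V0 vV] := cont_on_bounded (ltW hT) (ltW hcd) cv.
pose L1 := Num.max V K.
have KL1 : K <= L1 by rewrite le_max lexx orbT.
have vL1 s y : s \in `[0, T] -> y \in `[c, d] -> `|v s y| <= L1.
  by move=> sT ycd; rewrite le_max vV.
have [gam hgam] := ggamma L1 (le_trans K0 KL1).
have gGam y y' z : - L1 <= y' -> y' <= y -> y <= L1 ->
    g y z - g y' z <= `|gam| * (y - y').
  move=> h1 h2 h3; have := hgam y y' z h1 h2 h3.
  have : - gam * (y - y') <= `|gam| * (y - y').
    by rewrite ler_wpM2r ?subr_ge0// -normrN ler_norm.
  lra.
have gN y z z' : `|y| <= K -> `|z| <= L + 1 -> `|z'| <= L + 1 ->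
    `|g y z - g y z'| <= rho (L + 1) * `|z - z'|.
  by move=> yK zL zL'; apply: (le_trans (glipz y z z' yK)); rewrite ler_wpM2r// rhoM.
have rL1 : 0 <= rho (L + 1) by rewrite rho_ge0// addr_ge0.
pose k := 3 * expR ((`|gam| + 1) * T) * (1 + `|gam|).
have k0 : 0 <= k by rewrite !mulr_ge0 ?expR_ge0 ?addr_ge0.
apply/eqP; rewrite -subr_eq0 -normr_le0; apply/ler_addgt0Pr => e e0; rewrite add0r.
have k1 : 0 < k + 1 by rewrite ltr_wpDl.
(* Comparison loses [k * n] and the distance from [f] to [u] another [n]. *)
have n0 : 0 < e / (k + 1) by rewrite divr_gt0.
have [f [ft [fx [fxx [[Cf neu res fxL [fb f0]] fu]]]]] := appr _ n0.
have kn : (k + 1) * (e / (k + 1)) = e by rewrite mulrC divfK// gt_eqF.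
set n := e / (k + 1) in n0 kn res fb f0 fu.
have near s y : s \in `[0, T] -> y \in `[c, d] ->
    `|clamp K (f s y)| <= K /\ `|clamp K (f s y) - f s y| <= n.
  move=> sT ycd; split => //; apply: clamp_near; [exact: K0|exact: ltW|].
  apply: (le_trans (fb s y sT)); rewrite (addrC 1) lerD2r.
  by apply: expK; move: sT; rewrite in_itv /= => /andP[].
have fuv := fu t x tT xcd.
have up : v t x - f t x <= k * n.
  rewrite /k -mulrA.
  apply: (subsolution_le_approximation (p := fun s y => clamp K (f s y)) hT hcd
    _ _ _ KL1 gGam gN cv subv vL1 Cf) => //.
  - exact: ltW.
  - move=> s y sT ycd; have := res s y sT ycd.
    by rewrite /G (clamp_id (fxL s y)).
  - by move=> y ycd; rewrite v0//; apply: le_trans (f0 y ycd); rewrite distrC ler_norm.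
(* The same comparison for [- v] and the reflected source; negation reverses the order of the two
   values in the one-sided condition, which therefore keeps its form. *)
have down : - v t x - - f t x <= k * n.
  rewrite /k -mulrA.
  apply: (@subsolution_le_approximation _ T c d hT hcd (reflect_source g)
    (fun s y => - v s y) (fun s y => - clamp K (f s y)) (fun s y => - f s y)
    (fun s y => - ft s y) (fun s y => - fx s y) (fun s y => - fxx s y)
    K L L1 `|gam| (rho (L + 1)) n) => //.
  - exact: ltW.
  - move=> y y' z h1 h2 h3; rewrite /reflect_source.
    have := gGam (- y') (- y) (- z); rewrite !lerN2 lerNl => /(_ h3 h2).
    by move=> /(_ h1); lra.
  - move=> y z z' yK zL zL'; rewrite /reflect_source -opprD normrN.
    have := gN (- y) (- z) (- z'); rewrite -opprD !normrN; exact.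
  - have := cont_on_lin (k := -2) cv cv; congr cont_on.
    by apply/funext => s; apply/funext => y; ring.
  - by move=> s y sT ycd; rewrite normrN; exact: vL1.
  - exact: is_C12N.
  - by move=> s; have [-> ->] := neu s; rewrite oppr0.
  - by move=> s y; rewrite normrN; exact: fxL.
  - by move=> s y sT ycd; rewrite -opprD !normrN; exact: near.
  - move=> s y sT ycd; have := res s y sT ycd.
    rewrite /G (clamp_id (fxL s y)) /reflect_source !opprK -normrN.
    by congr (`|_| <= _); ring.
  - move=> y ycd; rewrite v0//; have := f0 y ycd.
    by rewrite ler_norml => /andP[? ?]; lra.
move: fuv up down kn; rewrite !ler_norml; clear => /andP[? ?] ? ? ?.
by apply/andP; split; lra.
Qed.
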